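(* Let $(M,\pi)$ be a Poisson manifold and let $X\subset M$ be an embedded submanifold. Then $X$ is coregular if and only if $X$ is the intersection of a Poisson submanifold $P\subset(M,\pi)$ with a transversal $\tau\subset(M,\pi)$.
   Context: For a Poisson manifold $(M,\pi)$, $\pi^\sharp:T^*M\to TM$ is defined by $\langle\pi^\sharp(\alpha),\beta\rangle=\pi(\alpha,\beta)$. An embedded submanifold $X\subset M$ is coregular if the bundle map $\mathrm{pr}\circ\pi^\sharp:T^*M|_X\to TM|_X/TX$ has constant rank. A submanifold $P$ is a Poisson submanifold if $\pi^\sharp(T^*M|_P)\subset TP$. A transversal is an embedded submanifold $\tau\subset M$ that is transverse to the symplectic leaves, i.e. $T_p\tau+\pi^\sharp(T_p^*M)=T_pM$ for all $p\in\tau$. Submanifolds are embedded. *)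

(* Defs.v *)
From HB Require Import structures.
From mathcomp Require Import all_boot all_order all_algebra.
From mathcomp Require Import all_classical all_reals all_analysis.
Set Implicit Arguments.
Unset Strict Implicit.
Unset Printing Implicit Defensive.
Import Order.TTheory GRing.Theory Num.Theory.
Import numFieldNormedType.Exports.
Local Open Scope classical_set_scope.
Local Open Scope ring_scope.

(** * Smooth maps between open subsets of normed spaces

    For finite-dimensional [V], having continuous directional derivatives of
    all orders is the usual notion of C^k.  Only used with [U] open. *)

Fixpoint Ck_on (R : realType) (V W : normedModType R) (k : nat) (U : set V)
    (f : V -> W) : Prop :=
  if k is k'.+1 then
    (forall x, U x -> differentiable f x) /\
    (forall v, Ck_on k' U ('D_v f))
  else forall x, U x -> {for x, continuous f}.

Definition smooth_on (R : realType) (V W : normedModType R) (U : set V)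
    (f : V -> W) : Prop := forall k, Ck_on k U f.

(** * Charts and smooth manifolds *)

(** A homeomorphism between an open subset of [M] and an open subset of R^n;
    the values of [cmap] and [cinv] outside these open sets are irrelevant. *)
Record chart (R : realType) (n : nat) (M : topologicalType) := Chart {
  cdom : set M ;
  cmap : M -> 'rV[R]_n ;
  cinv : 'rV[R]_n -> M ;
  cdom_open : open cdom ;
  crng_open : open (cmap @` cdom) ;
  cmapK : {in cdom, cancel cmap cinv} ;
  cmap_continuous : {in cdom, continuous cmap} ;
  cinv_continuous : {in cmap @` cdom, continuous cinv} }.

Definition crng (R : realType) (n : nat) (M : topologicalType)
  (c : chart R n M) : set 'rV[R]_n := cmap c @` cdom c.

Definition compatible (R : realType) (n : nat) (M : topologicalType)
    (c c' : chart R n M) : Prop :=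
  smooth_on (cmap c @` (cdom c `&` cdom c')) (cmap c' \o cinv c) /\
  smooth_on (cmap c' @` (cdom c `&` cdom c')) (cmap c \o cinv c').

(** The charts [chart_at p] form a smooth atlas.  Since a chart around each
    point is singled out, tangent and cotangent vectors at [p] are represented
    by their coordinates in [chart_at p]: T_p M is ['rV[R]_n] (row vectors) and
    T_p^* M is ['cV[R]_n] (column vectors). *)
HB.mixin Record isSmoothManifold (R : realType) (n : nat) M
    of Topological M := {
  manifold_hausdorff : hausdorff_space M ;
  manifold_second_countable : @second_countable M ;
  chart_at : M -> chart R n M ;
  mem_chart_at : forall p, cdom (chart_at p) p ;
  chart_at_compatible : forall p q, compatible (chart_at p) (chart_at q) }.

#[short(type="smoothManifoldType")]
HB.structure Definition SmoothManifold (R : realType) (n : nat) :=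
  { M of Topological M & isSmoothManifold R n M }.

Definition maximal_atlas (R : realType) (n : nat) (M : smoothManifoldType R n) :
    set (chart R n M) :=
  [set c | forall p : M, compatible c (chart_at p)].

Definition smooth_fun (R : realType) (n : nat) (M : smoothManifoldType R n)
    (f : M -> R) : Prop :=
  forall p : M, smooth_on (crng (chart_at p)) (f \o cinv (chart_at p)).

Definition pairing (R : realType) (n : nat)
  (v : 'rV[R]_n) (alpha : 'cV[R]_n) : R := (v *m alpha) 0 0.

(** The differential at [p] of a function defined near [p]. *)
Definition dfun (R : realType) (n : nat) (M : smoothManifoldType R n)
    (f : M -> R) (p : M) : 'cV[R]_n :=
  \col_i 'D_(delta_mx 0 i) (f \o cinv (chart_at p)) (cmap (chart_at p) p).

(** * Poisson structures *)

(** The value at a pair of covectors of the bivector with matrix [B]. *)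
Definition bivector (R : realType) (n : nat) (B : 'M[R]_n)
  (alpha beta : 'cV[R]_n) : R := (alpha^T *m B *m beta) 0 0.

Definition bracket (R : realType) (n : nat) (M : smoothManifoldType R n)
    (B : M -> 'M[R]_n) (f g : M -> R) (p : M) : R :=
  bivector (B p) (dfun f p) (dfun g p).

(** [pi_mx p] is the matrix of the bivector pi_p in the basis of T_p M given
    by [chart_at p].  Smoothness is that of the components pi(dc_i, dc_j) in
    each chart c of the atlas; the Jacobi identity of the bracket
    {f,g} = pi(df,dg) amounts to [pi,pi] = 0. *)
Record poisson_structure (R : realType) (n : nat)
    (M : smoothManifoldType R n) := PoissonStructure {
  pi_mx : M -> 'M[R]_n ;
  pi_antisym : forall p, (pi_mx p)^T = - pi_mx p ;
  pi_smooth : forall (q : M) (i j : 'I_n),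
    smooth_on (crng (chart_at q))
      (bracket pi_mx (fun x => cmap (chart_at q) x 0 i)
                     (fun x => cmap (chart_at q) x 0 j)
         \o cinv (chart_at q)) ;
  pi_jacobi : forall f g h : M -> R,
    smooth_fun f -> smooth_fun g -> smooth_fun h ->
    forall p, bracket pi_mx f (bracket pi_mx g h) p
            + bracket pi_mx g (bracket pi_mx h f) p
            + bracket pi_mx h (bracket pi_mx f g) p = 0 }.

Definition sharp (R : realType) (n : nat) (M : smoothManifoldType R n)
    (pi : poisson_structure M) (p : M) (alpha : 'cV[R]_n) : 'rV[R]_n :=
  alpha^T *m pi_mx pi p.

Lemma sharpP (R : realType) (n : nat) (M : smoothManifoldType R n)
    (pi : poisson_structure M) (p : M) (alpha beta : 'cV[R]_n) :
  pairing (sharp pi p alpha) beta = bivector (pi_mx pi p) alpha beta.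
Proof. by []. Qed.

(** * Submanifolds *)

(** Slice charts; submanifolds have a well-defined dimension [k], are not
    assumed closed, and may be empty or disconnected. *)
Definition embedded_submanifold (R : realType) (n : nat)
    (M : smoothManifoldType R n) (X : set M) : Prop :=
  exists2 k, (k <= n)%N &
    forall p, X p -> exists c, [/\ maximal_atlas c, cdom c p &
      forall q, cdom c q ->
        (X q <-> forall i : 'I_n, (k <= i)%N -> cmap c q 0 i = 0)].

(** T_p X inside T_p M: the velocities at time 0 of the smooth curves through
    [p] which lie in [X]. *)
Definition tangent_space (R : realType) (n : nat) (M : smoothManifoldType R n)
    (X : set M) (p : M) : set 'rV[R]_n :=
  [set v | exists (e : R) (gamma : R -> M),
    [/\ 0 < e, gamma 0 = p,
        (forall t, ball 0 e t -> X (gamma t) /\ cdom (chart_at p) (gamma t)),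
        smooth_on (ball (0 : R) e) (cmap (chart_at p) \o gamma) &
        'D_1 (cmap (chart_at p) \o gamma) 0 = v]].

(** [A] is any matrix whose row space is T_p X, so that [v |-> v *m cokermx A]
    has kernel T_p X and represents the projection T_p M -> T_p M / T_p X;
    the matrix [pi_mx pi p *m cokermx A] then represents pr o pi^sharp at [p]. *)
Definition coregular (R : realType) (n : nat) (M : smoothManifoldType R n)
    (pi : poisson_structure M) (X : set M) : Prop :=
  exists r : nat, forall p, X p ->
    exists2 A : 'M[R]_n, (forall v, (v <= A)%MS <-> tangent_space X p v) &
      \rank (pi_mx pi p *m cokermx A) = r.

Definition poisson_submanifold (R : realType) (n : nat)
    (M : smoothManifoldType R n) (pi : poisson_structure M) (P : set M) : Prop :=
  embedded_submanifold P /\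
  forall p, P p -> forall alpha, tangent_space P p (sharp pi p alpha).

(** Transverse to the symplectic leaves, whose tangent spaces are the images of
    pi^sharp; not to be confused with "Poisson transversals". *)
Definition leaf_transversal (R : realType) (n : nat) (M : smoothManifoldType R n)
    (pi : poisson_structure M) (tau : set M) : Prop :=
  embedded_submanifold tau /\
  forall p, tau p -> forall v, exists u alpha,
    tangent_space tau p u /\ v = u + sharp pi p alpha.

(* Main.v *)
From HB Require Import structures.
Require Import Defs.
From mathcomp Require Import all_boot all_order all_algebra.
From mathcomp Require Import all_classical all_reals all_analysis.
From mathcomp Require Import ring lra zify.
From mathcomp Require Import perm.
Set Implicit Arguments.
Unset Strict Implicit.
Unset Printing Implicit Defensive.
Import Order.TTheory GRing.Theory Num.Theory.
Import numFieldNormedType.Exports.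
Local Open Scope classical_set_scope.
Local Open Scope ring_scope.

(** Let X have dimension k and let r be the rank of pr o pi^sharp along X.

    Construction of P.  If r > 0, near a point of X some Hamiltonian vector
    field X_f is not tangent to X.  In a chart where X_f = d/dx_k the bivector
    does not depend on x_k, by the Jacobi identity, so that the flow-out of X
    along X_f is a submanifold of dimension k + 1 whose normal rank is r - 1.
    After r steps one gets a Poisson submanifold of dimension k + r which
    contains X near the point.  Any Poisson submanifold is preserved by the
    Hamiltonian flows, so this one lies in every other which contains X near
    the point; hence its germ along X is unique and the local pieces glue.

    Construction of tau.  With weights al_i and maps g_i : M -> R^n which are
    charts where al_i <> 0, call y normal to P at x in X when
    sum_i al_i(x) <g_i(y) - g_i(x), dg_i(x) v> = 0 for all v in T_x P.  The
    points y that are normal to P at a nearby point of X form a submanifold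
    which is complementary to P along X; this description being intrinsic, the
    local pieces glue again.  Transversality to the leaves holds on X, because
    T_x P = T_x X + im pi^sharp there, and is an open condition.

    Conversely, if X is the intersection of P and tau, then
    T_x X = T_x P n T_x tau and im pi^sharp is contained in T_x P, hence
    T_x P = T_x X + im pi^sharp; the rank of pr o pi^sharp is therefore
    dim P - dim X = dim M - dim tau. *)

(** * Smooth germs *)

(** The flow is a limit of Euler polygons: the derivative of an Euler iterate is an Euler iterate of
    the tangent lift of the field, so smooth dependence on the initial point is convergence for the
    lift, and the induction on the order repeats one statement. The obstacle on both sides of the
    construction is that pieces built in charts depend on choices, while [embedded_submanifold] asks
    for one set. Two pieces of P are compared through a one-sided statement, minimality, used twice
    with the roles exchanged. Two pieces of tau are compared through a condition written with
    functions defined on all of M; the weighted charts take the place of a metric and its normal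
    exponential map. The form behind this condition is positive definite because the weights are
    non-negative and some chart has positive weight at each point; this makes the implicit equations
    solvable for every P. Each flow-out lowers the normal rank by exactly one: the coefficients of
    pi are constant along the flow lines, so the rank on X propagates, and the bracket of f with the
    coordinates is a unit row, which the enlarged submanifold removes from the normal part. *)

Section Ck.
Context {R : realType}.
Implicit Types V W : normedModType R.

(** One neighbourhood serves all orders [k], so that a smooth germ is represented by a map that is
    smooth on an open set ([smooth_atP]). *)
Definition smooth_at V W (f : V -> W) (x : V) : Prop :=
  \forall y \near x, forall k, Ck_on k [set y] f.

Lemma Ck_onS V W k (U : set V) (f : V -> W) : Ck_on k.+1 U f <->
  (forall x, U x -> differentiable f x) /\ (forall v, Ck_on k U ('D_v f)).
Proof. by []. Qed.

(** Continuity and differentiability in [Ck_on] are those of [f] on the whole of [V] at points of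
    [U], never of a restriction to [U]; hence singletons are legitimate domains. *)
Lemma Ck_onP V W k (U : set V) (f : V -> W) :
  Ck_on k U f <-> forall x, U x -> Ck_on k [set x] f.
Proof.
elim: k f => [|k IH] f /=; split.
- by move=> h x Ux y ->; apply: h.
- by move=> h x Ux; apply: (h x Ux).
- move=> [h1 h2] x Ux; split=> [y ->|v]; first exact: h1.
  by have /IH := h2 v; apply.
- move=> h; split=> [x Ux|v]; first by apply: (h x Ux).1.
  by apply/IH => x Ux; apply: (h x Ux).2.
Qed.

Lemma Ck_on_sub V W k (U U' : set V) (f : V -> W) :
  U' `<=` U -> Ck_on k U f -> Ck_on k U' f.
Proof. by move=> UU /Ck_onP h; apply/Ck_onP => x /UU; apply: h. Qed.

Lemma Ck_onW V W k (U : set V) (f : V -> W) : Ck_on k.+1 U f -> Ck_on k U f.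
Proof.
elim: k f => [|k IH] f /= [h1 h2].
  by move=> x Ux; apply: differentiable_continuous; apply: h1.
by split=> // v; apply: IH; apply: h2.
Qed.

Lemma near_eq_differentiable V W (f g : V -> W) x :
  (\forall y \near x, f y = g y) -> differentiable f x -> differentiable g x.
Proof.
move=> fg df.
have fgx : f x = g x by exact: nbhs_singleton fg.
have [dc e] := (diff_locallyP x f).1 df.
apply/diff_locallyP.
have key : g \o shift x = cst (g x) + 'd f x +o_ (0 : V) id.
  apply/eqaddoP => eps eps0.
  have fg0 : \forall h \near (0:V), f (h + x) = g (h + x).
    by move: fg; rewrite (near_shift 0 x); apply: filterS => h /=; rewrite subr0.
  have e2 : f \o shift x = cst (f x) + 'd f x +o_ (0 : V) id by [].
  move/eqaddoP : e2 => /(_ _ eps0) e2.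
  near=> h.
  have -> : (g \o shift x - (cst (g x) + 'd f x)) h = (f \o shift x - (cst (f x) + 'd f x)) h.
    rewrite /= !fctE /= -fgx; congr (_ - _).
    by symmetry; near: h.
  by near: h.
have lf : 'd g x = 'd f x :> (V -> W) by apply: diff_unique.
by rewrite lf.
Unshelve. all: by end_near. Qed.

Lemma near_near (T : topologicalType) (x : T) (P : set T) :
  (\forall y \near x, P y) -> \forall y \near x, \forall z \near y, P z.
Proof. by move=> h; apply: near_join. Qed.

Lemma Ck_on_eq V W k (U : set V) (f g : V -> W) :
  (forall x, U x -> \forall y \near x, f y = g y) -> Ck_on k U f -> Ck_on k U g.
Proof.
elim: k f g => [|k IH] f g fg /=.
  move=> h x Ux; have fgx := fg x Ux.
  have e : f x = g x by exact: nbhs_singleton fgx.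
  have := h x Ux; rewrite /prop_for /continuous_at e; apply: cvg_trans.
  exact: near_eq_cvg.
move=> [h1 h2]; split=> [x Ux|v].
  exact: near_eq_differentiable (fg x Ux) (h1 x Ux).
apply: IH (h2 v) => x Ux; have := near_near (fg x Ux).
by apply: filterS => y; apply: near_eq_derive.
Qed.

Lemma smooth_at_near_eq V W (f g : V -> W) x :
  (\forall y \near x, f y = g y) -> smooth_at f x -> smooth_at g x.
Proof.
move=> /near_near fg h; rewrite /smooth_at; apply: filterS2 fg h => y fg h k.
by apply: (@Ck_on_eq _ _ _ _ f) => // _ ->.
Qed.

Lemma smooth_onP V W (U : set V) (f : V -> W) : open U ->
  smooth_on U f <-> forall x, U x -> smooth_at f x.
Proof.
move=> oU; split=> [h x Ux|h k].
  have : \forall y \near x, U y by exact: open_nbhs_nbhs.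
  by apply: filterS => y Uy k; apply: (Ck_onP k U f).1 => //; apply: h.
by apply/Ck_onP => x Ux; have /nbhs_singleton := h x Ux.
Qed.

Lemma smooth_atP V W (f : V -> W) x :
  smooth_at f x <-> exists U, [/\ open U, U x & smooth_on U f].
Proof.
split=> [|[U [oU Ux /smooth_onP h]]]; last exact: h.
move=> h; have : nbhs x (fun y => forall k, Ck_on k [set y] f) by exact: h.
rewrite nbhsE => -[U [oU Ux] {}h]; exists U; split=> //.
by move=> k; apply/Ck_onP => y Uy; apply: h.
Qed.

Lemma smooth_at_nbhs V W (f : V -> W) x :
  smooth_at f x -> \forall y \near x, smooth_at f y.
Proof. exact: near_near. Qed.

Lemma smooth_at_derive V W (f : V -> W) x v :
  smooth_at f x -> smooth_at ('D_v f) x.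
Proof. by rewrite /smooth_at; apply: filterS => y h k; have /Ck_onS[_] := h k.+1; apply. Qed.

Lemma smooth_at_differentiable V W (f : V -> W) x :
  smooth_at f x -> differentiable f x.
Proof. by move=> /nbhs_singleton /(_ 1%N) [h _]; apply: h. Qed.

Lemma smooth_at_continuous V W (f : V -> W) x :
  smooth_at f x -> {for x, continuous f}.
Proof.
by move=> /smooth_at_differentiable; apply: differentiable_continuous.
Qed.

Lemma Ck_cst V W k (U : set V) (a : W) : Ck_on k U (fun=> a).
Proof.
elim: k a => [|k IH] a /=; first by move=> x _; apply: cst_continuous.
split=> [x _|v]; first exact: differentiable_cst.
suff -> : 'D_v (fun=> a) = fun=> 0 :> W by [].
by apply/funext => x; rewrite derive_cst.
Qed.

Lemma smooth_at_cst V W (a : W) (x : V) : smooth_at (fun=> a) x.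
Proof. by apply: nearW => y k; apply: Ck_cst. Qed.

Lemma Ck_lin V W k (U : set V) (f : {linear V -> W}) :
  continuous f -> Ck_on k U f.
Proof.
case: k => [|k] cf /=; first by move=> x _; apply: cf.
split=> [x _|v]; first by apply: linear_differentiable.
suff -> : 'D_v f = fun=> f v by exact: Ck_cst.
apply/funext => x; rewrite deriveE; last exact: linear_differentiable.
by rewrite diff_lin.
Qed.

Lemma smooth_at_lin V W (f : {linear V -> W}) x : continuous f -> smooth_at f x.
Proof. by move=> cf; apply: nearW => y k; apply: Ck_lin. Qed.

Lemma CkD V W k (U : set V) (f g : V -> W) : open U ->
  Ck_on k U f -> Ck_on k U g -> Ck_on k U (fun x => f x + g x).
Proof.
move=> oU; elim: k f g => [|k IH] f g /=.
  by move=> hf hg x Ux; apply: cvgD; [apply: hf|apply: hg].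
move=> [f1 f2] [g1 g2]; split=> [x Ux|v].
  by apply: differentiableD; [apply: f1|apply: g1].
apply: (@Ck_on_eq _ _ _ _ (fun x => 'D_v f x + 'D_v g x)); last exact: IH.
move=> x Ux; have : \forall y \near x, U y by exact: open_nbhs_nbhs.
apply: filterS => y Uy; symmetry; apply: deriveD; apply: diff_derivable; auto.
Qed.

Lemma Ck_sum V W k (U : set V) (I : Type) (r : seq I) (P : pred I)
    (f : I -> V -> W) : open U -> (forall i, P i -> Ck_on k U (f i)) ->
  Ck_on k U (fun x => \sum_(i <- r | P i) f i x).
Proof.
move=> oU h; elim: r => [|i r IH].
  apply: (@Ck_on_eq _ _ _ _ (fun=> 0)); last exact: Ck_cst.
  by move=> x _; apply: nearW => y; rewrite big_nil.
apply: (@Ck_on_eq _ _ _ _ (fun x => (if P i then f i x else 0) +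
    \sum_(j <- r | P j) f j x)).
  move=> x _; apply: nearW => y; rewrite big_cons; case: ifP => // _.
  by rewrite add0r.
apply: CkD => //; case Pi : (P i); [exact: h|exact: Ck_cst].
Qed.

Lemma CkM V k (U : set V) (f g : V -> R) : open U ->
  Ck_on k U f -> Ck_on k U g -> Ck_on k U (fun x => f x * g x).
Proof.
move=> oU; elim: k f g => [|k IH] f g.
  by move=> /= hf hg x Ux; apply: cvgM; [apply: hf|apply: hg].
move=> hf hg; have fk := Ck_onW hf; have gk := Ck_onW hg.
case/Ck_onS: hf => f1 f2; case/Ck_onS: hg => g1 g2; apply/Ck_onS; split=> [x Ux|v].
  by apply: differentiableM; [apply: f1|apply: g1].
apply: (@Ck_on_eq _ _ _ _ (fun x => f x * 'D_v g x + g x * 'D_v f x)).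
  move=> x Ux; have : \forall y \near x, U y by exact: open_nbhs_nbhs.
  by apply: filterS => y Uy; symmetry; rewrite deriveM//;
    apply: diff_derivable; auto.
by apply: CkD => //; apply: IH.
Qed.

Lemma CkV V k (U : set V) (f : V -> R) : open U -> (forall x, U x -> f x != 0) ->
  Ck_on k U f -> Ck_on k U (fun x => (f x)^-1).
Proof.
move=> oU f0; elim: k => [|k IH].
  by move=> /= hf x Ux; apply: cvgV; [exact: f0|apply: hf].
move=> hf; have fk := Ck_onW hf; case/Ck_onS: hf => [f1 f2]; apply/Ck_onS; split=> [x Ux|v].
  by apply: differentiableV; [apply: f1|apply: f0].
apply: (@Ck_on_eq _ _ _ _ (fun x => (-1) * ((f x)^-1 * (f x)^-1 * 'D_v f x))).
  move=> x Ux; have : \forall y \near x, U y by exact: open_nbhs_nbhs.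
  apply: filterS => y Uy; symmetry; rewrite deriveV; [|by auto|].
    rewrite mulN1r scaleNr; congr (- _); rewrite /GRing.scale /=.
    by rewrite -expr2 exprVn.
  apply: diff_derivable; auto.
have ik := IH fk; apply: CkM => //; first exact: Ck_cst.
by apply: CkM => //; apply: CkM.
Qed.

Lemma derive_lin_comp V V' W (L : {linear V' -> W}) (f : V -> V') x v :
  continuous L -> differentiable f x ->
  'D_v (fun y => L (f y)) x = L ('D_v f x).
Proof.
move=> cL df.
have dL : differentiable L (f x) by exact: linear_differentiable.
rewrite deriveE; last exact: (differentiable_comp (g := L)).
by rewrite (diff_comp (g := L)) //= diff_lin // deriveE.
Qed.

Lemma Ck_lin_comp V V' W k (U : set V) (L : {linear V' -> W}) (f : V -> V') :
  open U -> continuous L -> Ck_on k U f -> Ck_on k U (fun x => L (f x)).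
Proof.
move=> oU cL; elim: k f => [|k IH] f.
  by move=> /= hf x Ux; apply: (continuous_comp (hf x Ux)); apply: cL.
case/Ck_onS=> [f1 f2]; apply/Ck_onS; split=> [x Ux|v].
  by apply: (differentiable_comp (g := L)); [exact: f1|exact: linear_differentiable].
apply: (@Ck_on_eq _ _ _ _ (fun x => L ('D_v f x))); last by apply: IH.
move=> x Ux; have : \forall y \near x, U y by exact: open_nbhs_nbhs.
by apply: filterS => y Uy; rewrite derive_lin_comp //; apply: f1.
Qed.

Lemma derive_comp V V' W (f : V -> V') (g : V' -> W) x v :
  differentiable f x -> differentiable g (f x) ->
  'D_v (g \o f) x = 'D_('D_v f x) g (f x).
Proof.
move=> df dg; rewrite deriveE; last exact: differentiable_comp.
by rewrite diff_comp //= !deriveE.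
Qed.

(** In the chain rule the direction of differentiation of [g] moves with the point. Expanding it in
    a basis leaves the fixed directions [b i], and the induction hypothesis applies to each
    ['D_(b i) g]. *)
Lemma Ck_comp_basis V V' k (U : set V) (I : finType) (b : I -> V')
    (l : I -> {linear V' -> R}) (f : V -> V') (g : V' -> R) :
  (forall v, v = \sum_i l i v *: b i) -> (forall i, continuous (l i)) ->
  open U -> Ck_on k U f -> (forall x, U x -> Ck_on k [set f x] g) ->
  Ck_on k U (g \o f).
Proof.
move=> bE lc oU; elim: k g => [|k IH] g.
  by move=> /= hf hg x Ux; apply: continuous_comp; [exact: hf|exact: (hg x Ux)].
move=> hf hg; have fk := Ck_onW hf; case/Ck_onS: hf => [f1 f2].
have g1 x : U x -> differentiable g (f x) by move=> Ux; have [h _] := hg x Ux; apply: h.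
apply/Ck_onS; split=> [x Ux|v]; first by apply: differentiable_comp; auto.
apply: (@Ck_on_eq _ _ _ _ (fun x => \sum_i l i ('D_v f x) * ('D_(b i) g \o f) x)).
  move=> x Ux; have : \forall y \near x, U y by exact: open_nbhs_nbhs.
  apply: filterS => y Uy; symmetry; rewrite derive_comp; [|by auto|by auto].
  rewrite deriveE; last by auto.
  rewrite {1}[X in 'd _ _ X]bE linear_sum; apply: eq_bigr => i _.
  have dg := g1 y Uy; rewrite linearZ; congr (_ * _).
  by rewrite /= deriveE.
apply: Ck_sum => // i _; apply: CkM => //; first exact: Ck_lin_comp.
by apply: IH => // x Ux; have [_] := hg x Ux; apply.
Qed.

Definition scale_by W (w : W) (a : R) : W := a *: w.

Lemma scale_by_is_linear W (w : W) : linear (scale_by w).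
Proof. by move=> a u v; rewrite /scale_by scalerDl scalerA. Qed.

HB.instance Definition _ W (w : W) := GRing.isLinear.Build R R W _
  (scale_by w) (@scale_by_is_linear W w).

Section rV.
Context {V : normedModType R}.

Definition rV_coord m (i : 'I_m) (v : 'rV[R]_m) : R := v 0 i.

Lemma rV_coord_is_linear m (i : 'I_m) : linear (rV_coord i).
Proof. by move=> a u v; rewrite /rV_coord !mxE. Qed.

HB.instance Definition _ m (i : 'I_m) := GRing.isLinear.Build R 'rV[R]_m R _
  (rV_coord i) (@rV_coord_is_linear m i).

Lemma rV_coord_continuous m (i : 'I_m) : continuous (rV_coord i).
Proof. by move=> x; apply: coord_continuous. Qed.

Lemma Ck_coord m k (U : set V) (f : V -> 'rV[R]_m) j : open U ->
  Ck_on k U f -> Ck_on k U (fun x => f x 0 j).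
Proof.
by move=> oU; apply: (Ck_lin_comp (L := rV_coord j)) => //; apply: rV_coord_continuous.
Qed.

Lemma Ck_rV m k (U : set V) (f : V -> 'rV[R]_m) : open U ->
  (forall j, Ck_on k U (fun x => f x 0 j)) -> Ck_on k U f.
Proof.
move=> oU h.
apply: (@Ck_on_eq _ _ _ _ (fun x => \sum_j f x 0 j *: delta_mx 0 j)).
  by move=> x _; apply: nearW => y; rewrite -row_sum_delta.
apply: Ck_sum => // j _.
apply: (Ck_lin_comp (L := scale_by (delta_mx 0 j : 'rV[R]_m))) => //.
exact: scalel_continuous.
Qed.

Lemma Ck_comp m k (U : set V) (f : V -> 'rV[R]_m) (g : 'rV[R]_m -> R) :
  open U -> Ck_on k U f -> (forall x, U x -> Ck_on k [set f x] g) ->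
  Ck_on k U (g \o f).
Proof.
apply: (@Ck_comp_basis _ _ _ _ _ (fun j => delta_mx 0 j) (@rV_coord m)).
- by move=> v; rewrite -row_sum_delta.
- exact: rV_coord_continuous.
Qed.

Lemma smooth_atD (W : normedModType R) (f g : V -> W) x :
  smooth_at f x -> smooth_at g x -> smooth_at (fun x => f x + g x) x.
Proof.
move=> /smooth_atP[U [oU Ux fU]] /smooth_atP[U' [oU' U'x gU]].
apply/smooth_atP; exists (U `&` U'); split=> //; first exact: openI.
have oI : open (U `&` U') by exact: openI.
by move=> k; apply: CkD => //; [move: (fU k)|move: (gU k)];
  apply: Ck_on_sub => y [].
Qed.

Lemma smooth_at_sum (W : normedModType R) (I : Type) (r : seq I) (P : pred I)
    (f : I -> V -> W) x : (forall i, P i -> smooth_at (f i) x) ->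
  smooth_at (fun x => \sum_(i <- r | P i) f i x) x.
Proof.
move=> h; elim: r => [|i r IH].
  apply: (@smooth_at_near_eq _ _ (fun=> 0)); last exact: smooth_at_cst.
  by apply: nearW => y; rewrite big_nil.
apply: (@smooth_at_near_eq _ _ (fun x => (if P i then f i x else 0) +
    \sum_(j <- r | P j) f j x)).
  apply: nearW => y; rewrite big_cons; case: ifP => // _.
  by rewrite add0r.
by apply: smooth_atD => //; case Pi : (P i); [exact: h|exact: smooth_at_cst].
Qed.

Lemma smooth_atM (f g : V -> R) x :
  smooth_at f x -> smooth_at g x -> smooth_at (fun x => f x * g x) x.
Proof.
move=> /smooth_atP[U [oU Ux fU]] /smooth_atP[U' [oU' U'x gU]].
apply/smooth_atP; exists (U `&` U'); split=> //; first exact: openI.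
have oI : open (U `&` U') by exact: openI.
by move=> k; apply: CkM => //; [move: (fU k)|move: (gU k)];
  apply: Ck_on_sub => y [].
Qed.

Lemma smooth_at_prod (I : Type) (r : seq I) (P : pred I)
    (f : I -> V -> R) x : (forall i, P i -> smooth_at (f i) x) ->
  smooth_at (fun x => \prod_(i <- r | P i) f i x) x.
Proof.
move=> h; elim: r => [|i r IH].
  apply: (@smooth_at_near_eq V R (fun=> 1)); last exact: smooth_at_cst.
  by apply: nearW => y; rewrite big_nil.
apply: (@smooth_at_near_eq V R (fun x => (if P i then f i x else 1) *
    \prod_(j <- r | P j) f j x)).
  apply: nearW => y; rewrite big_cons; case: ifP => // _.
  by rewrite mul1r.
by apply: smooth_atM => //; case Pi : (P i); [exact: h|exact: smooth_at_cst].
Qed.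

Lemma smooth_at_lin_comp (V' W : normedModType R) (L : {linear V' -> W})
    (f : V -> V') x :
  continuous L -> smooth_at f x -> smooth_at (fun x => L (f x)) x.
Proof.
move=> cL /smooth_atP[U [oU Ux fU]]; apply/smooth_atP; exists U; split=> // k.
exact: Ck_lin_comp.
Qed.

Lemma smooth_at_coord m (f : V -> 'rV[R]_m) x j :
  smooth_at f x -> smooth_at (fun x => f x 0 j) x.
Proof.
by apply: (smooth_at_lin_comp (L := rV_coord j)); apply: rV_coord_continuous.
Qed.

Lemma smooth_at_scalel (W : normedModType R) (h : V -> R) (w : W) x :
  smooth_at h x -> smooth_at (fun x => h x *: w) x.
Proof.
by apply: (smooth_at_lin_comp (L := scale_by w)); apply: scalel_continuous.
Qed.

Lemma smooth_atZ (W : normedModType R) (f : V -> W) (a : R) x :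
  smooth_at f x -> smooth_at (fun x => a *: f x) x.
Proof.
by apply: (smooth_at_lin_comp (L := *:%R a)); apply: scaler_continuous.
Qed.

Lemma smooth_atN (W : normedModType R) (f : V -> W) x :
  smooth_at f x -> smooth_at (fun x => - f x) x.
Proof.
move=> /(smooth_atZ (-1)); apply: smooth_at_near_eq.
by apply: nearW => y; rewrite scaleN1r.
Qed.

Lemma smooth_atB (W : normedModType R) (f g : V -> W) x :
  smooth_at f x -> smooth_at g x -> smooth_at (fun x => f x - g x) x.
Proof. by move=> sf sg; apply: smooth_atD => //; exact: smooth_atN. Qed.

Lemma smooth_at_rV m (f : V -> 'rV[R]_m) x :
  (forall j, smooth_at (fun x => f x 0 j) x) -> smooth_at f x.
Proof.
move=> h.
apply: (@smooth_at_near_eq _ _ (fun x => \sum_j f x 0 j *: delta_mx 0 j)).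
  by apply: nearW => y; rewrite -row_sum_delta.
by apply: smooth_at_sum => // j _; apply: smooth_at_scalel.
Qed.

Lemma smooth_at_row m (f : 'I_m -> V -> R) x :
  (forall j, smooth_at (f j) x) -> smooth_at (fun x => \row_j f j x) x.
Proof.
move=> h; apply: smooth_at_rV => j; apply: smooth_at_near_eq (h j).
by apply: nearW => y; rewrite mxE.
Qed.

Lemma smooth_at_mulmx m p (A : 'M[R]_(m, p)) (f : V -> 'rV[R]_m) x :
  smooth_at f x -> smooth_at (fun x => f x *m A) x.
Proof.
move=> sf; apply: smooth_at_rV => j.
apply: (@smooth_at_near_eq _ _ (fun x => \sum_i f x 0 i * A i j)).
  by apply: nearW => y; rewrite mxE.
apply: smooth_at_sum => i _; apply: smooth_atM; first exact: smooth_at_coord.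
exact: smooth_at_cst.
Qed.

Lemma smooth_at_comp_basis (V' : normedModType R) (I : finType) (b : I -> V')
    (l : I -> {linear V' -> R}) (f : V -> V') (g : V' -> R) x :
  (forall v, v = \sum_i l i v *: b i) -> (forall i, continuous (l i)) ->
  smooth_at f x -> smooth_at g (f x) -> smooth_at (g \o f) x.
Proof.
move=> bE lc sf sg; have cf := smooth_at_continuous sf.
have [U [oU Ux fU]] := (smooth_atP f x).1 sf.
apply/smooth_atP.
have [U' [oU' U'x gU]] : exists U', [/\ open U', U' x &
    forall y, U' y -> forall k, Ck_on k [set f y] g].
  have : nbhs x (fun y => forall k, Ck_on k [set f y] g) by exact: (cf _ sg).
  by rewrite nbhsE => -[U' [? ?] ?]; exists U'.
exists (U `&` U'); split=> //; first exact: openI.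
move=> k; apply: (Ck_comp_basis bE lc); first exact: openI.
- by move: (fU k); apply: Ck_on_sub => y [].
- by move=> y [_] /gU.
Qed.

Lemma smooth_at_comp1 (f : V -> R) (g : R -> R) x :
  smooth_at f x -> smooth_at g (f x) -> smooth_at (g \o f) x.
Proof.
apply: (@smooth_at_comp_basis R unit (fun=> (1 : R)) (fun=> idfun)).
- by move=> v; rewrite big_const cardT enumT unlock /= addr0 /GRing.scale /= mulr1.
- by move=> _ y; apply: cvg_id.
Qed.

Lemma smooth_at_compR m (f : V -> 'rV[R]_m) (g : 'rV[R]_m -> R) x :
  smooth_at f x -> smooth_at g (f x) -> smooth_at (g \o f) x.
Proof.
apply: (@smooth_at_comp_basis _ _ (fun j => delta_mx 0 j) (@rV_coord m)).
- by move=> v; rewrite -row_sum_delta.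
- exact: rV_coord_continuous.
Qed.

Lemma smooth_atV (f : V -> R) x : f x != 0 ->
  smooth_at f x -> smooth_at (fun x => (f x)^-1) x.
Proof.
move=> fx0 sf; have cf := smooth_at_continuous sf.
have [U [oU Ux fU]] := (smooth_atP f x).1 sf.
apply/smooth_atP.
have [U' [oU' U'x gU]] : exists U', [/\ open U', U' x &
    forall y, U' y -> f y != 0].
  have : nbhs x (fun y => f y != 0) by exact: cvgr_neq0 cf fx0.
  by rewrite nbhsE => -[U' [? ?] ?]; exists U'.
exists (U `&` U'); split=> //; first exact: openI.
move=> k; apply: CkV; first exact: openI.
- by move=> y [_] /gU.
- by move: (fU k); apply: Ck_on_sub => y [].
Qed.

End rV.

Lemma smooth_at_comp V m p (f : V -> 'rV[R]_m) (g : 'rV[R]_m -> 'rV[R]_p) x :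
  smooth_at f x -> smooth_at g (f x) -> smooth_at (g \o f) x.
Proof.
move=> sf sg; apply: smooth_at_rV => j.
by apply: (@smooth_at_compR V m f (fun y => g y 0 j)) => //; exact: smooth_at_coord.
Qed.

End Ck.

(** * Mean value estimates and Lipschitz bounds *)

Section estimates.
Context {R : realType}.
Implicit Types V W : normedModType R.

Lemma nbhsW (T : topologicalType) (P : set T) (x : T) :
  (forall y, P y) -> \forall y \near x, P y.
Proof. exact: nearW. Qed.

Lemma near_forall (T : topologicalType) (I : finType) (P : I -> set T) (x : T) :
  (forall i, \forall y \near x, P i y) -> \forall y \near x, forall i, P i y.
Proof. exact: filter_forall. Qed.

Lemma rV_norm_le n (v : 'rV[R]_n) K : 0 <= K ->
  (forall j, `|v 0 j| <= K) -> `|v| <= K.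
Proof.
move=> K0 h; have [/= ->//|[[i j] e]] : `|v| = 0 \/ exists i, `|v| = `|v i.1 i.2|.
  have [e|n0] := eqVneq (mx_norm v) 0; first by left.
  by right; have [i e] := mx_norm_neq0 n0; exists i.
by rewrite e /= (ord1 i).
Qed.

Lemma rV_coord_le n (v : 'rV[R]_n) j : `|v 0 j| <= `|v|.
Proof. by rewrite [leRHS]mx_normrE (le_bigmax _ _ (0, j)). Qed.

Lemma diff_eps V W (f : V -> W) x : differentiable f x -> forall e : R, 0 < e ->
  \forall h \near (0 : V), `|f (h + x) - f x - 'd f x h| <= e * `|h|.
Proof.
move=> /diff_locallyP[_ E] e e0; move/eqaddoP: E => /(_ _ e0).
by apply: filterS => h; rewrite /= !fctE /= opprD addrA.
Qed.

Lemma differentiable_eps V W (f : V -> W) x (L : {linear V -> W}) :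
  continuous L -> (forall e : R, 0 < e ->
    \forall h \near (0 : V), `|f (h + x) - f x - L h| <= e * `|h|) ->
  differentiable f x /\ 'd f x = L :> (V -> W).
Proof.
move=> cL h.
have key : f \o shift x = cst (f x) + L +o_ (0 : V) id.
  apply/eqaddoP => e e0; apply: filterS (h e e0) => y /=.
  by rewrite !fctE /= opprD addrA.
have dL : 'd f x = L :> (V -> W) by apply: diff_unique.
by split=> //; apply/diff_locallyP; rewrite dL.
Qed.

Lemma derive_rV n W (f : 'rV[R]_n -> W) x v : differentiable f x ->
  'D_v f x = \sum_i v 0 i *: 'D_(delta_mx 0 i) f x.
Proof.
move=> df; rewrite deriveE // {1}[v]row_sum_delta linear_sum.
by apply: eq_bigr => i _; rewrite linearZ /= deriveE.
Qed.

Lemma derive_along V W (f : V -> W) x h (t : R) : differentiable f (x + t *: h) ->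
  is_derive t 1 (fun t : R => f (x + t *: h)) ('D_h f (x + t *: h)).
Proof.
move=> df.
have dg : is_derive t (1 : R) (fun t : R => x + t *: h) h.
  have d1 : differentiable (scale_by h) t.
    by apply: linear_differentiable; apply: scalel_continuous.
  apply: DeriveDef.
    by apply: diff_derivable; apply: differentiableD.
  rewrite deriveD; [|exact: derivable_cst|exact: diff_derivable].
  rewrite derive_cst add0r -[LHS]/('D_1 (scale_by h) t) deriveE // diff_lin.
    exact: scale1r.
  exact: scalel_continuous.
have dgt : differentiable (fun t : R => x + t *: h) t.
  by apply/derivable1_diffP; case: dg.
apply: DeriveDef.
  by apply: diff_derivable; apply: (differentiable_comp (f := fun t : R => x + t *: h)).
rewrite (@derive_comp _ _ _ _ (fun t : R => x + t *: h) f) //.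
by congr ('D_ _ f _); case: dg.
Qed.

Lemma mean_value_le V (f : V -> R) x h K :
  (forall t, 0 <= t <= 1 -> differentiable f (x + t *: h)) ->
  (forall t, 0 <= t <= 1 -> `|'D_h f (x + t *: h)| <= K) ->
  `|f (x + h) - f x| <= K.
Proof.
move=> df dK.
have [c cI e] := @MVT_segment R (fun t => f (x + t *: h)) (fun t => 'D_h f (x + t *: h)) 0 1 ler01
   (fun t tI => derive_along (df t (ltac:(by move: tI; rewrite in_itv /= => /andP[/ltW-> /ltW->]))))
   (ltac:(apply: derivable_within_continuous => t; rewrite in_itv /= => tI; have [] := derive_along (df t tI); exact)).
move: e; rewrite scale0r scale1r addr0 subr0 mulr1 => ->.
by apply: dK; move: cI; rewrite in_itv.
Qed.

(** Rows carry the supremum norm, so the scalar estimate applied to each coordinate loses no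
    constant. *)
Lemma mean_value_rV V m (f : V -> 'rV[R]_m) x h K : 0 <= K ->
  (forall t, 0 <= t <= 1 -> differentiable f (x + t *: h)) ->
  (forall t, 0 <= t <= 1 -> `|'D_h f (x + t *: h)| <= K) ->
  `|f (x + h) - f x| <= K.
Proof.
move=> K0 df dK; apply: rV_norm_le => // j; rewrite !mxE.
have dj t : 0 <= t <= 1 -> differentiable (fun y => f y 0 j) (x + t *: h).
  move=> /df dt; apply: (differentiable_comp (g := rV_coord j)) => //.
  by apply: linear_differentiable; apply: rV_coord_continuous.
apply: (mean_value_le (f := fun y => f y 0 j)) => // t tI.
rewrite (derive_lin_comp (L := rV_coord j)); last 2 first.
- exact: rV_coord_continuous.
- exact: df.
by apply: le_trans (dK t tI); apply: rV_coord_le.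
Qed.

(** Strict differentiability: the mean value estimate for [f] minus its linear part at [x], whose
    partial derivatives are small near [x] by continuity. *)
Lemma smooth_strict_diff n m (f : 'rV[R]_n -> 'rV[R]_m) x : smooth_at f x ->
  forall e : R, 0 < e -> exists2 r : R, 0 < r & forall y z, ball x r y -> ball x r z ->
    `|f y - f z - 'd f x (y - z)| <= e * `|y - z|.
Proof.
move=> sf e e0.
have dx := smooth_at_differentiable sf.
(* The [n] partial derivatives share the error [e]; [n.+1] keeps the quotient meaningful when [n] is
   0. *)
have n0 : 0 < e / n.+1%:R by rewrite divr_gt0.
have : \forall y \near x, differentiable f y /\
    forall i, `|'D_(delta_mx 0 i) f y - 'D_(delta_mx 0 i) f x| <= e / n.+1%:R.
  have h1 : \forall y \near x, differentiable f y.
    by apply: filterS (smooth_at_nbhs sf) => y; apply: smooth_at_differentiable.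
  have h2 : \forall y \near x, forall i,
      `|'D_(delta_mx 0 i) f y - 'D_(delta_mx 0 i) f x| <= e / n.+1%:R.
    apply: (@near_forall _ 'I_n) => i.
    have := smooth_at_continuous (smooth_at_derive (delta_mx 0 i) sf).
    by move=> /cvgr_distC_le; apply.
  by apply: filterS2 h1 h2 => y.
move=> /nbhs_ballP[r /= r0 rP]; exists r => // y z yr zr.
pose g := fun y => f y - 'd f x y.
have -> : f y - f z - 'd f x (y - z) = g (z + (y - z)) - g z.
  rewrite /g [z + _]addrC subrK linearB /=.
  by rewrite !opprD !opprK !addrA; congr (_ + _); rewrite addrAC.
have dL : forall u, differentiable ('d f x) u.
  by move=> u; apply: linear_differentiable; apply: diff_continuous.
have inb t : 0 <= t <= 1 -> ball x r (z + t *: (y - z)).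
  move=> /andP[t0 t1]; move: yr zr; rewrite -!ball_normE /= => yr zr.
  have -> : x - (z + t *: (y - z)) = t *: (x - y) + (1 - t) *: (x - z).
    by rewrite !scalerBr scalerBl !scale1r; apply/matrixP => i j; rewrite !mxE; ring.
  apply: le_lt_trans (ler_normD _ _) _; rewrite !normrZ ger0_norm // ger0_norm ?subr_ge0 //.
  have [->|tn0] := eqVneq t 0; first by rewrite mul0r add0r subr0 mul1r.
  have -> : r = t * r + (1 - t) * r by ring.
  apply: ltr_leD; first by rewrite ltr_pM2l // lt0r tn0.
  by apply: ler_wpM2l; rewrite ?subr_ge0 // ltW.
have dg t : 0 <= t <= 1 -> differentiable g (z + t *: (y - z)).
  by move=> /inb /rP[d _]; apply: differentiableB.
apply: mean_value_rV => //; first by rewrite mulr_ge0 // ltW.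
move=> t /[dup] /dg dgt /inb /rP[d h].
rewrite /g deriveB; [|exact: diff_derivable|exact: diff_derivable].
rewrite [X in _ - X]deriveE // diff_lin; last exact: diff_continuous.
rewrite -deriveE // !derive_rV // -sumrB.
apply: le_trans (ler_norm_sum _ _ _) _.
apply: (@le_trans _ _ (\sum_(i < n) e / n.+1%:R * `|y - z|)).
  apply: ler_sum => i _; rewrite -scalerBr normrZ mulrC.
  by apply: ler_pM => //; apply: rV_coord_le.
rewrite sumr_const card_ord.
have -> : e * `|y - z| = (e / n.+1%:R * `|y - z|) *+ n.+1.
  by rewrite -[RHS]mulr_natr mulrAC divfK.
by rewrite [leRHS]mulrSr lerDl mulr_ge0 // ltW.
Qed.

Lemma linear_rV_smooth n W (L : {linear 'rV[R]_n -> W}) x : smooth_at L x.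
Proof.
apply: (@smooth_at_near_eq _ 'rV[R]_n W (fun y => \sum_i y 0 i *: L (delta_mx 0 i))).
  apply: nbhsW => y; rewrite [in RHS](row_sum_delta y) linear_sum.
  by apply: eq_bigr => i _; rewrite linearZ.
apply: smooth_at_sum => i _; apply: smooth_at_scalel.
by apply: smooth_at_coord; apply: (@smooth_at_lin _ _ _ idfun) => y; apply: cvg_id.
Qed.

Lemma linear_rV_continuous n W (L : {linear 'rV[R]_n -> W}) : continuous L.
Proof. by move=> x; apply: smooth_at_continuous; apply: linear_rV_smooth. Qed.

Lemma smooth_at_id V (x : V) : smooth_at (fun y : V => y) x.
Proof. by apply: (@smooth_at_lin _ _ _ idfun) => y; apply: cvg_id. Qed.

Lemma mulmx_bound n m (A : 'M[R]_(n, m)) :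
  exists2 C, 0 < C & forall v : 'rV[R]_n, `|v *m A| <= C * `|v|.
Proof.
exact: (linear_lipschitz (f := mulmxr A) (@linear_rV_continuous n _ (mulmxr A))).
Qed.

Lemma bounded_ball_continuous n (f : 'rV[R]_n -> R) (r : R) :
  (forall x, {for x, continuous f}) -> exists2 C, 0 <= C & forall x, `|x| <= r -> `|f x| <= C.
Proof.
move=> cf; have [r0|r0] := ltP r 0.
  by exists 0 => // x xr; have := le_lt_trans xr r0; rewrite normr_lt0.
pose A := [set x : 'rV[R]_n | `|x| <= r].
have cA : compact A.
  apply: bounded_closed_compact.
    by exists r; split; [exact: num_real|move=> M rM x /= xr; apply: le_trans xr (ltW rM)].
  have -> : A = (fun x : 'rV[R]_n => `|x|) @^-1` [set y | y <= r] by [].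
  by apply: closed_comp; [move=> x _; apply: norm_continuous|exact: closed_le].
have A0 : A !=set0 by exists 0; rewrite /A /= normr0.
have cn : {within A, continuous (fun x => `|f x|)}.
  apply: continuous_subspaceT => x; apply: (continuous_comp (cf x)).
  exact: norm_continuous.
have [c _ cP] := EVT_max_rV A0 cA cn.
by exists `|f c| => // x xr; apply: cP; rewrite inE.
Qed.

Lemma smooth_derive_bound n m (f : 'rV[R]_n -> 'rV[R]_m) (r : R) :
  (forall x, smooth_at f x) ->
  exists2 C, 0 <= C & forall x v, `|x| <= r -> `|'D_v f x| <= C * `|v|.
Proof.
move=> sf.
have /choice[C CP] : forall ij : 'I_n * 'I_m, exists C, 0 <= C /\
    forall x, `|x| <= r -> `|'D_(delta_mx 0 ij.1) f x 0 ij.2| <= C.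
  move=> [i j]; have [x|C C0 CP] := @bounded_ball_continuous n
    (fun x => 'D_(delta_mx 0 i) f x 0 j) r.
    by apply: smooth_at_continuous; apply: smooth_at_coord; apply: smooth_at_derive.
  by exists C.
have sC0 : 0 <= \sum_ij C ij by apply: sumr_ge0 => ij _; have [] := CP ij.
exists (\sum_ij C ij) => // x v xr.
apply: rV_norm_le => [|j]; first by rewrite mulr_ge0.
rewrite derive_rV; last exact: smooth_at_differentiable.
rewrite summxE; apply: le_trans (ler_norm_sum _ _ _) _.
have -> : \sum_ij C ij = \sum_j \sum_i C (i, j).
  by rewrite exchange_big pair_bigA; apply: eq_bigr => -[].
rewrite mulr_suml (bigD1 j) //= mulr_suml -[leLHS]addr0; apply: lerD; last first.
  apply: sumr_ge0 => j' _; rewrite mulr_ge0 // sumr_ge0 // => i _.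
  by have [] := CP (i, j').
apply: ler_sum => i _; rewrite mxE normrM mulrC; apply: ler_pM => //.
  by have [_] := CP (i, j); apply.
exact: rV_coord_le.
Qed.

Lemma ball0_convex V (r : R) (y z : V) t : `|y| <= r -> `|z| <= r -> 0 <= t <= 1 ->
  `|z + t *: (y - z)| <= r.
Proof.
move=> yr zr /andP[t0 t1].
have -> : z + t *: (y - z) = t *: y + (1 - t) *: z.
  by rewrite scalerBr scalerBl scale1r addrCA addrC addrAC.
apply: le_trans (ler_normD _ _) _; rewrite !normrZ ger0_norm // ger0_norm ?subr_ge0 //.
have -> : r = t * r + (1 - t) * r by ring.
by apply: lerD; apply: ler_wpM2l; rewrite ?subr_ge0.
Qed.

Lemma smooth_lipschitz_ball n m (f : 'rV[R]_n -> 'rV[R]_m) (r : R) :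
  (forall x, smooth_at f x) ->
  exists2 C, 0 <= C & forall y z, `|y| <= r -> `|z| <= r -> `|f y - f z| <= C * `|y - z|.
Proof.
move=> sf; have [C C0 CP] := smooth_derive_bound r sf.
exists C => // y z yr zr.
have e : z + (y - z) = y by rewrite addrC subrK.
have := @mean_value_rV _ _ f z (y - z) (C * `|y - z|); rewrite e; apply.
- by rewrite mulr_ge0.
- by move=> t _; apply: smooth_at_differentiable.
by move=> t tI; apply: CP; apply: ball0_convex.
Qed.

Lemma smooth_lipschitz_at n m (f : 'rV[R]_n -> 'rV[R]_m) x : smooth_at f x ->
  exists C r, [/\ 0 < C, 0 < r & forall y z, ball x r y -> ball x r z ->
    `|f y - f z| <= C * `|y - z|].
Proof.
move=> sf; have [r r0 rP] := smooth_strict_diff sf ltr01.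
have [k k0 kP] := linear_lipschitz (@linear_rV_continuous _ _ ('d f x)).
exists (1 + k), r; split=> [||y z yr zr]; [by rewrite addr_gt0|by []|].
rewrite -(subrK ('d f x (y - z)) (f y - f z)); apply: le_trans (ler_normD _ _) _.
by rewrite mulrDl; apply: lerD; [exact: rP|exact: kP].
Qed.

End estimates.

(** * The inverse function theorem *)

Section inverse.
Context {R : realType}.
Implicit Types V W : normedModType R.

Lemma continuous_norm_sub V W (f : V -> W) (a : W) x :
  {for x, continuous f} -> {for x, continuous (fun y => `|f y - a|)}.
Proof. by move=> cf; apply: cvg_norm; apply: cvgB => //; exact: cvg_cst. Qed.

Lemma Ck_prod V k (U : set V) (I : Type) (r : seq I) (P : pred I)
    (f : I -> V -> R) : open U -> (forall i, P i -> Ck_on k U (f i)) ->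
  Ck_on k U (fun x => \prod_(i <- r | P i) f i x).
Proof.
move=> oU h; elim: r => [|i r IH].
  apply: (@Ck_on_eq R V R _ _ (fun=> 1)); last exact: Ck_cst.
  by move=> x _; apply: nbhsW => y; rewrite big_nil.
apply: (@Ck_on_eq R V R _ _ (fun x => (if P i then f i x else 1) *
    \prod_(j <- r | P j) f j x)).
  move=> x _; apply: nbhsW => y; rewrite big_cons; case: ifP => // _.
  by rewrite mul1r.
apply: CkM => //; case Pi : (P i); [exact: h|exact: Ck_cst].
Qed.

Lemma Ck_det V k (U : set V) n (A : V -> 'M[R]_n) : open U ->
  (forall i j, Ck_on k U (fun x => A x i j)) -> Ck_on k U (fun x => \det (A x)).
Proof.
move=> oU h; rewrite /determinant; apply: Ck_sum => // s _.
apply: CkM => //; first exact: Ck_cst.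
by apply: Ck_prod.
Qed.

(** By Cramer's rule an entry of the inverse is a cofactor over the determinant. *)
Lemma Ck_invmx V k (U : set V) n (A : V -> 'M[R]_n) i j : open U ->
  (forall x, U x -> A x \in unitmx) ->
  (forall i j, Ck_on k U (fun x => A x i j)) -> Ck_on k U (fun x => invmx (A x) i j).
Proof.
move=> oU uA h.
apply: (@Ck_on_eq R V R _ _ (fun x => (\det (A x))^-1 *
   ((-1) ^+ (j + i) * \det (row' j (col' i (A x)))))).
  move=> x Ux; have : \forall y \near x, U y by exact: open_nbhs_nbhs.
  by apply: filterS => y /uA uy; rewrite /invmx uy !mxE.
apply: CkM => //.
  apply: CkV => //; last exact: Ck_det.
  by move=> x /uA; rewrite unitmxE unitfE.
apply: CkM => //; first exact: Ck_cst.
apply: Ck_det => // i' j'.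
by apply: (@Ck_on_eq R V R _ _ (fun x => A x (lift j i') (lift i j'))) => // x _;
  apply: nbhsW => y; rewrite !mxE.
Qed.

Lemma inj_unitmx n (L : {linear 'rV[R]_n -> 'rV[R]_n}) :
  (forall v, L v = 0 -> v = 0) -> lin1_mx L \in unitmx.
Proof.
move=> inj; rewrite -row_free_unit -kermx_eq0; apply/rowV0P => v /sub_kermxP.
by rewrite mul_rV_lin1; apply: inj.
Qed.

Lemma diff_lin1 n m (f : 'rV[R]_n -> 'rV[R]_m) x v :
  'd f x v = v *m lin1_mx ('d f x).
Proof. by rewrite mul_rV_lin1. Qed.

Lemma lin1_derive n (f : 'rV[R]_n -> 'rV[R]_n) x : differentiable f x ->
  lin1_mx ('d f x) = \matrix_(i, j) 'D_(delta_mx 0 i) f x 0 j.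
Proof. by move=> df; apply/matrixP => i j; rewrite !mxE deriveE. Qed.

(** On a small ball [f] differs from its linear part by a small Lipschitz map. This gives a lower
    bound for distances between values, hence injectivity, and it makes a Newton step with the fixed
    inverse [invmx J] halve the residual, hence openness. *)
Lemma inverse_function n (f : 'rV[R]_n -> 'rV[R]_n) a (N : set 'rV[R]_n) :
  smooth_at f a -> (forall v, 'd f a v = 0 -> v = 0) -> nbhs a N ->
  exists (U : set 'rV[R]_n) (g : 'rV[R]_n -> 'rV[R]_n),
    [/\ open U, U a & U `<=` N] /\
    [/\ open (f @` U), {in U, cancel f g},
        (forall x, U x -> smooth_at f x), (forall y, (f @` U) y -> smooth_at g y) &
        (forall x v, U x -> 'd f x v = 0 -> v = 0)].
Proof.
move=> sf inj aN.
have uJ := inj_unitmx inj; set J := lin1_mx ('d f a) in uJ.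
have JE v : 'd f a v = v *m J by rewrite mul_rV_lin1.
have [C C0 CP] := mulmx_bound (invmx J).
(* As [C] bounds the inverse of the differential, an error factor 1/(2C) costs at most half of the
   distance in [lowb]. *)
have e0 : 0 < (2 * C)^-1 by rewrite invr_gt0 mulr_gt0.
have [r r0 rP] := smooth_strict_diff sf e0.
have : \forall x \near a, N x /\ smooth_at f x.
  by apply: filterS2 aN (smooth_at_nbhs sf).
move=> /nbhs_ballP[r1 /= r10 r1P].
pose r2 := Num.min r r1; pose U := ball a r2.
have r20 : 0 < r2 by rewrite lt_min r0.
have Ur x : U x -> ball a r x by apply: le_ball; rewrite ge_min lexx.
have Ur1 x : U x -> ball a r1 x by apply: le_ball; rewrite ge_min lexx orbT.
have oU : open U by exact: ball_open.
have sfU x : U x -> smooth_at f x by move=> /Ur1/r1P[].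
have lowb y z : U y -> U z -> `|y - z| <= 2 * C * `|f y - f z|.
  move=> Uy Uz; have := rP _ _ (Ur _ Uy) (Ur _ Uz); rewrite JE => h.
  have E : y - z = (f y - f z) *m invmx J - (f y - f z - (y - z) *m J) *m invmx J.
    by rewrite -mulmxBl subKr mulmxK.
  have h1 : `|y - z| <= C * `|f y - f z| + C * ((2 * C)^-1 * `|y - z|).
    rewrite {1}E; apply: le_trans (ler_normB _ _) _; apply: lerD; first exact: CP.
    by apply: le_trans (CP _) _; apply: ler_wpM2l => //; exact: ltW.
  have e2 : C * ((2 * C)^-1 * `|y - z|) = `|y - z| / 2.
    by field; rewrite lt0r_neq0.
  by rewrite e2 in h1; lra.
have injU y z : U y -> U z -> f y = f z -> y = z.
  move=> Uy Uz e; have := lowb y z Uy Uz; rewrite e subrr normr0 mulr0 normr_le0.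
  by rewrite subr_eq0 => /eqP.
(* If the differential kills [v], then [f] moves [x + t v] by at most |t v|/(4C) for small [t],
   while [lowb] requires at least |t v|/(2C). *)
have dinj x v : U x -> 'd f x v = 0 -> v = 0.
  move=> Ux dv; have e1 : 0 < (4 * C)^-1 by rewrite invr_gt0 mulr_gt0.
  have h1 := diff_eps (smooth_at_differentiable (sfU x Ux)) e1.
  have h2 : \forall h \near (0 : 'rV[R]_n), U (h + x).
    have : \forall y \near x, U y by exact: open_nbhs_nbhs.
    by rewrite (near_shift 0 x); apply: filterS => h /=; rewrite subr0.
  have : \forall t \near (0 : R), U (t *: v + x) /\
     `|f (t *: v + x) - f x - 'd f x (t *: v)| <= (4 * C)^-1 * `|t *: v|.
    have c0 : (fun t : R => t *: v) @ (0 : R) --> (0 : 'rV[R]_n).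
      by rewrite -[X in _ --> X](scale0r v); apply: scalel_continuous.
    have h3 : \forall h \near (0 : 'rV[R]_n), U (h + x) /\
        `|f (h + x) - f x - 'd f x h| <= (4 * C)^-1 * `|h| by exact: (filterI h2 h1).
    exact: (c0 _ h3).
  move=> /nbhs_ballP[d /= d0 dP].
  have d20 : 0 < d / 2 by rewrite divr_gt0.
  have [|Uv] := dP (d / 2).
    by rewrite /ball /= sub0r normrN gtr0_norm //; lra.
  have -> : 'd f x (d / 2 *: v) = 0 by rewrite linearZ /= dv; exact: scaler0.
  rewrite subr0 => h3.
  have := lowb _ _ Uv Ux; rewrite addrK => h4.
  have h5 : 2 * C * `|f (d / 2 *: v + x) - f x| <= 2 * C * ((4 * C)^-1 * `|d / 2 *: v|).
    by apply: ler_wpM2l => //; rewrite mulr_ge0 // ltW.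
  have e2 : 2 * C * ((4 * C)^-1 * `|d / 2 *: v|) = `|d / 2 *: v| / 2.
    by field; rewrite lt0r_neq0.
  have : `|d / 2 *: v| <= 0 by rewrite e2 in h5; lra.
  by rewrite normr_le0 scaler_eq0 gt_eqF //= => /eqP.
(* The distance of [f x] to [y] attains its minimum over a closed ball at some [c]. A Newton step
   from [c] stays in the ball and would at least halve the residual, so the minimum is 0. *)
have openfU : open (f @` U).
  rewrite openE => _ [x0 Ux0 <-] /=.
  have : nbhs x0 U by exact: open_nbhs_nbhs.
  move=> /nbhs_closedballP[s sP].
  have s0 : 0 < s%:num by [].
  have inU x : `|x - x0| <= s%:num -> U x.
    by move=> h; apply: sP; rewrite closed_ballE // /closed_ball_ /= distrC.
  (* The minimizer lies within 2C times 2d of [x0] and the Newton step has length at most C d; the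
     sum is 5 C d, the radius of the ball. *)
  pose d := s%:num / (5 * C).
  have d0 : 0 < d by rewrite divr_gt0 // mulr_gt0.
  apply/nbhs_ballP; exists d => //= y.
  rewrite -ball_normE /= => yd.
  pose A := [set x : 'rV[R]_n | `|x - x0| <= s%:num].
  have cA : compact A.
    apply: bounded_closed_compact.
      exists (s%:num + `|x0|); split; first exact: num_real.
      move=> M sM x /= xs; apply: le_trans (ltW sM).
      rewrite -(subrK x0 x); apply: le_trans (ler_normD _ _) _.
      by rewrite lerD2r.
    have -> : A = (fun x : 'rV[R]_n => `|x - x0|) @^-1` [set y | y <= s%:num] by [].
    apply: closed_comp; last exact: closed_le.
    by move=> x _; apply: (@continuous_norm_sub _ _ id); exact: cvg_id.
  have A0 : A !=set0 by exists x0; rewrite /A /= subrr normr0.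
  have cn : {within A, continuous (fun x => `|f x - y|)}.
    apply: continuous_in_subspaceT => x; rewrite inE => /inU /sfU /smooth_at_continuous cf.
    exact: continuous_norm_sub.
  have [c cA' cP] := EVT_min_rV A0 cA cn.
  have Ac : A c by rewrite inE in cA'.
  have Uc := inU _ Ac.
  have fcd : `|f c - y| < d.
    by apply: le_lt_trans (cP x0 _) yd; rewrite inE /A /= subrr normr0.
  exists c => //; apply/eqP; rewrite -subr_eq0 -normr_le0.
  pose c' := c - (f c - y) *m invmx J.
  have h1 : `|c' - c| <= C * `|f c - y|.
    by rewrite /c' addrAC subrr sub0r normrN.
  have dC : 5 * C * d = s%:num by rewrite /d; field; rewrite lt0r_neq0.
  have Ac' : A c'.
    rewrite /A /= -(subrK c c') -addrA; apply: le_trans (ler_normD _ _) _.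
    have h2 := lowb _ _ Uc Ux0.
    have h3 : `|f c - f x0| <= `|f c - y| + `|f x0 - y|.
      by rewrite -[`|f x0 - y|]normrN opprB; apply: le_trans (ler_normD _ _); rewrite addrA subrK.
    have h4 : `|f c - f x0| <= 2 * d.
      by apply: le_trans h3 _; rewrite mulr2n mulrDl !mul1r; apply: lerD; exact: ltW.
    have h5 : 2 * C * `|f c - f x0| <= 2 * C * (2 * d).
      by apply: ler_wpM2l => //; rewrite mulr_ge0 // ltW.
    have h6 : C * `|f c - y| <= C * d by apply: ler_wpM2l; exact: ltW.
    lra.
  have h2 := cP c'; rewrite inE in h2; have {h2} h2 := h2 Ac'.
  have h3 := rP _ _ (Ur _ (inU _ Ac')) (Ur _ Uc).
  have e3 : f c' - f c - 'd f a (c' - c) = f c' - y.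
    have -> : c' - c = - ((f c - y) *m invmx J) by rewrite /c' addrAC subrr sub0r.
    by rewrite JE mulNmx mulmxKV // opprK addrA subrK.
  rewrite e3 in h3.
  have h4 : (2 * C)^-1 * `|c' - c| <= `|f c - y| / 2.
    have -> : `|f c - y| / 2 = (2 * C)^-1 * (C * `|f c - y|) by field; rewrite lt0r_neq0.
    by apply: ler_wpM2l => //; exact: ltW.
  lra.
pose g y := xget a [set x | U x /\ f x = y].
have gP y : (f @` U) y -> U (g y) /\ f (g y) = y.
  by move=> [x Ux fx]; apply: (@xgetPex _ a [set x | U x /\ f x = y]); exists x.
have gK x : U x -> g (f x) = x.
  move=> Ux; have [|Ug fg] := gP (f x); first by exists x.
  exact: injU.
have dg y : (f @` U) y -> differentiable g y /\
    forall v, 'D_v g y = v *m invmx (lin1_mx ('d f (g y))).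
  move=> fUy; have [Ux0 fx0] := gP y fUy; set x0 := g y in Ux0 fx0 *.
  have u0 := inj_unitmx (fun v => dinj x0 v Ux0).
  set B0 := invmx _.
  have [C1 C10 C1P] := mulmx_bound B0.
  pose L : {linear 'rV[R]_n -> 'rV[R]_n} := mulmxr B0.
  have [dg gL] : differentiable g y /\ 'd g y = L :> (_ -> _).
    apply: differentiable_eps; first exact: linear_rV_continuous.
    move=> e ep.
    pose e' := e / (2 * C * C1).
    have e'0 : 0 < e' by rewrite divr_gt0 // !mulr_gt0.
    have /nbhs_ballP[d /= d0 dP] := diff_eps (smooth_at_differentiable (sfU x0 Ux0)) e'0.
    have h2 : \forall k \near (0 : 'rV[R]_n), (f @` U) (k + y).
      have : \forall z \near y, (f @` U) z by exact: open_nbhs_nbhs.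
      by rewrite (near_shift 0 y); apply: filterS => h /=; rewrite subr0.
    have d20 : 0 < d / (2 * C) by rewrite divr_gt0 // mulr_gt0.
    have h3 : \forall k \near (0 : 'rV[R]_n), `|k| < d / (2 * C).
      by apply/nbhs_ballP; exists (d / (2 * C)) => //= k; rewrite -ball_normE /= sub0r normrN.
    apply: filterS2 h2 h3 => k /gP[Uk fk] kd.
    set h := g (k + y) - x0.
    have hk : `|h| <= 2 * C * `|k|.
      by have := lowb _ _ Uk Ux0; rewrite fk fx0 addrK.
    have hd : `|h| < d.
      apply: le_lt_trans hk _; have -> : d = 2 * C * (d / (2 * C)) by field; rewrite lt0r_neq0.
      by rewrite ltr_pM2l // mulr_gt0.
    have := dP h; rewrite -ball_normE /= sub0r normrN => /(_ hd).
    rewrite /h subrK fk fx0 addrK -/h => h4.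
    have -> : h - L k = - ((k - 'd f x0 h) *m B0).
      rewrite /L /= (diff_lin1 f x0 h) mulmxBl mulmxK //; exact: (esym (opprB _ _)).
    rewrite normrN; apply: le_trans (C1P _) _.
    apply: (@le_trans _ _ (C1 * (e' * (2 * C * `|k|)))).
      apply: ler_wpM2l; first exact: ltW.
      by apply: le_trans h4 _; apply: ler_wpM2l => //; exact: ltW.
    by rewrite le_eqVlt; apply/orP; left; apply/eqP; rewrite /e'; field; rewrite !lt0r_neq0.
  split=> [|v]; first exact: dg.
  rewrite deriveE; last exact: dg.
  exact: (congr1 (fun F => F v) gL).
exists U, g; split; [split=> //|split=> //].
- by apply: ballxx.
- by move=> x /Ur1/r1P[].
- by move=> x; rewrite inE; apply: gK.
move=> y fUy; apply/smooth_atP; exists (f @` U); split=> // k.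
(* Bootstrapping: the derivative of [g] is the inverse of the differential of [f] at [g], hence as
   regular as [g] itself, which gains one order. *)
elim: k => [|k IH].
  by move=> z /dg[d _]; exact: differentiable_continuous.
apply/Ck_onS; split=> [z /dg[]//|v].
apply: (@Ck_on_eq _ _ _ _ _ (fun z => v *m invmx (\matrix_(i, j) 'D_(delta_mx 0 i) f (g z) 0 j))).
  move=> z fUz; have : \forall w \near z, (f @` U) w by exact: open_nbhs_nbhs.
  apply: filterS => w fUw; have [_ ->] := dg w fUw; rewrite lin1_derive //.
  by apply: smooth_at_differentiable; apply: sfU; have [] := gP w fUw.
apply: Ck_rV => // j.
apply: (@Ck_on_eq R _ R _ _ (fun z => \sum_i v 0 i * (invmx (\matrix_(i, j) 'D_(delta_mx 0 i) f (g z) 0 j)) i j)).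
  by move=> z _; apply: nbhsW => w; rewrite mxE.
apply: Ck_sum => // i _; apply: CkM => //; first exact: Ck_cst.
apply: Ck_invmx => //.
  move=> z fUz; have [Uz _] := gP z fUz; rewrite -lin1_derive; last by apply: smooth_at_differentiable; apply: sfU.
  by apply: inj_unitmx => w; apply: dinj.
move=> i' j'.
apply: (@Ck_on_eq R _ R _ _ ((fun x => 'D_(delta_mx 0 i') f x 0 j') \o g)).
  by move=> z _; apply: nbhsW => w; rewrite mxE.
apply: Ck_comp => // z fUz; have [Uz _] := gP z fUz.
have : smooth_at (fun x => 'D_(delta_mx 0 i') f x 0 j') (g z).
  by apply: smooth_at_coord; apply: smooth_at_derive; apply: sfU.
by move/nbhs_singleton; apply.
Qed.

End inverse.

(** * Flows of bounded vector fields *)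

Section euler_scheme.
Context {R : realType}.
Implicit Types V W : normedModType R.

Lemma cvg_norm_le V (u : nat -> V) l C N0 : u @ \oo --> l ->
  (forall N, (N0 <= N)%N -> `|u N| <= C) -> `|l| <= C.
Proof.
move=> ul h.
have cl : closed [set x : V | `|x| <= C].
  have -> : [set x : V | `|x| <= C] = (fun x => `|x|) @^-1` [set y | y <= C] by [].
  by apply: closed_comp; [move=> x _; apply: norm_continuous|exact: closed_le].
have uC : \forall N \near \oo, `|u N| <= C by exists N0.
exact: (@closed_cvg _ _ _ _ u [set x : V | `|x| <= C] cl uC l ul).
Qed.

Lemma norm_triangle V (a b c : V) : `|a - c| <= `|a - b| + `|b - c|.
Proof. by rewrite -{1}(subrK b a) -addrA ler_normD. Qed.

Lemma cvg_bigsum V (I : Type) (r : seq I) (f : I -> nat -> V) (l : I -> V) :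
  (forall i, f i @ \oo --> l i) ->
  (fun N => \sum_(i <- r) f i N) @ \oo --> \sum_(i <- r) l i.
Proof.
move=> fl; elim: r => [|i r IH].
  rewrite big_nil (_ : (fun N => _) = fun=> 0); first exact: cvg_cst.
  by apply/funext => N; rewrite big_nil.
rewrite big_cons (_ : (fun N => _) = fun N => f i N + \sum_(i <- r) f i N).
  exact: cvgD.
by apply/funext => N; rewrite big_cons.
Qed.

Lemma subr_shuffle (V : zmodType) (a b c d : V) : a - b - c = a - (d + c) - (b - d).
Proof. by rewrite opprD opprB !addrA (addrAC a) subrK addrAC. Qed.

Lemma cauchy_rV n (u : nat -> 'rV[R]_n) :
  (forall e, 0 < e -> exists N0, forall i j, (N0 <= i)%N -> (N0 <= j)%N -> `|u i - u j| <= e) ->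
  exists l : 'rV[R]_n, u @ \oo --> l.
Proof.
move=> h.
have /choice[l lP] : forall k : 'I_n, exists l : R, (fun i => u i 0 k) @ \oo --> l.
  move=> k; apply/cvg_ex; apply/cauchy_cvgP; apply/cauchy_ballP => e e0; near_simpl.
  have [N0 h0] := h (e / 2) ltac:(by rewrite divr_gt0).
  have hN : \forall N \near \oo, (N0 <= N)%N by exists N0.
  exists ([set N | (N0 <= N)%N], [set N | (N0 <= N)%N]); first by split; exists N0.
  move=> [i j] [/= hi hj]; rewrite -ball_normE /=.
  have := h0 i j hi hj; have := rV_coord_le (u i - u j) k; rewrite !mxE => h1 h2.
  by apply: le_lt_trans h1 _; apply: le_lt_trans h2 _; lra.
exists (\row_k l k); apply/cvgrPdist_le => e e0.
have : \forall i \near \oo, forall k, `|l k - u i 0 k| <= e.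
  by apply: filter_forall => k; move/cvgrPdist_le : (lP k); apply.
apply: filterS => i hi; apply: rV_norm_le => [|k]; first exact: ltW.
by rewrite !mxE.
Qed.

Lemma pow1_le_expR (K h : R) j : 0 <= K -> 0 <= h -> h * j%:R <= 1 ->
  (1 + K * h) ^+ j <= expR K.
Proof.
move=> K0 h0 hj; apply: (@le_trans _ _ (expR (K * h) ^+ j)).
  by apply: lerXn2r; rewrite ?nnegrE ?expR_ge0 ?addr_ge0 ?mulr_ge0 // expR_ge1Dx.
rewrite -expRM_natr ler_expR -mulrA -[leRHS]mulr1.
exact: ler_wpM2l.
Qed.

Section euler.
Context {n : nat}.
Implicit Types (F : 'rV[R]_n -> 'rV[R]_n) (y z : 'rV[R]_n).

Definition euler F (h : R) (j : nat) y : 'rV[R]_n :=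
  iter j (fun z => z + h *: F z) y.

Lemma eulerS F h j y : euler F h j.+1 y = euler F h j y + h *: F (euler F h j y).
Proof. by []. Qed.

Lemma eulerD F h i j y : euler F h (i + j) y = euler F h i (euler F h j y).
Proof. exact: iterD. Qed.

(** An a priori bound over unit time, uniform in the step, stands in for a bound or a global
    Lipschitz constant of [F]: the tangent lift of a bounded field need have neither, but it
    inherits this property. *)
Definition euler_bounded F := forall r : R, exists2 C, 0 <= C &
  forall N j y, (0 < N)%N -> (j <= N)%N -> `|y| <= r -> `|euler F N%:R^-1 j y| <= C.

(** Discrete Gronwall: one step of size [h] multiplies distances by at most 1 + K h, and [N] steps
    of size 1/N by at most exp K. *)
Lemma euler_lipschitz F : (forall x, smooth_at F x) -> euler_bounded F ->
  forall r, exists2 L, 0 <= L & forall N j y z, (0 < N)%N -> (j <= N)%N ->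
    `|y| <= r -> `|z| <= r ->
    `|euler F N%:R^-1 j y - euler F N%:R^-1 j z| <= L * `|y - z|.
Proof.
move=> sF bF r; have [C C0 CP] := bF r.
have [K K0 KP] := smooth_lipschitz_ball C sF.
exists (expR K); first exact: expR_ge0.
move=> N j y z N0 jN yr zr; set h := N%:R^-1.
have h0 : 0 <= h by rewrite invr_ge0.
have step i : (i <= N)%N -> `|euler F h i y - euler F h i z| <= (1 + K * h) ^+ i * `|y - z|.
  elim: i => [|i IH] iN; first by rewrite expr0 mul1r.
  rewrite !eulerS opprD addrACA -scalerBr; apply: le_trans (ler_normD _ _) _.
  rewrite normrZ ger0_norm // exprS -mulrA mulrDl mul1r; apply: lerD.
    by apply: IH; exact: ltnW.
  rewrite -[leRHS]mulrA [leRHS]mulrCA; apply: ler_wpM2l => //.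
  apply: le_trans (KP _ _ _ _) _; [exact: CP N0 (ltnW iN) yr|exact: CP N0 (ltnW iN) zr|].
  by apply: ler_wpM2l => //; apply: IH; exact: ltnW.
apply: le_trans (step j jN) _; apply: ler_wpM2r => //.
apply: pow1_le_expR => //; rewrite /h mulrC ler_pdivrMr ?ltr0n // mul1r ler_nat.
exact: jN.
Qed.

(** Only a step size and its refinements are compared; two arbitrary ones are later compared through
    their common refinement. *)
Lemma euler_compare F : (forall x, smooth_at F x) -> euler_bounded F ->
  forall r, exists2 K, 0 <= K & forall N M y, (0 < N)%N -> (0 < M)%N -> `|y| <= r ->
    `|euler F (N * M)%:R^-1 (N * M) y - euler F N%:R^-1 N y| <= K * N%:R^-1.
Proof.
move=> sF bF r; have [C C0 CP] := bF r.
have [K K0 KP] := smooth_lipschitz_ball C sF.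
have [B B0 BP] : exists2 B, 0 <= B & forall z, `|z| <= C -> `|F z| <= B.
  exists (K * C + `|F 0|) => [|z zC]; first by rewrite addr_ge0 // mulr_ge0.
  rewrite -(subrK (F 0) (F z)); apply: le_trans (ler_normD _ _) _; rewrite lerD2r.
  apply: le_trans (KP _ _ zC _) _; first by rewrite normr0.
  by rewrite subr0 ler_wpM2l.
exists (K * B * expR K); first by rewrite !mulr_ge0 // expR_ge0.
move=> N M y N0 M0 yr; set h := N%:R^-1; set h' := (N * M)%:R^-1.
have h0 : 0 <= h by rewrite invr_ge0.
have h'0 : 0 <= h' by rewrite invr_ge0.
have NR : 0 < N%:R :> R by rewrite ltr0n.
have MR : 0 < M%:R :> R by rewrite ltr0n.
have hM : h' * M%:R = h by rewrite /h' /h natrM; field; rewrite !lt0r_neq0.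
have NM0 : (0 < N * M)%N by rewrite muln_gt0 N0.
have fine i : (i <= N * M)%N -> `|euler F h' i y| <= C by move=> ?; apply: CP.
(* Local error: [M] fine steps from [z] differ from one coarse step by a quantity of order h^2, as
   [F] varies by at most K h B along them. *)
have loc j : (j < N)%N -> forall z, z = euler F h' (M * j) y ->
    `|euler F h' M z - (z + h *: F z)| <= h * (K * (h * B)).
  move=> jN z zE.
  have inr i : (i <= M)%N -> (i + M * j <= N * M)%N.
    move=> iM; apply: (@leq_trans (M + M * j)); first by rewrite leq_add2r.
    by rewrite -mulnS mulnC leq_mul2r jN orbT.
  have zi i : (i <= M)%N -> `|euler F h' i z| <= C.
    by move=> iM; rewrite zE -eulerD; apply: fine; apply: inr.
  have dz i : (i <= M)%N -> `|euler F h' i z - z| <= (h' * i%:R) * B.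
    elim: i => [|i IH] iM; first by rewrite subrr normr0 mulr0 mul0r.
    rewrite eulerS addrAC; apply: le_trans (ler_normD _ _) _.
    rewrite -natr1 mulrDr mulr1 mulrDl; apply: lerD; first by apply: IH; exact: ltnW.
    rewrite normrZ ger0_norm //; apply: ler_wpM2l => //; apply: BP; apply: zi; exact: ltnW.
  have dzi i : (i <= M)%N ->
      `|euler F h' i z - (z + (h' * i%:R) *: F z)| <= (h' * i%:R) * (K * (h * B)).
    elim: i => [|i IH] iM; first by rewrite mulr0 scale0r mul0r addr0 subrr normr0.
    rewrite eulerS -natr1 mulrDr mulr1 scalerDl addrA.
    have -> (a b c d : 'rV[R]_n) : a + b - (c + d) = (a - c) + (b - d) by rewrite opprD addrACA.
    rewrite -scalerBr; apply: le_trans (ler_normD _ _) _; rewrite [leRHS]mulrDl.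
    apply: lerD; first by apply: IH; exact: ltnW.
    rewrite normrZ ger0_norm //; apply: ler_wpM2l => //.
    apply: le_trans (KP _ _ _ _) _; [by apply: zi; exact: ltnW|exact: (zi 0%N)|].
    apply: ler_wpM2l => //; apply: le_trans (dz i (ltnW iM)) _.
    apply: ler_wpM2r => //; rewrite -hM; apply: ler_wpM2l => //.
    by rewrite ler_nat ltnW.
  by have := dzi M (leqnn M); rewrite hM.
have coarse i : (i <= N)%N -> `|euler F h i y| <= C by move=> ?; apply: CP.
(* Global error: [j] local errors, each amplified by at most the Gronwall factor. *)
have main j : (j <= N)%N -> `|euler F h' (M * j) y - euler F h j y| <=
    j%:R * (h * (K * (h * B))) * (1 + K * h) ^+ j.
  elim: j => [|j IH] jN; first by rewrite muln0 subrr normr0 !mul0r.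
  rewrite mulnS eulerD eulerS; set z := euler F h' (M * j) y; set w := euler F h j y.
  rewrite -(subrK (z + h *: F z) (euler F h' M z)) -addrA.
  apply: le_trans (ler_normD _ _) _.
  have -> : z + h *: F z - (w + h *: F w) = (z - w) + h *: (F z - F w).
    by rewrite opprD addrACA scalerBr.
  have Kh1 : 1 <= 1 + K * h by rewrite lerDl mulr_ge0.
  have Kh0 : 0 <= K * h by rewrite mulr_ge0.
  have hh : 0 <= h * (K * (h * B)) by rewrite !mulr_ge0.
  have zw : `|z - w + h *: (F z - F w)| <= (1 + K * h) * `|z - w|.
    apply: le_trans (ler_normD _ _) _; rewrite mulrDl mul1r lerD2l normrZ ger0_norm //.
    rewrite [K * h]mulrC -mulrA; apply: ler_wpM2l => //; apply: KP.
      by apply: fine; rewrite [(N * M)%N]mulnC leq_mul2l (ltnW jN) orbT.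
    exact/coarse/ltnW.
  have h1 := loc j jN z erefl.
  have h2 := IH (ltnW jN).
  have h3 : (1 + K * h) * `|z - w| <= (1 + K * h) * (j%:R * (h * (K * (h * B))) * (1 + K * h) ^+ j).
    by apply: ler_wpM2l => //; apply: le_trans Kh1.
  have h4 : h * (K * (h * B)) <= h * (K * (h * B)) * (1 + K * h) ^+ j.+1.
    by apply: ler_peMr => //; apply: exprn_ege1.
  apply: le_trans (lerD (le_trans h1 h4) (le_trans zw h3)) _.
  rewrite le_eqVlt; apply/orP; left; apply/eqP; rewrite exprS -natr1; ring.
have := main N (leqnn N); rewrite mulnC => h1; apply: le_trans h1 _.
have -> : N%:R * (h * (K * (h * B))) = K * B * h by rewrite /h; field; rewrite lt0r_neq0.
rewrite mulrAC; apply: ler_wpM2r => //; apply: ler_wpM2l; first by rewrite mulr_ge0.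
by apply: pow1_le_expR => //; rewrite /h mulVf // lt0r_neq0.
Qed.

Definition euler_lim F y : 'rV[R]_n :=
  lim ((fun N => euler F N.+1%:R^-1 N.+1 y) @ \oo).

Lemma euler_cvg F y : (forall x, smooth_at F x) -> euler_bounded F ->
  (fun N => euler F N.+1%:R^-1 N.+1 y) @ \oo --> euler_lim F y.
Proof.
move=> sF bF; have [K K0 KP] := euler_compare sF bF `|y|.
suff [l lP] : exists l : 'rV[R]_n, (fun N => euler F N.+1%:R^-1 N.+1 y) @ \oo --> l.
  exact: cvgP lP.
apply: cauchy_rV => e e0.
have [N0 N0P] : exists N0 : nat, K * 2 / e <= N0.+1%:R.
  exists (Num.truncn (K * 2 / e)); apply: ltW; exact: truncnS_gt.
exists N0 => i j iN jN.
have b k : (N0 <= k)%N -> K * k.+1%:R^-1 <= e / 2.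
  move=> kN; rewrite ler_pdivrMr ?ltr0n //.
  move: N0P; rewrite ler_pdivrMr // => h.
  have : N0.+1%:R * e <= k.+1%:R * e by rewrite ler_pM2r // ler_nat.
  by lra.
have h1 := KP i.+1 j.+1 y isT isT (lexx _).
have h2 := KP j.+1 i.+1 y isT isT (lexx _).
rewrite [(j.+1 * _)%N]mulnC in h2.
set w := euler F (i.+1 * j.+1)%:R^-1 _ y in h1 h2.
apply: (@le_trans _ _ (e / 2 + e / 2)); last lra.
apply: le_trans (norm_triangle _ w _) _; apply: lerD.
  by rewrite distrC; apply: le_trans h1 (b i iN).
exact: le_trans h2 (b j jN).
Qed.

Lemma smooth_at_euler F h j y : (forall x, smooth_at F x) -> smooth_at (euler F h j) y.
Proof.
move=> sF; elim: j => [|j IH]; first exact: smooth_at_id.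
apply: smooth_atD => //; apply: smooth_atZ.
exact: (@smooth_at_comp _ _ _ _ (euler F h j) F).
Qed.

(** The field together with its variational equation: the left half is the base point, the right
    half the tangent vector. *)
Definition tangent_map F (u : 'rV[R]_(n + n)) : 'rV[R]_(n + n) :=
  row_mx (F (lsubmx u)) ('D_(rsubmx u) F (lsubmx u)).

End euler.
Arguments euler : simpl never.

Lemma smooth_at_lsubmx n m (u : 'rV[R]_(n + m)) : smooth_at (@lsubmx _ 1 n m) u.
Proof. exact: linear_rV_smooth. Qed.

Lemma smooth_at_rsubmx n m (u : 'rV[R]_(n + m)) : smooth_at (@rsubmx _ 1 n m) u.
Proof. exact: linear_rV_smooth. Qed.

Lemma smooth_at_row_mx V n m (f : V -> 'rV[R]_n) (g : V -> 'rV[R]_m) x :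
  smooth_at f x -> smooth_at g x -> smooth_at (fun y => row_mx (f y) (g y)) x.
Proof.
move=> sf sg; apply: smooth_at_rV => j; case: (split_ordP j) => i ->.
  apply: smooth_at_near_eq (smooth_at_coord i sf).
  by apply: nbhsW => y; rewrite row_mxEl.
apply: smooth_at_near_eq (smooth_at_coord i sg).
by apply: nbhsW => y; rewrite row_mxEr.
Qed.

Lemma row_mx_norm n m (a : 'rV[R]_n) (b : 'rV[R]_m) C : 0 <= C ->
  `|a| <= C -> `|b| <= C -> `|row_mx a b| <= C.
Proof.
move=> C0 aC bC; apply: rV_norm_le => // j; case: (split_ordP j) => i ->.
  by rewrite row_mxEl (le_trans (rV_coord_le _ _)).
by rewrite row_mxEr (le_trans (rV_coord_le _ _)).
Qed.

Lemma lsubmx_norm n m (u : 'rV[R]_(n + m)) : `|lsubmx u| <= `|u|.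
Proof. by apply: rV_norm_le => // j; rewrite mxE rV_coord_le. Qed.

Lemma rsubmx_norm n m (u : 'rV[R]_(n + m)) : `|rsubmx u| <= `|u|.
Proof. by apply: rV_norm_le => // j; rewrite mxE rV_coord_le. Qed.

(** * Differentiating the Euler scheme *)

Section euler_tangent.
Context {n : nat} (F : 'rV[R]_n -> 'rV[R]_n).
Hypothesis sF : forall x, smooth_at F x.
Implicit Types (y z w : 'rV[R]_n).

Lemma smooth_tangent_map u : smooth_at (tangent_map F) u.
Proof.
apply: smooth_at_row_mx.
  exact: (@smooth_at_comp _ _ _ _ (@lsubmx _ 1 n n) F _ (smooth_at_lsubmx u)).
apply: (@smooth_at_near_eq R _ _
   (fun u : 'rV[R]_(n + n) => \sum_i rsubmx u 0 i *: 'D_(delta_mx 0 i) F (lsubmx u))).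
  by apply: nbhsW => v; rewrite [RHS]derive_rV //; apply: smooth_at_differentiable.
apply: smooth_at_sum => i _; apply: smooth_at_rV => j.
apply: (@smooth_at_near_eq R _ _
   (fun u : 'rV[R]_(n + n) => rsubmx u 0 i * 'D_(delta_mx 0 i) F (lsubmx u) 0 j)).
  by apply: nbhsW => v; rewrite [RHS]mxE.
apply: smooth_atM; first by apply: smooth_at_coord; exact: smooth_at_rsubmx.
apply: (@smooth_at_compR _ _ _ (@lsubmx _ 1 n n) (fun y => 'D_(delta_mx 0 i) F y 0 j)).
  exact: smooth_at_lsubmx.
by apply: smooth_at_coord; apply: smooth_at_derive.
Qed.

(** Differentiating one step z + h F(z) in the direction [w] gives one step of the lift, so
    discretization and differentiation commute exactly. *)
Lemma euler_tangent h j y w : euler (tangent_map F) h j (row_mx y w) =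
  row_mx (euler F h j y) ('D_w (euler F h j) y).
Proof.
elim: j => [|j IH]; first by rewrite /= derive_id.
rewrite eulerS IH /tangent_map row_mxKl row_mxKr scale_row_mx add_row_mx eulerS.
congr (row_mx _ _).
have de x : differentiable (euler F h j) x.
  by apply: smooth_at_differentiable; apply: smooth_at_euler.
have dF x : differentiable F x by apply: smooth_at_differentiable.
have dc x : differentiable (F \o euler F h j) x by apply: differentiable_comp.
rewrite [RHS](_ : _ = 'D_w (euler F h j + h *: (F \o euler F h j)) y) //.
have dh : derivable (h *: (F \o euler F h j)) y w.
  by apply: derivableZ; exact: (diff_derivable (dc y)).
rewrite (deriveD (diff_derivable (de y)) dh).
by rewrite (deriveZ h (diff_derivable (dc y))) (derive_comp w (de y) (dF _)).
Qed.

Hypothesis bF : euler_bounded F.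

(** The base point stays in a ball, on which the derivative of [F] is bounded by some [K]; the
    vector part then grows by at most 1 + K h per step. *)
Lemma euler_bounded_tangent : euler_bounded (tangent_map F).
Proof.
move=> r; have [C C0 CP] := bF r.
have [K K0 KP] := smooth_derive_bound C sF.
have [r0|r0] := ltP r 0.
  by exists 0 => // N j y _ _ yr; have := le_lt_trans yr r0; rewrite normr_lt0.
have M0 : 0 <= C + expR K * r by rewrite addr_ge0 // mulr_ge0 // expR_ge0.
exists (C + expR K * r) => // N j u N0 jN ur.
rewrite -(hsubmxK u); set y := lsubmx u; set w := rsubmx u.
have yr : `|y| <= r by apply: le_trans ur; apply: lsubmx_norm.
have wr : `|w| <= r by apply: le_trans ur; apply: rsubmx_norm.
set h := N%:R^-1; have h0 : 0 <= h by rewrite invr_ge0.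
have step i : (i <= N)%N -> `|rsubmx (euler (tangent_map F) h i (row_mx y w))| <=
    (1 + K * h) ^+ i * r.
  elim: i => [|i IH] iN; first by rewrite row_mxKr expr0 mul1r.
  have := IH (ltnW iN).
  rewrite eulerS euler_tangent /tangent_map !row_mxKl !row_mxKr scale_row_mx add_row_mx row_mxKr.
  set d := 'D_w _ _ => dr; apply: le_trans (ler_normD _ _) _.
  rewrite exprS -mulrA [leRHS]mulrDl mul1r; apply: lerD => //.
  rewrite normrZ ger0_norm // -[leRHS]mulrA [leRHS]mulrCA; apply: ler_wpM2l => //.
  apply: le_trans (KP _ _ _) _; first exact: CP N0 (ltnW iN) yr.
  exact: ler_wpM2l.
have := step j jN; rewrite euler_tangent row_mxKr => dr.
apply: row_mx_norm => //.
  by apply: le_trans (CP _ _ _ N0 jN yr) _; rewrite lerDl mulr_ge0 // expR_ge0.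
apply: le_trans dr _; rewrite -[leLHS]add0r; apply: lerD => //.
apply: ler_wpM2r => //; apply: pow1_le_expR => //.
by rewrite /h mulrC ler_pdivrMr ?ltr0n // mul1r ler_nat.
Qed.

(** The first-order expansions of the iterates have remainders that are quadratic in [w] uniformly
    in [N]; they survive the passage to the limit. *)
Lemma derive_euler_lim y : differentiable (euler_lim F) y /\
  forall w, 'D_w (euler_lim F) y = rsubmx (euler_lim (tangent_map F) (row_mx y w)).
Proof.
pose E N := euler F N.+1%:R^-1 N.+1.
have dE N x : differentiable (E N) x.
  by apply: smooth_at_differentiable; apply: smooth_at_euler.
have sT := smooth_tangent_map; have bT := euler_bounded_tangent.
pose G w := rsubmx (euler_lim (tangent_map F) (row_mx y w)).
have EG w : (fun N => 'D_w (E N) y) @ \oo --> G w.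
  have := euler_cvg (y := row_mx y w) sT bT.
  move=> /(@cvg_comp _ _ _ _ (@rsubmx R 1 n n)) h.
  have {h} := h _ (@linear_rV_continuous _ _ _ (@rsubmx R 1 n n) _).
  have -> : (rsubmx \o (fun N => euler (tangent_map F) N.+1%:R^-1 N.+1 (row_mx y w))) =
      (fun N => 'D_w (E N) y) by apply/funext => N; rewrite /comp euler_tangent row_mxKr.
  exact.
(* [G] is a limit of linear maps, hence linear; [A] is its matrix. *)
pose A := \matrix_i G (delta_mx 0 i).
have GA w : G w = w *m A.
  have h1 : (fun N => \sum_i w 0 i *: 'D_(delta_mx 0 i) (E N) y) @ \oo --> \sum_i w 0 i *: G (delta_mx 0 i).
    by apply: cvg_bigsum => i; apply: cvgZr; exact: EG.
  have h2 : (fun N => 'D_w (E N) y) = (fun N => \sum_i w 0 i *: 'D_(delta_mx 0 i) (E N) y).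
    by apply/funext => N; rewrite derive_rV.
  have := EG w; rewrite h2 => h3.
  rewrite (cvg_unique _ h3 h1) ?mulmx_sum_row; last exact: norm_hausdorff.
  by apply: eq_bigr => i _; rewrite rowK.
have [L L0 LP] := euler_lipschitz sT bT (`|y| + 1).
(* The derivatives of [E N] are halves of Euler iterates of the lift, which are Lipschitz uniformly
   in [N]. Normalizing [w] to the unit vector [w'] keeps all arguments in the fixed ball for which
   [L] was obtained. *)
have est N w : `|w| <= 1 -> `|E N (y + w) - E N y - 'D_w (E N) y| <= L * `|w| * `|w|.
  move=> w1; have [->|wn0] := eqVneq w 0.
    by rewrite addr0 derive0 subrr subr0 normr0 mulr0.
  have nw : 0 < `|w| by rewrite normr_gt0.
  pose w' := `|w|^-1 *: w.
  have nw' : `|w'| = 1 by rewrite normrZ normfV normr_id mulVf // gt_eqF.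
  have wE : w = `|w| *: w' by rewrite scalerA divff ?gt_eqF // scale1r.
  have Dw x : 'D_w (E N) x = `|w| *: 'D_w' (E N) x.
    by rewrite {1}wE !deriveE // linearZ.
  pose L0' : {linear 'rV[R]_n -> 'rV[R]_n} := 'd (E N) y.
  have dL x : differentiable L0' x.
    by apply: linear_differentiable; apply: linear_rV_continuous.
  pose g x := E N x - L0' x.
  have -> : E N (y + w) - E N y - 'D_w (E N) y = g (y + w) - g y.
    rewrite deriveE // /g (linearD L0'); exact: subr_shuffle.
  apply: mean_value_rV; first by rewrite !mulr_ge0.
    by move=> t _; apply: differentiableB.
  move=> t /andP[t0 t1].
  rewrite /g deriveB; [|exact: diff_derivable|exact: diff_derivable].
  rewrite [X in _ - X]deriveE // diff_lin; last exact: linear_rV_continuous.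
  rewrite -deriveE // !Dw -scalerBr normrZ normr_id mulrC; apply: ler_wpM2r => //.
  have tw : `|t *: w| <= `|w| by rewrite normrZ ger0_norm // ler_piMl.
  have := LP N.+1 N.+1 (row_mx (y + t *: w) w') (row_mx y w') isT (leqnn _).
  rewrite !euler_tangent opp_row_mx add_row_mx opp_row_mx add_row_mx.
  have e0 : y + t *: w - y = t *: w by rewrite addrC addKr.
  rewrite e0 (subrr w') => h.
  have b1 : `|y| <= `|y| + 1 by rewrite lerDl.
  have b2 : `|w'| <= `|y| + 1 by rewrite nw' lerDr.
  have b0 : 0 <= `|y| + 1 by rewrite addr_ge0.
  have b3 : `|y + t *: w| <= `|y| + 1.
    by apply: le_trans (ler_normD _ _) _; rewrite lerD2l (le_trans tw).
  have {}h := h (row_mx_norm b0 b3 b2) (row_mx_norm b0 b1 b2).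
  apply: le_trans (_ : _ <= L * `|row_mx (t *: w) (0 : 'rV[R]_n)|) _.
    by apply: le_trans h; rewrite -[X in `|X| <= _](row_mxKr (E N (y + t *: w) - E N y)); exact: rsubmx_norm.
  by apply: ler_wpM2l => //; apply: row_mx_norm => //; rewrite normr0.
have Ec z : (fun N => E N z) @ \oo --> euler_lim F z by exact: euler_cvg.
have lest w : `|w| <= 1 -> `|euler_lim F (y + w) - euler_lim F y - G w| <= L * `|w| * `|w|.
  move=> w1; apply: (@cvg_norm_le _ (fun N => E N (y + w) - E N y - 'D_w (E N) y) _ _ 0%N).
    by apply: cvgB; [apply: cvgB; exact: Ec|exact: EG].
  by move=> N _; exact: est.
have [dl dE'] : differentiable (euler_lim F) y /\ 'd (euler_lim F) y = mulmxr A :> (_ -> _).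
  apply: differentiable_eps; first exact: linear_rV_continuous.
  move=> e e0.
  have L1 : 0 < L + 1 by rewrite ltr_wpDl.
  have d0 : 0 < Num.min 1 (e / (L + 1)) by rewrite lt_min ltr01 divr_gt0.
  apply/nbhs_ballP; exists (Num.min 1 (e / (L + 1))) => //= h.
  rewrite -ball_normE /= sub0r normrN lt_min => /andP[/ltW h1 /ltW h2].
  rewrite [h + y]addrC /= -GA; apply: le_trans (lest h h1) _.
  apply: ler_wpM2r => //; apply: (@le_trans _ _ ((L + 1) * `|h|)).
    by apply: ler_wpM2r => //; rewrite lerDl.
  by rewrite mulrC -ler_pdivlMr.
split=> // w; rewrite deriveE // -/(G w) GA.
exact: (congr1 (fun F => F w) dE').
Qed.

End euler_tangent.

(* A derivative of the limit of the Euler iterates is again such a limit, for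
   the tangent map; this drives the induction on the order. *)
Lemma smooth_euler_lim n (F : 'rV[R]_n -> 'rV[R]_n) :
  (forall x, smooth_at F x) -> euler_bounded F -> forall y, smooth_at (euler_lim F) y.
Proof.
move=> sF bF y; apply: nbhsW => {}y k.
suff : forall k n (F : 'rV[R]_n -> 'rV[R]_n), (forall x, smooth_at F x) ->
    euler_bounded F -> Ck_on k setT (euler_lim F).
  by move=> /(_ k n F sF bF); apply: Ck_on_sub.
move=> {n F sF bF y k}; elim=> [|k IH] n F sF bF.
  by move=> x _; apply: differentiable_continuous; have [] := derive_euler_lim sF bF x.
apply/Ck_onS; split=> [x _|w]; first by have [] := derive_euler_lim sF bF x.
have -> : 'D_w (euler_lim F) = @rsubmx R 1 n n \o (euler_lim (tangent_map F) \o (fun y => row_mx y w)).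
  by apply/funext => x; have [_ ->] := derive_euler_lim sF bF x.
apply: (Ck_lin_comp (L := @rsubmx R 1 n n)) => //; first exact: openT.
  exact: linear_rV_continuous.
apply: Ck_rV => [|j]; first exact: openT.
apply: (@Ck_comp R _ _ k setT (fun y => row_mx y w) (fun u => euler_lim (tangent_map F) u 0 j)).
- exact: openT.
- have : smooth_on setT (fun y : 'rV[R]_n => row_mx y w).
    apply/smooth_onP => [|x _]; first exact: openT.
    by apply: smooth_at_row_mx; [exact: smooth_at_id|exact: smooth_at_cst].
  exact.
- move=> x _; apply: (@Ck_on_sub _ _ _ _ setT) => //.
  apply: Ck_coord; first exact: openT.
  by apply: IH; [exact: smooth_tangent_map|exact: euler_bounded_tangent].
Qed.

End euler_scheme.

Lemma smooth_at_scale_rV (R : realType) (W : normedModType R) m (f : W -> R) (g : W -> 'rV[R]_m) (a : W) :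
  smooth_at f a -> smooth_at g a -> smooth_at (fun y => f y *: g y) a.
Proof.
move=> sf sg; apply: smooth_at_rV => j.
apply: (@smooth_at_near_eq R W R (fun y => f y * g y 0 j)).
  by apply: nbhsW => y; rewrite [RHS]mxE.
by apply: smooth_atM => //; apply: smooth_at_coord.
Qed.

(** * The flow of a bounded vector field *)

Section flow.
Context {R : realType} {n : nat} (V : 'rV[R]_n -> 'rV[R]_n) (K : R).
Hypothesis sV : forall x, smooth_at V x.
Hypothesis VK : forall x, `|V x| <= K.
Implicit Types (x y z : 'rV[R]_n) (s : R).

(* The time-one map of this autonomous field is (s, x) |-> (s, flow s x), whence
   the joint smoothness of the flow. *)
Definition flow_field (u : 'rV[R]_(1 + n)) : 'rV[R]_(1 + n) :=
  row_mx 0 (lsubmx u 0 0 *: V (rsubmx u)).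

Definition flow s x : 'rV[R]_n :=
  rsubmx (euler_lim flow_field (row_mx (const_mx s) x)).

Lemma smooth_flow_field u : smooth_at flow_field u.
Proof.
apply: smooth_at_row_mx; first exact: smooth_at_cst.
apply: smooth_at_scale_rV; first by apply: smooth_at_coord; exact: smooth_at_lsubmx.
exact: (@smooth_at_comp _ _ _ _ (@rsubmx _ 1 1 n) V _ (smooth_at_rsubmx u)).
Qed.

Lemma euler_flow h j s x : euler flow_field h j (row_mx (const_mx s) x) =
  row_mx (const_mx s) (euler V (h * s) j x).
Proof.
elim: j => // j IH; rewrite !eulerS IH /flow_field row_mxKl row_mxKr mxE.
by rewrite scale_row_mx add_row_mx scaler0 addr0 scalerA.
Qed.

Lemma row_const_mxE (u : 'rV[R]_(1 + n)) : u = row_mx (const_mx (lsubmx u 0 0)) (rsubmx u).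
Proof.
rewrite -{1}(hsubmxK u); congr row_mx.
by apply/rowP => i; rewrite !mxE (ord1 i).
Qed.

Lemma const_mx_norm s : `|const_mx s : 'rV[R]_1| = `|s|.
Proof.
apply/eqP; rewrite eq_le; apply/andP; split.
  by apply: rV_norm_le => // j; rewrite mxE.
by have := rV_coord_le (const_mx s : 'rV[R]_1) 0; rewrite mxE.
Qed.

Lemma bound_ge0 : 0 <= K.
Proof. by apply: le_trans (VK 0). Qed.

Lemma euler_dist h j x : `|euler V h j x - x| <= `|h| * j%:R * K.
Proof.
elim: j => [|j IH]; first by rewrite subrr normr0 mulr0 mul0r.
rewrite eulerS addrAC; apply: le_trans (ler_normD _ _) _.
rewrite -natr1 mulrDr mulr1 mulrDl; apply: lerD => //.
by rewrite normrZ ler_wpM2l.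
Qed.

Lemma inv_mul_le1 N j : (0 < N)%N -> (j <= N)%N -> N%:R^-1 * j%:R <= 1 :> R.
Proof. by move=> N0 jN; rewrite mulrC ler_pdivrMr ?ltr0n // mul1r ler_nat. Qed.

Lemma euler_bounded_flow_field : euler_bounded flow_field.
Proof.
move=> r; have K0 := bound_ge0.
have C0 : 0 <= `|r| + `|r| * K by rewrite addr_ge0 // mulr_ge0.
exists (`|r| + `|r| * K) => // N j u N0 jN ur.
rewrite [u]row_const_mxE euler_flow.
have ur' : `|u| <= `|r| by apply: le_trans ur (ler_norm _).
have sr : `|lsubmx u 0 0| <= `|r|.
  by apply: le_trans (rV_coord_le _ _) (le_trans (lsubmx_norm _) ur').
apply: row_mx_norm => //.
  by rewrite const_mx_norm; apply: le_trans sr _; rewrite lerDl mulr_ge0.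
set x := rsubmx u; rewrite -(subrK x (euler _ _ _ _)) addrC.
apply: le_trans (ler_normD _ _) _; apply: lerD.
  exact: le_trans (rsubmx_norm _) ur'.
apply: le_trans (euler_dist _ _ _) _; apply: ler_wpM2r => //.
rewrite normrM mulrAC ger0_norm ?invr_ge0 //.
rewrite -[leRHS]mul1r; apply: ler_pM => //.
exact: inv_mul_le1.
Qed.

Lemma flow_cvg s x : (fun N => euler V (N.+1%:R^-1 * s) N.+1 x) @ \oo --> flow s x.
Proof.
have := euler_cvg (y := row_mx (const_mx s) x) smooth_flow_field euler_bounded_flow_field.
move=> /(@cvg_comp _ _ _ _ (@rsubmx R 1 1 n)) h.
have {h} := h _ (@linear_rV_continuous _ _ _ (@rsubmx R 1 1 n) _).
rewrite (_ : _ \o _ = fun N => euler V (N.+1%:R^-1 * s) N.+1 x) //.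
by apply/funext => N; rewrite /comp euler_flow row_mxKr.
Qed.

Lemma smooth_flow u : smooth_at (fun u : 'rV[R]_(1 + n) => flow (lsubmx u 0 0) (rsubmx u)) u.
Proof.
apply: (@smooth_at_near_eq R _ _ (@rsubmx R 1 1 n \o euler_lim flow_field)).
  by apply: nbhsW => v /=; rewrite /flow -row_const_mxE.
apply: smooth_at_comp; last exact: smooth_at_rsubmx.
exact: (smooth_euler_lim smooth_flow_field euler_bounded_flow_field).
Qed.

Lemma flow0 x : flow 0 x = x.
Proof.
have h := @flow_cvg 0 x.
have e : (fun N => euler V (N.+1%:R^-1 * 0) N.+1 x) = fun=> x.
  apply/funext => N; rewrite mulr0; elim: N.+1 => // j IH.
  by rewrite eulerS IH scale0r addr0.
rewrite e in h; apply: cvg_unique h _; first exact: norm_hausdorff.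
exact: cvg_cst.
Qed.

(** Along a polygon of total time [s] the point moves by at most |s| K, so [V] varies by at most L
    |s| K; this is uniform in the number of steps. *)
Lemma flow_first_order x : exists2 C, 0 <= C & forall s, `|s| <= 1 ->
  `|flow s x - x - s *: V x| <= C * `|s| * `|s|.
Proof.
have K0 := bound_ge0.
have [L L0 LP] := smooth_lipschitz_ball (`|x| + K) sV.
exists (L * K); first exact: mulr_ge0.
move=> s s1.
apply: (@cvg_norm_le _ _ (fun N => euler V (N.+1%:R^-1 * s) N.+1 x - x - s *: V x) _ _ 0%N).
  by apply: cvgB; [apply: cvgB; [exact: flow_cvg|exact: cvg_cst]|exact: cvg_cst].
move=> N _; set h := N.+1%:R^-1 * s.
have hj j : (j <= N.+1)%N -> `|h| * j%:R <= `|s|.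
  move=> jN; rewrite /h normrM mulrAC ger0_norm ?invr_ge0 //.
  by apply: ler_piMl => //; apply: inv_mul_le1.
have step j : (j <= N.+1)%N ->
    `|euler V h j x - x - (h * j%:R) *: V x| <= `|h| * j%:R * (L * (`|s| * K)).
  elim: j => [|j IH] jN; first by rewrite mulr0 scale0r subrr subr0 normr0 mulr0 mul0r.
  rewrite eulerS -natr1.
  have -> : euler V h j x + h *: V (euler V h j x) - x - (h * (j%:R + 1)) *: V x =
     (euler V h j x - x - (h * j%:R) *: V x) + h *: (V (euler V h j x) - V x).
    rewrite mulrDr mulr1 scalerDl scalerBr opprD !addrA; congr (_ + _).
    by rewrite -!addrA; congr (_ + _); rewrite addrC -!addrA.
  have -> : `|h| * (j%:R + 1) * (L * (`|s| * K)) = `|h| * j%:R * (L * (`|s| * K)) + `|h| * (L * (`|s| * K)) by ring.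
  apply: le_trans (ler_normD _ _) _; apply: lerD; first by apply: IH; exact: ltnW.
  rewrite normrZ; apply: ler_wpM2l => //.
  have dj : `|euler V h j x - x| <= `|s| * K.
    apply: le_trans (euler_dist _ _ _) _; apply: ler_wpM2r => //; apply: hj; exact: ltnW.
  apply: le_trans (LP _ _ _ _) _; last by apply: ler_wpM2l.
    rewrite -(subrK x (euler _ _ _ _)) addrC; apply: le_trans (ler_normD _ _) _.
    rewrite lerD2l; apply: le_trans dj _; exact: ler_piMl.
  by rewrite lerDl.
have := step N.+1 (leqnn _).
have -> : h * N.+1%:R = s by rewrite /h mulrAC mulVf ?mul1r // pnatr_eq0.
move=> hs; apply: le_trans hs _; have := hj N.+1 (leqnn _).
have -> : L * K * `|s| * `|s| = `|s| * (L * (`|s| * K)) by ring.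
by move=> h1; apply: ler_wpM2r => //; rewrite !mulr_ge0.
Qed.

(** The uniform Lipschitz bound lets the starting point vary with [N]; [flow_mul] starts from the
    end of another polygon. *)
Lemma flow_cvg_seq s (a : nat -> 'rV[R]_n) b : a @ \oo --> b ->
  (fun N => euler V (N.+1%:R^-1 * s) N.+1 (a N)) @ \oo --> flow s b.
Proof.
move=> ab.
have [L L0 LP] := euler_lipschitz smooth_flow_field euler_bounded_flow_field (`|s| + `|b| + 1).
apply/cvgrPdist_le => e e0.
have e20 : 0 < e / 2 by rewrite divr_gt0.
have eL : 0 < e / 2 / (L + 1) by rewrite divr_gt0 // ltr_wpDl.
move/cvgrPdist_le : (@flow_cvg s b) => /(_ _ e20) h1.
move/cvgrPdist_le : (ab) => /(_ _ eL) h2.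
move/cvgrPdist_le : (ab) => /(_ _ ltr01) h3.
apply: filterS3 h1 h2 h3 => N h1 h2 h3.
apply: (@le_trans _ _ (e / 2 + e / 2)); last lra.
apply: le_trans (norm_triangle _ (euler V (N.+1%:R^-1 * s) N.+1 b) _) _; apply: lerD => //.
have aN : `|a N| <= `|s| + `|b| + 1.
  rewrite -addrA; apply: le_trans (_ : `|b| + 1 <= _); last by rewrite lerDr.
  rewrite -(subrK b (a N)) addrC; apply: le_trans (ler_normD _ _) _.
  by rewrite lerD2l distrC.
have C0 : 0 <= `|s| + `|b| + 1 by rewrite !addr_ge0.
have := LP N.+1 N.+1 (row_mx (const_mx s) b) (row_mx (const_mx s) (a N)) isT (leqnn _).
rewrite !euler_flow !opp_row_mx !add_row_mx (subrr (const_mx s)) => h.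
have ss : `|const_mx s : 'rV[R]_1| <= `|s| + `|b| + 1.
  by rewrite const_mx_norm -addrA lerDl addr_ge0.
have bb : `|b| <= `|s| + `|b| + 1 by rewrite addrAC lerDr addr_ge0.
have {}h := h (row_mx_norm C0 ss bb) (row_mx_norm C0 ss aN).
apply: le_trans (_ : _ <= L * `|row_mx (0 : 'rV[R]_1) (b - a N)|) _.
  by apply: le_trans h; rewrite -[X in `|X| <= _](row_mxKr (0 : 'rV[R]_1)); exact: rsubmx_norm.
apply: (@le_trans _ _ (L * (e / 2 / (L + 1)))).
  apply: ler_wpM2l => //; apply: row_mx_norm => //; first exact: ltW.
  by rewrite normr0 ltW.
rewrite mulrCA; apply: ler_piMr; first exact: ltW.
by rewrite ler_pdivrMr ?ltr_wpDl // mul1r lerDl.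
Qed.

(** The group law for multiples of one time: with step s/N, the N(k+2) steps split exactly into
    N(k+1) steps followed by N. This is the part of the law that [derive_flow] uses. *)
Lemma flow_mul s k x : flow (k.+2%:R * s) x = flow s (flow (k.+1%:R * s) x).
Proof.
(* A subsequence of the polygons for time (m+1)s; its index is shifted by one because these are
   indexed by [N.+1]. *)
have sub m : (fun N => euler V (N.+1%:R^-1 * s) (N.+1 * m.+1) x) @ \oo --> flow (m.+1%:R * s) x.
  have h := @flow_cvg (m.+1%:R * s) x.
  have hm : (fun N => N.+1 * m.+1 - 1)%N @ \oo --> \oo.
    move=> P [N0 _ NP]; exists N0 => // N /= NN; apply: NP => /=.
    rewrite mulSn addSn subn1 /=.
    exact: leq_trans NN (leq_trans (leq_pmulr N (ltn0Sn m)) (leq_addl m _)).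
  have := cvg_comp _ _ hm h; rewrite (_ : _ \o _ = fun N => euler V (N.+1%:R^-1 * s) (N.+1 * m.+1) x) //.
  apply/funext => N; have E : (N.+1 * m.+1 - 1).+1 = (N.+1 * m.+1)%N by rewrite subn1 prednK.
  rewrite -[LHS]/(euler V ((N.+1 * m.+1 - 1).+1%:R^-1 * (m.+1%:R * s)) (N.+1 * m.+1 - 1).+1 x) E.
  congr (euler V _ _ x); rewrite natrM; field.
  by rewrite !nat1r !pnatr_eq0.
have h2 := @flow_cvg_seq s _ _ (sub k).
have h1 := sub k.+1.
apply: cvg_unique h1 _; first exact: norm_hausdorff.
rewrite (_ : (fun N => _) = fun N => euler V (N.+1%:R^-1 * s) N.+1 (euler V (N.+1%:R^-1 * s) (N.+1 * k.+1) x)) //.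
by apply/funext => N; rewrite -eulerD -mulnS.
Qed.

Lemma differentiable_flow_time x s : differentiable (fun s => flow s x) s.
Proof.
pose j (s : R) : 'rV[R]_(1 + n) := row_mx (const_mx s) x.
have sj : smooth_at j s.
  apply: smooth_at_row_mx; last exact: smooth_at_cst.
  apply: smooth_at_rV => i; apply: smooth_at_near_eq (smooth_at_id s).
  by apply: nbhsW => t; rewrite mxE.
have : smooth_at ((fun u : 'rV[R]_(1 + n) => flow (lsubmx u 0 0) (rsubmx u)) \o j) s.
  by apply: smooth_at_comp => //; exact: smooth_flow.
have E : (fun s => flow s x) = (fun u : 'rV[R]_(1 + n) => flow (lsubmx u 0 0) (rsubmx u)) \o j.
  by apply/funext => t; rewrite /comp /j row_mxKl row_mxKr mxE.
by rewrite E; exact: smooth_at_differentiable.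
Qed.

(** Differentiability in time is already known, so it suffices to compute the derivative along
    arbitrarily small non-zero [h]. For h = s/(k+1), [flow_mul] moves the base point to [flow s x],
    where [flow_first_order] applies. *)
Lemma derive_flow x s : 'D_1 (fun s => flow s x) s = V (flow s x).
Proof.
have df := differentiable_flow_time x s.
set D := (X in X = _); set z := flow s x.
have dD h : 'd (fun s => flow s x) s h = h *: D.
  by rewrite (deriv1E (diff_derivable df)) /= derive1E.
have small d : 0 < d -> exists h, [/\ h != 0, `|h| < d & flow (h + s) x = flow h z].
  move=> d0; have [s0|s0] := eqVneq s 0.
    exists (d / 2); rewrite s0 addr0 /z s0 flow0; split=> //.
      by rewrite gt_eqF // divr_gt0.
    by rewrite gtr0_norm ?divr_gt0 //; lra.
  have [k kP] : exists k : nat, `|s| / d < k.+1%:R.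
    by exists (Num.truncn (`|s| / d)); exact: truncnS_gt.
  exists (s / k.+1%:R); split.
  - by rewrite mulf_neq0 // invr_eq0 pnatr_eq0.
  - by rewrite normrM normfV normr_nat ltr_pdivrMr ?ltr0n // mulrC -ltr_pdivrMr.
  - have E1 : s = k.+1%:R * (s / k.+1%:R) by rewrite mulrCA mulfV ?mulr1 // pnatr_eq0.
    have := flow_mul (s / k.+1%:R) k x; rewrite -E1 => <-.
    congr (flow _ x); rewrite {2}E1 -[k.+2%:R]natr1 mulrDl mul1r.
    by rewrite addrC.
have [C C0 CP] := flow_first_order z.
apply/eqP; rewrite -subr_eq0 -normr_le0; apply/ler_addgt0Pr => e e0; rewrite add0r.
have e20 : 0 < e / 2 by rewrite divr_gt0.
have /nbhs_ballP[d /= d0 dP] := diff_eps df e20.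
pose d' := Num.min d (Num.min 1 (e / 2 / (C + 1))).
have C1 : 0 < C + 1 by rewrite ltr_wpDl.
have d'0 : 0 < d' by rewrite !lt_min d0 ltr01 !divr_gt0.
have [h [h0 hd fh]] := small d' d'0.
move: hd; rewrite !lt_min => /and3P[hd h1 h2].
have h3 := dP h; rewrite -ball_normE /= sub0r normrN in h3; have {}h3 := h3 hd.
rewrite fh dD -/z in h3; have h4 := CP h (ltW h1).
have nh : 0 < `|h| by rewrite normr_gt0.
rewrite -(ler_pM2l nh) -normrZ scalerBr.
apply: le_trans (norm_triangle _ (flow h z - z) _) _; rewrite distrC.
apply: (le_trans (lerD h3 h4)).
rewrite -mulrA [C * _]mulrA [C * `|h| * `|h|]mulrC [e / 2 * _]mulrC -mulrDr.
apply: ler_wpM2l => //.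
have : C * `|h| <= e / 2.
  apply: le_trans (_ : (C + 1) * `|h| <= _); first by apply: ler_wpM2r => //; rewrite lerDl.
  by rewrite mulrC -ler_pdivlMr // ltW.
lra.
Qed.

End flow.

(** * Bump functions *)

Section bump.
Context {R : realType}.
Implicit Types x h : R.

(* The derivatives of exp(-1/x) are linear combinations of the x^-j exp(-1/x). *)
Definition flat (j : nat) x : R := if 0 < x then x^-1 ^+ j * expR (- x^-1) else 0.

Lemma flat_le0 j x : x <= 0 -> flat j x = 0.
Proof. by rewrite /flat; case: ltP. Qed.

(** With m = j + 2, exp u is the m-th power of exp(u/m), hence at least (u/m)^m. The two extra
    powers give the quadratic bound that makes [flat j] differentiable at 0. *)
Lemma pow_expRN_bound j (u : R) : 0 < u ->
  u ^+ j * expR (- u) <= j.+2%:R ^+ j.+2 * u^-1 ^+ 2.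
Proof.
move=> u0.
have h : (u / j.+2%:R) ^+ j.+2 <= expR u.
  have -> : expR u = expR (u / j.+2%:R) ^+ j.+2.
    by rewrite -expRM_natr -mulrA mulVf ?mulr1 // pnatr_eq0.
  apply: lerXn2r; rewrite ?nnegrE ?expR_ge0 ?divr_ge0 ?ltW //.
  by apply: lt_le_trans (expR_ge1Dx _); rewrite ltrDr.
have ju : 0 < j.+2%:R ^+ j.+2 :> R by rewrite exprn_gt0 // ltr0n.
have {}h : u ^+ j.+2 <= j.+2%:R ^+ j.+2 * expR u.
  by move: h; rewrite exprMn exprVn ler_pdivrMr // mulrC.
rewrite expRN ler_pdivrMr ?expR_gt0 // mulrAC exprVn ler_pdivlMr ?exprn_gt0 //.
by rewrite -exprD addn2.
Qed.

Lemma flat_bound j x : `|flat j x| <= j.+2%:R ^+ j.+2 * x ^+ 2.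
Proof.
rewrite /flat; case: ltP => x0; last by rewrite normr0 mulr_ge0 ?sqr_ge0 ?exprn_ge0.
have u0 : 0 < x^-1 by rewrite invr_gt0.
rewrite ger0_norm; last by rewrite mulr_ge0 // ?expR_ge0 // exprn_ge0 // ltW.
by have := pow_expRN_bound j u0; rewrite invrK.
Qed.

Lemma is_derive_flat j x : is_derive x 1 (flat j) (flat j.+2 x - j%:R * flat j.+1 x).
Proof.
have [x0|x0|x0] := ltgtP x 0.
- rewrite !flat_le0 ?ltW // mulr0 subr0.
  apply: near_eq_is_derive (is_derive_cst (0 : R) x 1).
  have : \forall y \near x, y < 0 by exact: lt_nbhsl.
  by apply: filterS => y y0; rewrite flat_le0 // ltW.
- apply: (@near_eq_is_derive _ _ _ (fun y : R => y^-1 ^+ j * expR (- y^-1))).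
    have : \forall y \near x, 0 < y by apply: open_nbhs_nbhs; split=> //; exact: open_gt.
    by apply: filterS => y y0; rewrite /flat y0.
  have xn0 : x != 0 by rewrite gt_eqF.
  have dV : is_derive x 1 (fun y : R => y^-1) (- x^-1 ^+ 2).
    have h : derivable (fun y : R => y) x 1 by exact: derivable_id.
    apply: DeriveDef; first exact: (derivableV xn0 h).
    by rewrite (deriveV xn0 h) derive_id scaleNr /GRing.scale /= mulr1 exprVn.
  have dE : is_derive x 1 (fun y : R => expR (- y^-1)) (expR (- x^-1) * x^-1 ^+ 2).
    have dN : is_derive x 1 (fun y : R => - y^-1) (x^-1 ^+ 2).
      by apply: is_derive_eq (opprK _); exact: is_deriveN.
    exact: (@is_derive1_comp R expR (fun y : R => - y^-1) x _ _ (is_derive_expR _) dN).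
  have dP : is_derive x 1 (fun y : R => y^-1 ^+ j) (- (j%:R * x^-1 ^+ j.+1)).
    have dp : is_derive x^-1 1 (fun y : R => y ^+ j) (j%:R * x^-1 ^+ j.-1).
      by apply: DeriveDef; [exact: exprn_derivable|rewrite exp_derive /GRing.scale /= mulr1 mulr_natl].
    have h := @is_derive1_comp R (fun y => y ^+ j) (fun y : R => y^-1) x _ _ dp dV.
    refine (is_derive_eq h _).
    case: j {dp h} => [|j] /=; first by rewrite !mul0r oppr0.
    by rewrite !exprS expr0; ring.
  have h := is_deriveM dP dE; refine (is_derive_eq h _).
  rewrite /GRing.scale /= /flat x0 !exprS expr0; ring.
- rewrite x0 !flat_le0 // mulr0 subr0.
  have C0 : 0 < j.+2%:R ^+ j.+2 :> R by rewrite exprn_gt0 // ltr0n.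
  have L0 : linear (fun _ : R => 0 : R) by move=> a u v; rewrite scaler0 addr0.
  pose L : {linear R -> R} := HB.pack (fun _ : R => 0 : R) (GRing.isLinear.Build R R R _ _ L0).
  have [d e] : differentiable (flat j) 0 /\ 'd (flat j) 0 = L :> (R -> R).
    apply: differentiable_eps => [y|e e0]; first exact: cvg_cst.
    apply/nbhs_ballP; exists (e / j.+2%:R ^+ j.+2); first exact: divr_gt0.
    move=> h; rewrite -ball_normE /= sub0r normrN => hd.
    rewrite addr0 [flat j 0]flat_le0 // !subr0.
    apply: le_trans (flat_bound _ _) _; rewrite -real_normK ?num_real //.
    rewrite expr2 mulrA; apply: ler_wpM2r => //.
    by rewrite mulrC -ler_pdivlMr // ltW.
  apply: DeriveDef; first exact: diff_derivable.
  by rewrite deriveE // e.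
Qed.

Lemma derive1_scale (f : R -> R) x v : derivable f x 1 -> 'D_v f x = v * 'D_1 f x.
Proof.
move=> df; have d : differentiable f x by apply/derivable1_diffP.
by rewrite deriveE // (deriv1E df) derive1E.
Qed.

Lemma smooth_flat j x : smooth_at (flat j) x.
Proof.
apply: nbhsW => {}x k.
suff : Ck_on k setT (flat j) by apply: Ck_on_sub.
elim: k j => [|k IH] j.
  move=> y _; apply: differentiable_continuous; apply/derivable1_diffP.
  by have [] := is_derive_flat j y.
apply/Ck_onS; split=> [y _|v].
  by apply/derivable1_diffP; have [] := is_derive_flat j y.
have -> : 'D_v (flat j) = fun y => v * (flat j.+2 y + - j%:R * flat j.+1 y).
  apply/funext => y; have [dy e] := is_derive_flat j y.
  by rewrite (derive1_scale v dy) e mulNr.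
have oT : open [set: R] by exact: openT.
apply: CkM => //; first exact: Ck_cst.
by apply: CkD => //; apply: CkM => //; exact: Ck_cst.
Qed.

Definition smooth_step x : R := flat 0 x / (flat 0 x + flat 0 (1 - x)).

Lemma flat_ge0 x : 0 <= flat 0 x.
Proof. by rewrite /flat; case: ltP => // _; rewrite mulr_ge0 ?expR_ge0 // expr0. Qed.

Lemma flat_gt0 x : 0 < x -> 0 < flat 0 x.
Proof. by rewrite /flat => ->; rewrite expr0 mul1r expR_gt0. Qed.

Lemma smooth_step_den x : 0 < flat 0 x + flat 0 (1 - x).
Proof.
have [x0|x0] := ltP 0 x; first by rewrite ltr_pwDl ?flat_gt0 ?flat_ge0.
by rewrite ltr_wpDl ?flat_ge0 // flat_gt0 // subr_gt0 (le_lt_trans x0).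
Qed.

Lemma smooth_step_ge0 x : 0 <= smooth_step x.
Proof. by rewrite divr_ge0 ?flat_ge0 // ltW // smooth_step_den. Qed.

Lemma smooth_step_le1 x : smooth_step x <= 1.
Proof. by rewrite ler_pdivrMr ?smooth_step_den // mul1r lerDl flat_ge0. Qed.

Lemma smooth_step0 x : x <= 0 -> smooth_step x = 0.
Proof. by move=> x0; rewrite /smooth_step flat_le0 // mul0r. Qed.

Lemma smooth_step1 x : 1 <= x -> smooth_step x = 1.
Proof.
move=> x1; rewrite /smooth_step [flat 0 (1 - x)]flat_le0 ?subr_le0 // addr0.
by rewrite divff // gt_eqF // flat_gt0 // (lt_le_trans ltr01).
Qed.

Lemma smooth_smooth_step x : smooth_at smooth_step x.
Proof.
apply: smooth_atM; first exact: smooth_flat.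
apply: smooth_atV; first by rewrite gt_eqF // smooth_step_den.
apply: smooth_atD; first exact: smooth_flat.
apply: (@smooth_at_comp1 R R (fun y => 1 - y) (flat 0)); last exact: smooth_flat.
by apply: smooth_atB; [exact: smooth_at_cst|exact: smooth_at_id].
Qed.

(* The argument of the step is at least 1 when |v_i| <= r and nonpositive when |v_i| >= 2r. *)
Definition bump n (a : 'rV[R]_n) (r : R) (v : 'rV[R]_n) : R :=
  \prod_i smooth_step (2 - ((v 0 i - a 0 i) / r) ^+ 2).

Lemma bump_ge0 n (a : 'rV[R]_n) r v : 0 <= bump a r v.
Proof. by apply: prodr_ge0 => i _; exact: smooth_step_ge0. Qed.

Lemma bump_le1 n (a : 'rV[R]_n) r v : bump a r v <= 1.
Proof.
by apply: prodr_ile1 => i _; rewrite smooth_step_ge0 smooth_step_le1.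
Qed.

Lemma bump1 n (a : 'rV[R]_n) r v : 0 < r -> `|v - a| <= r -> bump a r v = 1.
Proof.
move=> r0 var; apply: big1 => i _; apply: smooth_step1.
have h : `|(v 0 i - a 0 i) / r| <= 1.
  rewrite normrM normfV [`|r|]gtr0_norm // ler_pdivrMr // mul1r.
  by apply: le_trans var; have := rV_coord_le (v - a) i; rewrite !mxE.
have : ((v 0 i - a 0 i) / r) ^+ 2 <= 1.
  by rewrite -real_normK ?num_real // exprn_ile1.
lra.
Qed.

Lemma bump0 n (a : 'rV[R]_n) r v : 0 < r -> 2 * r <= `|v - a| -> bump a r v = 0.
Proof.
move=> r0 var.
have [i hi] : exists i, 2 * r <= `|v 0 i - a 0 i|.
  apply/not_existsP => h; have : `|v - a| <= \big[Num.max/0]_i `|v 0 i - a 0 i|.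
    apply: rV_norm_le; first by rewrite bigmax_ge_id.
    by move=> j; rewrite !mxE le_bigmax.
  move=> /(le_trans var); rewrite leNgt => /negP; apply.
  apply/bigmax_ltP; split=> [|i _]; first by rewrite mulr_gt0.
  by have /negP := h i; rewrite -ltNge.
rewrite /bump (bigD1 i) //= smooth_step0 ?mul0r //.
have h : 2 <= `|(v 0 i - a 0 i) / r|.
  by rewrite normrM normfV [`|r|]gtr0_norm // ler_pdivlMr.
have : 2 ^+ 2 <= ((v 0 i - a 0 i) / r) ^+ 2.
  by rewrite -[X in _ <= X]real_normK ?num_real // lerXn2r // nnegrE.
rewrite expr2; lra.
Qed.

Lemma smooth_bump n (a : 'rV[R]_n) r v : smooth_at (bump a r) v.
Proof.
apply: smooth_at_prod => i _.
apply: (@smooth_at_comp1 R _ (fun v : 'rV[R]_n => 2 - ((v 0 i - a 0 i) / r) ^+ 2) smooth_step);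
  last exact: smooth_smooth_step.
apply: smooth_atB; first exact: smooth_at_cst.
have s1 : smooth_at (fun v : 'rV[R]_n => (v 0 i - a 0 i) / r) v.
  apply: smooth_atM; last exact: smooth_at_cst.
  by apply: smooth_atB; [apply: smooth_at_coord; exact: smooth_at_id|exact: smooth_at_cst].
apply: smooth_at_near_eq (smooth_atM s1 s1).
by apply: nbhsW => w; rewrite expr2.
Qed.

End bump.

(** * Making a germ global and bounded *)

Section cutoff.
Context {R : realType}.

(** Supplies the global bounded field that [flow] requires from a field given near a point only. *)
Lemma cutoff n m (V : 'rV[R]_n -> 'rV[R]_m) a : smooth_at V a ->
  exists (W : 'rV[R]_n -> 'rV[R]_m) (K : R), [/\ forall y, smooth_at W y,
    forall y, `|W y| <= K & \forall y \near a, W y = V y].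
Proof.
move=> /smooth_at_nbhs/nbhs_ballP[d /= d0 dP].
(* The bump is 1 up to [r] and 0 from [2 * r] on; the gap between [2 * r] and [d] makes the
   extension by zero smooth. *)
pose r := d / 3; have r0 : 0 < r by rewrite divr_gt0.
have rd : d = 3 * r by rewrite /r; field.
pose W x := if `|x - a| < d then bump a r x *: V x else 0.
have sW x : smooth_at W x.
  have cn : continuous (fun x => `|x - a|).
    by move=> y; apply: (@continuous_norm_sub _ _ _ id); exact: cvg_id.
  have [xd|xd] := ltP `|x - a| d.
    apply: (@smooth_at_near_eq R _ _ (fun x => bump a r x *: V x)).
      have : \forall y \near x, `|y - a| < d.
        exact: (cn x [set z | z < d] (open_nbhs_nbhs (conj (@open_lt _ d) xd))).
      by apply: filterS => y yd; rewrite /W yd.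
    apply: smooth_at_scale_rV; first exact: smooth_bump.
    by apply: dP; rewrite -ball_normE /= distrC.
  apply: (@smooth_at_near_eq R _ 'rV[R]_m (fun=> 0)); last exact: smooth_at_cst.
  have x2 : 2 * r < `|x - a| by lra.
  have : \forall y \near x, 2 * r < `|y - a|.
    exact: (cn x [set z | 2 * r < z] (open_nbhs_nbhs (conj (@open_gt _ (2 * r)) x2))).
  apply: filterS => y yr; rewrite /W; case: ifP => // _.
  by rewrite bump0 ?scale0r // ltW.
have /choice[C CP] : forall j, exists C, 0 <= C /\ forall x, `|x| <= `|a| + d -> `|W x 0 j| <= C.
  move=> j; have [x|C C0 CP] := @bounded_ball_continuous R n (fun x => W x 0 j) (`|a| + d).
    by apply: smooth_at_continuous; apply: smooth_at_coord.
  by exists C.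
have C0 : 0 <= \sum_j C j by apply: sumr_ge0 => j _; have [] := CP j.
exists W, (\sum_j C j); split=> // [x|].
  have [xd|xd] := ltP `|x - a| d; last by rewrite /W ltNge xd /= normr0.
  apply: rV_norm_le => // j; apply: (@le_trans _ _ (C j)).
    have [_] := CP j; apply; rewrite -(subrK a x) addrC.
    by apply: le_trans (ler_normD _ _) _; rewrite lerD2l ltW.
  by rewrite (bigD1 j) //= lerDl sumr_ge0 // => i _; have [] := CP i.
apply/nbhs_ballP; exists r => //= x; rewrite -ball_normE /= distrC => xr.
have xd : `|x - a| < d by lra.
by rewrite /W xd bump1 ?scale1r // ltW.
Qed.

End cutoff.

Lemma smooth_on_at (R : realType) (V W : normedModType R) (U : set V) (f : V -> W) x :
  open U -> smooth_on U f -> U x -> smooth_at f x.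
Proof. by move=> oU /(smooth_onP _ oU); apply. Qed.

(** * Charts of a manifold *)

Section charts.
Context {R : realType} {n : nat}.

Section chart.
Context {M : topologicalType}.
Implicit Types (c : chart R n M) (p q : M).

Lemma chart_nbhs c p : cdom c p -> nbhs p (cdom c).
Proof. by move=> cp; apply: open_nbhs_nbhs; split=> //; exact: cdom_open. Qed.

Lemma cmapK_dom c p : cdom c p -> cinv c (cmap c p) = p.
Proof. by move=> cp; apply: cmapK; rewrite inE. Qed.

Lemma crng_cmap c p : cdom c p -> crng c (cmap c p).
Proof. by move=> cp; exists p. Qed.

Lemma cdom_cinv c u : crng c u -> cdom c (cinv c u).
Proof. by move=> [p cp <-]; rewrite cmapK_dom. Qed.

Lemma cinvK_rng c u : crng c u -> cmap c (cinv c u) = u.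
Proof. by move=> [p cp <-]; rewrite cmapK_dom. Qed.

Lemma crng_nbhs c p : cdom c p -> nbhs (cmap c p) (crng c).
Proof.
by move=> cp; apply: open_nbhs_nbhs; split; [exact: crng_open|exists p].
Qed.

Lemma cmap_near c p (Q : set 'rV[R]_n) : cdom c p ->
  (\forall u \near cmap c p, Q u) -> \forall q \near p, Q (cmap c q).
Proof. by move=> cp; apply: cmap_continuous; rewrite inE. Qed.

Lemma cinv_near c p (P : set M) : cdom c p ->
  (\forall q \near p, P q) -> \forall u \near cmap c p, P (cinv c u).
Proof.
move=> cp; have : {for cmap c p, continuous (cinv c)}.
  by apply: cinv_continuous; rewrite inE; exists p.
by rewrite /prop_for /continuous_at cmapK_dom //; apply.
Qed.

Lemma chart_overlap_open c1 c2 : open (cmap c1 @` (cdom c1 `&` cdom c2)).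
Proof.
rewrite openE => _ [q [c1q c2q] <-] /=.
apply: filterS2 (crng_nbhs c1q) (cinv_near c1q (chart_nbhs c2q)) => u c1u c2u.
exists (cinv c1 u); last exact: cinvK_rng.
by split=> //; exact: cdom_cinv.
Qed.

End chart.

Section manifold.
Context {M : smoothManifoldType R n}.
Implicit Types (c : chart R n M) (p q : M) (W : normedModType R).

Definition smoothM W (f : M -> W) p : Prop :=
  smooth_at (f \o cinv (chart_at p)) (cmap (chart_at p) p).

Definition ccoord c (i : 'I_n) : M -> R := fun x => cmap c x 0 i.

Lemma chart_at_maximal p : maximal_atlas (chart_at p).
Proof. by move=> q; exact: chart_at_compatible. Qed.

Lemma compatible_smooth c c' p : compatible c c' -> cdom c p -> cdom c' p ->
  smooth_at (cmap c' \o cinv c) (cmap c p) /\ smooth_at (cmap c \o cinv c') (cmap c' p).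
Proof.
move=> [s1 s2] cp c'p; split.
  have Ux : (cmap c @` (cdom c `&` cdom c')) (cmap c p) by exists p.
  exact: (smooth_on_at (@chart_overlap_open _ c c') s1 Ux).
rewrite setIC in s2.
have Ux : (cmap c' @` (cdom c' `&` cdom c)) (cmap c' p) by exists p.
exact: (smooth_on_at (@chart_overlap_open _ c' c) s2 Ux).
Qed.

Lemma maximal_atlas_smooth c :
  (forall q z, cdom c z -> cdom (chart_at q) z ->
    smooth_at (cmap (chart_at q) \o cinv c) (cmap c z) /\
    smooth_at (cmap c \o cinv (chart_at q)) (cmap (chart_at q) z)) ->
  @maximal_atlas R n M c.
Proof.
move=> h q; split; last rewrite setIC;
  (apply/smooth_onP; first exact: chart_overlap_open).
- by move=> _ [z [cz qz] <-]; have [] := h q z cz qz.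
- by move=> _ [z [qz cz] <-]; have [] := h q z cz qz.
Qed.

Lemma chart_transition c c' p : maximal_atlas c -> maximal_atlas c' ->
  cdom c p -> cdom c' p -> smooth_at (cmap c' \o cinv c) (cmap c p).
Proof.
move=> mc mc' cp c'p; have dp := mem_chart_at p.
have [s1 _] := compatible_smooth (mc p) cp dp.
have [_ s2] := compatible_smooth (mc' p) c'p dp.
have s3 : smooth_at ((cmap c' \o cinv (chart_at p)) \o (cmap (chart_at p) \o cinv c)) (cmap c p).
  by apply: smooth_at_comp => //=; rewrite cmapK_dom.
apply: smooth_at_near_eq s3.
apply: filterS (cinv_near cp (chart_nbhs dp)) => u /= du.
by rewrite (cmapK_dom du).
Qed.

Lemma smooth_chart_change (f : M -> R) c c' p : maximal_atlas c -> maximal_atlas c' ->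
  cdom c p -> cdom c' p -> smooth_at (f \o cinv c') (cmap c' p) ->
  smooth_at (f \o cinv c) (cmap c p).
Proof.
move=> mc mc' cp c'p sf.
have s3 : smooth_at ((f \o cinv c') \o (cmap c' \o cinv c)) (cmap c p).
  apply: smooth_at_compR; first exact: chart_transition.
  by rewrite /= cmapK_dom.
apply: smooth_at_near_eq s3.
apply: filterS (cinv_near cp (chart_nbhs c'p)) => u /= du.
by rewrite (cmapK_dom du).
Qed.

Lemma smoothMP (f : M -> R) c p : maximal_atlas c -> cdom c p ->
  smoothM f p <-> smooth_at (f \o cinv c) (cmap c p).
Proof.
by move=> mc cp; split; apply: smooth_chart_change => //;
  first [exact: chart_at_maximal|exact: mem_chart_at].
Qed.

Lemma smoothM_rV m (f : M -> 'rV[R]_m) p :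
  (forall j, smoothM (fun x => f x 0 j) p) -> smoothM f p.
Proof. by move=> h; apply: smooth_at_rV => j; apply: h. Qed.

Lemma smoothM_coord m (f : M -> 'rV[R]_m) p j :
  smoothM f p -> smoothM (fun x => f x 0 j) p.
Proof. exact: smooth_at_coord. Qed.

Lemma smoothM_near_eq W (f g : M -> W) p :
  (\forall q \near p, f q = g q) -> smoothM f p -> smoothM g p.
Proof.
move=> fg; apply: smooth_at_near_eq.
exact: (cinv_near (mem_chart_at p) fg).
Qed.

Lemma smoothM_nbhs (f : M -> R) p : smoothM f p -> \forall q \near p, smoothM f q.
Proof.
move=> sf; have dp := mem_chart_at p; have mp := chart_at_maximal p.
have := smooth_at_nbhs sf => /(cmap_near dp).
apply: filterS2 (chart_nbhs dp) => q dq sq.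
exact/(smoothMP f mp dq).
Qed.

Lemma smoothM_cmap c p : maximal_atlas c -> cdom c p -> smoothM (cmap c) p.
Proof.
move=> mc cp; apply: chart_transition => //; first exact: chart_at_maximal.
exact: mem_chart_at.
Qed.

Lemma smoothM_ccoord c i p : maximal_atlas c -> cdom c p -> smoothM (ccoord c i) p.
Proof. by move=> mc cp; apply: smoothM_coord; exact: smoothM_cmap. Qed.

Lemma smoothM_comp m (F : M -> 'rV[R]_m) (G : 'rV[R]_m -> R) p :
  smoothM F p -> smooth_at G (F p) -> smoothM (G \o F) p.
Proof.
move=> sF sG.
apply: (@smooth_at_compR _ _ _ (F \o cinv (chart_at p)) G) => //=.
by rewrite cmapK_dom //; exact: mem_chart_at.
Qed.

Lemma smoothM_continuous (f : M -> R) p : smoothM f p -> {for p, continuous f}.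
Proof.
move=> sf; have dp := mem_chart_at p; have := smooth_at_continuous sf.
rewrite /prop_for /continuous_at /= cmapK_dom // => h A /h.
move=> /(cmap_near dp); rewrite /= !nbhs_filterE; apply: filterS2 (chart_nbhs dp) => q dq /=.
by rewrite cmapK_dom.
Qed.

Lemma smooth_funP (f : M -> R) : smooth_fun f <-> forall p, smoothM f p.
Proof.
split=> [h p|h p].
  exact: (smooth_on_at (@crng_open _ _ _ _) (h p) (crng_cmap (mem_chart_at p))).
apply/smooth_onP => [|u [q dq <-]]; first exact: crng_open.
exact/(smoothMP f (chart_at_maximal p) dq).
Qed.

Lemma dfun_near_eq (f g : M -> R) p : (\forall q \near p, f q = g q) -> dfun f p = dfun g p.
Proof.
move=> fg; apply/colP => i; rewrite !mxE; apply: near_eq_derive.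
exact: (cinv_near (mem_chart_at p) fg).
Qed.

Lemma dfunE (f : M -> R) p (v : 'rV[R]_n) : smoothM f p ->
  (v *m dfun f p) 0 0 = 'D_v (f \o cinv (chart_at p)) (cmap (chart_at p) p).
Proof.
move=> /smooth_at_differentiable df; rewrite derive_rV // mxE.
by apply: eq_bigr => i _; rewrite mxE.
Qed.

Lemma dfun_cst (a : R) p : dfun (fun=> a : R) p = 0.
Proof. by apply/colP => i; rewrite !mxE; exact: derive_cst. Qed.

Lemma dfun_comp m (F : M -> 'rV[R]_m) (G : 'rV[R]_m -> R) p :
  smoothM F p -> smooth_at G (F p) ->
  dfun (G \o F) p = \sum_j 'D_(delta_mx 0 j) G (F p) *: dfun (fun x => F x 0 j) p.
Proof.
move=> sF sG; have dp := mem_chart_at p.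
have dF := smooth_at_differentiable sF.
have E : (F \o cinv (chart_at p)) (cmap (chart_at p) p) = F p by rewrite /= cmapK_dom.
have dG : differentiable G ((F \o cinv (chart_at p)) (cmap (chart_at p) p)).
  by rewrite E; exact: smooth_at_differentiable.
apply/colP => i; rewrite mxE summxE.
rewrite [LHS](derive_comp (delta_mx 0 i) dF dG) derive_rV // E.
apply: eq_bigr => j _; rewrite !mxE mulrC; congr (_ * _).
rewrite -[LHS]/(rV_coord j _) -(derive_lin_comp (L := rV_coord j)) //.
exact: rV_coord_continuous.
Qed.

(** Acting on rows from the right, it converts tangent vectors from the coordinates of [chart_at p]
    to those of [c]. *)
Definition jac c p : 'M[R]_n := \matrix_(i, j) dfun (ccoord c j) p i 0.

Lemma mulmx_jac c p v : maximal_atlas c -> cdom c p ->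
  v *m jac c p = 'D_v (cmap c \o cinv (chart_at p)) (cmap (chart_at p) p).
Proof.
move=> mc cp; apply/rowP => j.
have := smooth_at_differentiable (smoothM_cmap mc cp) => dc.
have -> : ('D_v (cmap c \o cinv (chart_at p)) (cmap (chart_at p) p)) 0 j =
    'D_v (ccoord c j \o cinv (chart_at p)) (cmap (chart_at p) p).
  rewrite -[LHS]/(rV_coord j _) -(derive_lin_comp (L := rV_coord j)) //.
  exact: rV_coord_continuous.
rewrite -dfunE; last exact: smoothM_ccoord.
by rewrite !mxE; apply: eq_bigr => i _; rewrite mxE.
Qed.

Lemma mulmx_jac_coord c p (v : 'rV[R]_n) i : (v *m jac c p) 0 i = (v *m dfun (ccoord c i) p) 0 0.
Proof. by rewrite !mxE; apply: eq_bigr => j _; rewrite mxE. Qed.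

Lemma jac_inverse c p v : maximal_atlas c -> cdom c p ->
  'D_(v *m jac c p) (cmap (chart_at p) \o cinv c) (cmap c p) = v.
Proof.
move=> mc cp; have dp := mem_chart_at p; have mp := chart_at_maximal p.
have s1 := chart_transition mp mc dp cp.
have s2 := chart_transition mc mp cp dp.
rewrite mulmx_jac //.
have E : (cmap c \o cinv (chart_at p)) (cmap (chart_at p) p) = cmap c p.
  by rewrite /= cmapK_dom.
have d2 : differentiable (cmap (chart_at p) \o cinv c) ((cmap c \o cinv (chart_at p)) (cmap (chart_at p) p)).
  by rewrite E; exact: smooth_at_differentiable.
rewrite -[in LHS]E -(derive_comp v (smooth_at_differentiable s1) d2).
rewrite (@near_eq_derive _ _ _ _ id); first exact: derive_id.
apply: filterS2 (crng_nbhs dp) (cinv_near dp (chart_nbhs cp)) => u du cu /=.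
by rewrite (cmapK_dom cu) cinvK_rng.
Qed.

Lemma jac_unit c p : maximal_atlas c -> cdom c p -> jac c p \in unitmx.
Proof.
move=> mc cp; rewrite -row_free_unit -kermx_eq0; apply/rowV0P => v /sub_kermxP h.
by rewrite -(jac_inverse v mc cp) h derive0.
Qed.

(* Restricting the range to a ball makes it convex. *)
Lemma new_chart c p (N : set M) (H : 'rV[R]_n -> 'rV[R]_n) :
  maximal_atlas c -> cdom c p -> nbhs p N -> smooth_at H (cmap c p) ->
  (forall v, 'd H (cmap c p) v = 0 -> v = 0) ->
  exists c' (e : R), [/\ maximal_atlas c', cdom c' p,
    cdom c' `<=` cdom c `&` N, {in cdom c', cmap c' =1 H \o cmap c} &
    0 < e /\ crng c' = ball (cmap c' p) e].
Proof.
move=> mc cp pN sH inj.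
have N' : nbhs (cmap c p) (fun u => crng c u /\ N (cinv c u)).
  by apply: filterS2 (crng_nbhs cp) (cinv_near cp pN).
have [U [g [[oU Up UN] [oHU gK sHU sg dinj]]]] := inverse_function sH inj N'.
have : nbhs (H (cmap c p)) (H @` U) by apply: open_nbhs_nbhs; split=> //; exists (cmap c p).
move=> /nbhs_ballP[e /= e0 eU].
pose D := [set q | cdom c q /\ U (cmap c q) /\ ball (H (cmap c p)) e (H (cmap c q))].
have oD : open D.
  rewrite openE => q [cq [Uq bq]] /=.
  have h1 : \forall u \near cmap c q, U u by apply: open_nbhs_nbhs.
  have h2 : \forall u \near cmap c q, ball (H (cmap c p)) e (H u).
    have : {for cmap c q, continuous H} by apply: smooth_at_continuous; exact: sHU.
    by apply; apply: open_nbhs_nbhs; split=> //; exact: ball_open.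
  apply: filterS3 (chart_nbhs cq) (cmap_near cq h1) (cmap_near cq h2).
  by move=> z z1 z2 z3; split.
have gK' u : U u -> g (H u) = u by move=> Uu; apply: gK; rewrite inE.
have rng : (H \o cmap c) @` D = ball (H (cmap c p)) e.
  apply/seteqP; split=> [_ [q [cq [Uq bq]] <-]//|w bw].
  have [u Uu Hu] := eU w bw; have [ru _] := UN u Uu.
  exists (cinv c u) => /=; last by rewrite cinvK_rng.
  by split; [exact: cdom_cinv|rewrite cinvK_rng // Hu].
have orng : open ((H \o cmap c) @` D) by rewrite rng; exact: ball_open.
have DK : {in D, cancel (H \o cmap c) (cinv c \o g)}.
  by move=> q; rewrite inE => -[cq [Uq _]] /=; rewrite gK' // cmapK_dom.
have Dc : {in D, continuous (H \o cmap c)}.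
  move=> q; rewrite inE => -[cq [Uq _]].
  apply: continuous_comp; first by apply: cmap_continuous; rewrite inE.
  by apply: smooth_at_continuous; exact: sHU.
have Dinv : {in (H \o cmap c) @` D, continuous (cinv c \o g)}.
  move=> w; rewrite inE => -[q [cq [Uq _]] <-].
  have sgq : smooth_at g (H (cmap c q)) by apply: sg; exists (cmap c q).
  apply: continuous_comp; first exact: smooth_at_continuous.
  by rewrite /= gK' //; apply: cinv_continuous; rewrite inE; exists q.
pose c' := Chart oD orng DK Dc Dinv.
exists c', e; split=> //.
- apply: maximal_atlas_smooth => q z [cz [Uz bz]] qz; split.
    have sgz : smooth_at g (H (cmap c z)) by apply: sg; exists (cmap c z).
    apply: (@smooth_at_comp _ _ _ _ g (cmap (chart_at q) \o cinv c)) => //.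
    rewrite /= gK' //; apply: chart_transition => //; exact: chart_at_maximal.
  apply: (@smooth_at_comp _ _ _ _ (cmap c \o cinv (chart_at q)) H).
    by apply: chart_transition => //; exact: chart_at_maximal.
  by rewrite /= cmapK_dom //; exact: sHU.
- by split=> //; split=> //; exact: ballxx.
- by move=> q [cq [Uq bq]]; split=> //; have [_] := UN _ Uq; rewrite cmapK_dom.
Qed.

(** In one direction the vanishing coordinates are differentiated along the curve; in the other, a
    straight line of the chart is the curve. *)
Lemma tangent_slice c p (S : set M) k v : maximal_atlas c -> cdom c p -> S p ->
  (forall q, cdom c q -> (S q <-> forall i : 'I_n, (k <= i)%N -> cmap c q 0 i = 0)) ->
  tangent_space S p v <-> forall i : 'I_n, (k <= i)%N -> (v *m dfun (ccoord c i) p) 0 0 = 0.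
Proof.
move=> mc cp Sp SP; have dp := mem_chart_at p; have mp := chart_at_maximal p.
set cc := chart_at p in dp mp *.
split=> [[e [gam [e0 g0 gS sg dg]]] i ki|hv].
  have sg0 : smooth_at (cmap cc \o gam) 0.
    exact: (smooth_on_at (ball_open _ _) sg (ballxx _ e0)).
  have gcts : {for 0, continuous gam}.
    have h := smooth_at_continuous sg0.
    rewrite /prop_for /continuous_at => A.
    rewrite g0 => pA.
    have := cinv_near dp pA; rewrite -/cc -g0 => /h /=.
    have : \forall t \near (0 : R), ball (0 : R) e t by exact: nbhsx_ballx.
    by apply: filterS2 => t te /=; rewrite cmapK_dom //; have [] := gS t te.
  have s1 : smooth_at (ccoord c i \o cinv cc) ((cmap cc \o gam) 0).
    by rewrite /= g0; exact: smoothM_ccoord.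
  have d1 := smooth_at_differentiable s1.
  have := derive_comp (1 : R) (smooth_at_differentiable sg0) d1.
  rewrite dg /= g0 -dfunE; last exact: smoothM_ccoord.
  move=> <-; rewrite (@near_eq_derive _ _ _ _ (fun=> 0)); first exact: derive_cst.
  have h1 : \forall t \near (0 : R), ball (0 : R) e t by exact: nbhsx_ballx.
  have h2 : \forall t \near (0 : R), cdom c (gam t).
    by apply: gcts; rewrite g0; exact: chart_nbhs.
  apply: filterS2 h1 h2 => t te ct /=; have [St dt] := gS t te.
  by rewrite (cmapK_dom dt); apply: (SP _ ct).1.
pose w := v *m jac c p.
have w0 (i : 'I_n) : (k <= i)%N -> w 0 i = 0 by move=> /hv; rewrite /w mulmx_jac_coord.
pose gam t := cinv c (cmap c p + t *: w).
have sline t : smooth_at (fun t : R => cmap c p + t *: w) t.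
  apply: smooth_atD; first exact: smooth_at_cst.
  by apply: smooth_at_scalel; exact: smooth_at_id.
have l0 : cmap c p + (0 : R) *: w = cmap c p by rewrite scale0r addr0.
have : \forall t \near (0 : R), crng c (cmap c p + t *: w) /\ cdom cc (gam t).
  have ct := smooth_at_continuous (sline 0).
  have h1 : \forall t \near (0 : R), crng c (cmap c p + t *: w).
    by apply: ct; rewrite l0; exact: crng_nbhs.
  have h2 : \forall t \near (0 : R), cdom cc (gam t).
    apply: (ct (fun u => cdom cc (cinv c u))); rewrite l0.
    exact: (cinv_near cp (chart_nbhs dp)).
  by apply: filterS2 h1 h2.
move=> /nbhs_ballP[e /= e0 eP].
have sgt t : ball (0 : R) e t -> smooth_at (cmap cc \o gam) t.
  move=> te; have [rt ct] := eP t te.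
  apply: (@smooth_at_comp _ _ _ _ (fun t : R => cmap c p + t *: w) (cmap cc \o cinv c)) => //.
  rewrite -[X in smooth_at _ X](cinvK_rng rt); apply: chart_transition => //.
  exact: cdom_cinv.
exists e, gam; split=> //.
- by rewrite /gam l0 cmapK_dom.
- move=> t te; have [rt ct] := eP t te; split=> //.
  apply/SP; first exact: cdom_cinv.
  move=> i ki; rewrite /gam cinvK_rng // mxE [X in _ + X]mxE w0 // mulr0 addr0.
  exact: (SP p cp).1.
- by apply/smooth_onP => [|t te]; [exact: ball_open|exact: sgt].
have d2 : differentiable (cmap cc \o cinv c) (cmap c p).
  by apply: smooth_at_differentiable; exact: chart_transition.
have dl := smooth_at_differentiable (sline 0).
have dl0 : 'D_1 (fun t : R => cmap c p + t *: w) 0 = w.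
  have h := @derive_along R _ _ (@idfun 'rV[R]_n) (cmap c p) w 0.
  have /h[_ e1] : differentiable (@idfun 'rV[R]_n) (cmap c p + (0 : R) *: w).
    exact/smooth_at_differentiable/smooth_at_id.
  exact: (etrans e1 (derive_id _ _)).
rewrite -(jac_inverse v mc cp) -/w -/cc.
rewrite -[X in 'D_X _ _ = _]/(1 : R).
have := @derive_comp _ _ _ _ (fun t : R => cmap c p + t *: w) (cmap cc \o cinv c) 0 1 dl.
by rewrite /= l0 dl0 => ->.
Qed.

End manifold.
End charts.

(** To each set of a countable base that lies in some [U x] one such [x] is attached, at the index
    given by the numbering [f]; [x0] fills the remaining indices. *)
Lemma lindelof (T : topologicalType) (X : set T) (x0 : T) (U : T -> set T) :
  @second_countable T -> X x0 -> (forall x, X x -> nbhs x (U x)) ->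
  exists s : nat -> T, (forall i, X (s i)) /\ forall x, X x -> exists i, U (s i) x.
Proof.
move=> [B /countable_injP[f fI] [_ Bb]] Xx0 XU.
pose good k x := X x /\ exists b, [/\ B b, f b = k & b `<=` U x].
exists (fun k => if pselect (exists x, good k x) is left h then projT1 (cid h) else x0).
split=> [k|x Xx].
  by case: pselect => // h; case: (cid h) => /= x [].
have [b [Bx bx] bU] := Bb x (U x) (XU x Xx).
exists (f b); case: pselect => [h|[]]; last by exists x; split=> //; exists b.
case: (cid h) => /= x' [Xx' [b' [Bb' fb b'U]]].
by apply: b'U; rewrite (fI _ _ _ _ fb) ?inE.
Qed.

(** * Gluing germs along a subset *)

Section global.
Context {R : realType} {n : nat} {M : smoothManifoldType R n}.
Implicit Types (c : chart R n M) (p q : M).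

Lemma smoothM_cst (W : normedModType R) (a : W) p : smoothM (fun _ : M => a) p.
Proof. exact: smooth_at_cst. Qed.

(** The support lies in the image of a compact set, which is closed because [M] is Hausdorff; hence
    extension by zero is smooth. The closed [K] is part of the conclusion so that products with
    functions defined on [N] only can be extended too. *)
Lemma bumpM p (N : set M) : nbhs p N -> exists b : M -> R,
  [/\ forall q, smoothM b q, forall q, 0 <= b q <= 1, \forall q \near p, b q = 1 &
   exists K, [/\ closed K, K `<=` N & forall q, ~ K q -> b q = 0]].
Proof.
move=> pN; set c := chart_at p; have cp : cdom c p := mem_chart_at p.
have mc : maximal_atlas c := chart_at_maximal p.
have : \forall u \near cmap c p, crng c u /\ N (cinv c u).
  by apply: filterS2 (crng_nbhs cp) (cinv_near cp pN).
move=> /nbhs_ballP[d /= d0 dP].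
pose r := d / 3; have r0 : 0 < r by rewrite divr_gt0.
have rd : d = 3 * r by rewrite /r; field.
pose a := cmap c p.
pose A := [set u : 'rV[R]_n | `|u - a| <= 2 * r].
have AP u : A u -> crng c u /\ N (cinv c u).
  by move=> Au; apply: dP; rewrite -ball_normE /= distrC; apply: le_lt_trans Au _; lra.
have cA : compact A.
  apply: bounded_closed_compact.
    exists (2 * r + `|a|); split; first exact: num_real.
    move=> K rK u /= Au; apply: le_trans (ltW rK).
    by rewrite -(subrK a u); apply: le_trans (ler_normD _ _) _; rewrite lerD2r.
  have -> : A = (fun u : 'rV[R]_n => `|u - a|) @^-1` [set y | y <= 2 * r] by [].
  apply: closed_comp; last exact: closed_le.
  by move=> u _; apply: (@continuous_norm_sub _ _ _ id); exact: cvg_id.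
pose K := cinv c @` A.
have clK : closed K.
  apply: compact_closed; first exact: manifold_hausdorff.
  apply: continuous_compact => //; apply: continuous_in_subspaceT => u; rewrite inE => /AP[ru _].
  by apply: cinv_continuous; rewrite inE.
pose b q := if pselect (cdom c q) then bump a r (cmap c q) else 0.
have bK q : ~ K q -> b q = 0.
  move=> nK; rewrite /b; case: pselect => //= cq; apply: bump0 => //.
  rewrite leNgt; apply/negP => lt; apply: nK; exists (cmap c q); last exact: cmapK_dom.
  exact: ltW.
have bE q : cdom c q -> b q = bump a r (cmap c q) by rewrite /b; case: pselect.
exists b; split.
- move=> q; have [cq|ncq] := pselect (cdom c q).
    apply: (@smoothM_near_eq _ _ _ R (bump a r \o cmap c)).
      by apply: filterS (chart_nbhs cq) => z /bE ->.
    by apply: smoothM_comp; [exact: smoothM_cmap|exact: smooth_bump].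
  apply: (@smoothM_near_eq _ _ _ R (fun=> 0)); last exact: smoothM_cst.
  have : \forall z \near q, ~ K z.
    apply: open_nbhs_nbhs; split; first exact: closed_openC.
    by move=> [u /AP[ru _] uq]; apply: ncq; rewrite -uq; exact: cdom_cinv.
  by apply: filterS => z /bK.
- by move=> q; rewrite /b; case: pselect => //= _; rewrite ?bump_ge0 ?bump_le1 ?lexx ?ler01.
- have h : \forall u \near cmap c p, bump a r u = 1.
    apply/nbhs_ballP; exists r => //= u; rewrite -ball_normE /= distrC => ur.
    by apply: bump1 => //; exact: ltW.
  by apply: filterS2 (chart_nbhs cp) (cmap_near cp h) => q /bE ->.
- by exists K; split=> // _ [u /AP[_ Nu] <-].
Qed.

(** Chart coordinates are local, while [pi_jacobi] and [embedding_family] deal with functions smooth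
    on all of [M]. *)
Lemma smoothM_extend (f : M -> R) p : smoothM f p ->
  exists g, (forall q, smoothM g q) /\ \forall q \near p, g q = f q.
Proof.
move=> sf; have [b [sb _ b1 [K [clK KN bK]]]] := bumpM (smoothM_nbhs sf).
exists (fun q => b q * f q); split=> [q|]; last first.
  by apply: filterS b1 => q ->; rewrite mul1r.
have [Kq|nKq] := pselect (K q); first by apply: smooth_atM; [exact: sb|exact: KN].
apply: (@smoothM_near_eq _ _ _ R (fun=> 0)); last exact: smoothM_cst.
have : \forall z \near q, ~ K z by apply: open_nbhs_nbhs; split=> //; exact: closed_openC.
by apply: filterS => z /bK ->; rewrite mul0r.
Qed.

Lemma bump_cover (X : set M) (x0 : M) (N : M -> set M) : X x0 ->
  (forall x, X x -> nbhs x (N x)) -> exists (s : nat -> M) (b : nat -> M -> R),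
  [/\ forall i, X (s i), forall i q, smoothM (b i) q, forall i q, 0 <= b i q <= 1,
      forall i q, b i q != 0 -> N (s i) q &
      forall x, X x -> exists i, \forall q \near x, b i q = 1].
Proof.
move=> Xx0 XN.
have /choice[b bP] : forall x, exists b : M -> R, X x -> [/\ forall q, smoothM b q,
   forall q, 0 <= b q <= 1, \forall q \near x, b q = 1 & forall q, b q != 0 -> N x q].
  move=> x; have [Xx|nX] := pselect (X x); last by exists (fun=> 0).
  have [b [sb b01 b1 [K [_ KN bK]]]] := bumpM (XN x Xx).
  exists b => _; split=> // q bq; apply: KN; apply: contrapT => /bK h.
  by rewrite h eqxx in bq.
have [s [sX sc]] := @lindelof M X x0 (fun x => [set y | \forall q \near y, b x q = 1])
  (@manifold_second_countable R n M) Xx0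
  (fun x Xx => near_join (let: And4 _ _ h _ := bP x Xx in h)).
exists s, (fun i => b (s i)); split=> [//|i|i|i|x /sc[i h]]; last by exists i.
- by have [] := bP _ (sX i).
- by have [] := bP _ (sX i).
- by have [] := bP _ (sX i).
Qed.

(* The bump functions [b i] select at each point a finite set of active indices;
   the pieces agree near a point when all its active germs do. *)
Lemma glue_germs (X : set M) (S N : M -> set M) :
  (forall x, X x -> nbhs x (N x)) ->
  (forall x x1, X x -> X x1 -> N x x1 -> \forall y \near x1, S x y <-> S x1 y) ->
  exists T O : set M, [/\ open O, X `<=` O, T `<=` O &
    forall y, O y -> exists x, [/\ X x, N x y & \forall z \near y, T z <-> S x z]].
Proof.
move=> XN co.
have [[x0 Xx0]|X0] := pselect (exists x, X x); last first.
  exists set0, set0; split=> //; first exact: open0.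
  by move=> x Xx; apply: X0; exists x.
have [s [b [sX sb b01 bN b1]]] := bump_cover Xx0 XN.
pose E (i : nat) (y : M) := \forall q \near y, b i q = 1.
have nE i y : E i y -> \forall z \near y, E i z by exact: near_near.
(* Inactivity is an open condition: [b i] is continuous and each [E j] is open. Near a point where
   [E j] holds, only the finitely many indices up to [j] can be active. *)
pose act i y := 2^-1 <= b i y /\ forall j, (j < i)%N -> ~ E j y.
have actN i y : act i y -> N (s i) y.
  move=> [h _]; apply: bN; rewrite gt_eqF //; apply: lt_le_trans h.
  by rewrite invr_gt0.
have nact i y : ~ act i y -> \forall z \near y, ~ act i z.
  move=> /not_andP[/negP|].
    rewrite -ltNge => lt.
    have : \forall z \near y, b i z < 2^-1.
      have h : nbhs (b i y) [set z | z < 2^-1].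
        by apply: open_nbhs_nbhs; split=> //; exact: open_lt.
      exact: (smoothM_continuous (sb i y) h).
    by apply: filterS => z lz [/le_lt_trans/(_ lz)]; rewrite ltxx.
  move=> /existsNP[j /not_implyP[ji /contrapT/nE]].
  by apply: filterS => z Ez [_ /(_ j ji)].
have exact_ y : (exists j, E j y) -> exists i, act i y.
  move=> [j Ej]; have ex : exists j, `[< E j y >] by exists j; apply/asboolP.
  have [i /asboolP Ei min] := ex_minnP ex.
  exists i; split=> [|l li /asboolP El].
    by have -> := nbhs_singleton Ei; rewrite invf_le1 // ler1n.
  by have := min l El; rewrite leqNgt li.
pose W := [set y | (exists j, E j y) /\ forall i i', act i y -> act i' y ->
   \forall z \near y, S (s i) z <-> S (s i') z].
(* No index becomes active near [y], and the finitely many pairs of active pieces that agree near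
   [y] agree near each nearby point. This gives both the openness of [W] and the local description
   of the glued set. *)
have key y : W y -> \forall z \near y, [/\ exists j, E j z, forall i, act i z -> act i y &
    forall i i', act i y -> act i' y -> [/\ S (s i) z <-> S (s i') z &
       \forall w \near z, S (s i) w <-> S (s i') w]].
  move=> [[j Ej] Wy].
  have actj i z : E j z -> act i z -> (i <= j)%N.
    by move=> Ejz [_ h]; rewrite leqNgt; apply/negP => /h.
  have h1 : \forall z \near y, forall i : 'I_j.+1, ~ act i y -> ~ act i z.
    apply: near_forall => i; have [a|na] := pselect (act i y); first exact: nbhsW.
    by apply: filterS (nact i y na) => z.
  have h2 : \forall z \near y, forall ii : 'I_j.+1 * 'I_j.+1, act ii.1 y -> act ii.2 y ->
      [/\ S (s ii.1) z <-> S (s ii.2) z & \forall w \near z, S (s ii.1) w <-> S (s ii.2) w].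
    apply: near_forall => -[i i'] /=.
    have [a|na] := pselect (act i y); last exact: nbhsW.
    have [a'|na'] := pselect (act i' y); last exact: nbhsW.
    by apply: filterS2 (Wy i i' a a') (near_near (Wy i i' a a')) => z.
  apply: filterS3 h1 h2 (nE j y Ej) => z h1 h2 Ejz; split; first by exists j.
    move=> i az; have ij : (i < j.+1)%N := actj i z Ejz az.
    by apply: contrapT => /(h1 (Ordinal ij)); apply.
  move=> i i' a a'.
  have ij : (i < j.+1)%N := actj i y (nbhs_singleton (nE j y Ej)) a.
  have ij' : (i' < j.+1)%N := actj i' y (nbhs_singleton (nE j y Ej)) a'.
  exact: (h2 (Ordinal ij, Ordinal ij')).
have keyW y : W y -> \forall z \near y, W z.
  move=> /key; apply: filterS => z [Ez az Sz]; split=> // i i' /az a /az a'.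
  by have [] := Sz i i' a a'.
exists [set z | W z /\ exists i, act i z /\ S (s i) z], W; split.
- by rewrite openE => y /keyW.
- move=> x Xx; split; first by have [j Ej] := b1 x Xx; exists j.
  move=> i i' /actN Nx /actN N'x.
  have := co _ _ (sX i) Xx Nx; have := co _ _ (sX i') Xx N'x.
  by apply: filterS2 => z h1 h2; rewrite h1 h2.
- by move=> z [].
move=> y Wy; have [i ai] := exact_ y Wy.1.
exists (s i); split; [exact: sX|exact: actN|].
apply: filterS2 (key y Wy) (keyW y Wy) => z [Ez az Sz] Wz; split.
  by move=> [_ [i' [a' Si']]]; have [h _] := Sz i i' ai (az _ a'); apply/h.
move=> Si; split=> //; have [i' a'] := exact_ z Ez.
by exists i'; split=> //; have [h _] := Sz i i' ai (az _ a'); apply/h.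
Qed.

End global.

(** * Straightening Hamiltonian vector fields *)

Section flow_box.
Context {R : realType} {n : nat}.
Variables (V : 'rV[R]_n -> 'rV[R]_n) (K : R) (k : 'I_n).
Hypothesis sV : forall x, smooth_at V x.
Hypothesis VK : forall x, `|V x| <= K.

Let e : 'rV[R]_n := delta_mx 0 k.

Definition flow_box (u : 'rV[R]_n) := flow V (u 0 k) (u - u 0 k *: e).

Lemma smooth_flow_box u : smooth_at flow_box u.
Proof.
pose j (u : 'rV[R]_n) : 'rV[R]_(1 + n) := row_mx (const_mx (u 0 k)) (u - u 0 k *: e).
have sid (w : 'rV[R]_n) : smooth_at (fun w : 'rV[R]_n => w 0 k) w.
  by apply: smooth_at_coord; exact: smooth_at_id.
have sj : smooth_at j u.
  apply: smooth_at_row_mx.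
    by apply: smooth_at_rV => i; apply: smooth_at_near_eq (sid u); apply: nbhsW => w; rewrite mxE.
  by apply: smooth_atB; [exact: smooth_at_id|exact: smooth_at_scalel].
have E : flow_box = (fun u : 'rV[R]_(1 + n) => flow V (lsubmx u 0 0) (rsubmx u)) \o j.
  by apply/funext => w; rewrite /comp /j row_mxKl row_mxKr mxE.
by rewrite E; apply: smooth_at_comp => //; exact: (smooth_flow sV VK).
Qed.

Lemma flow_box_id (u : 'rV[R]_n) : u 0 k = 0 -> flow_box u = u.
Proof. by move=> uk; rewrite /flow_box uk scale0r subr0 (flow0 sV VK). Qed.

Lemma derive_flow_box u : 'D_e flow_box u = V (flow_box u).
Proof.
pose z := u - u 0 k *: e.
have D := derive_flow sV VK z (u 0 k).
have ek : e 0 k = 1 by rewrite mxE !eqxx.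
have E : (fun h : R => h^-1 *: ((flow_box \o shift u) (h *: e) - flow_box u)) =
    (fun h : R => h^-1 *: (((fun s => flow V s z) \o shift (u 0 k)) (h *: (1 : R)) - flow V (u 0 k) z)).
  apply/funext => h; rewrite /= /flow_box -/z.
  have -> : (h *: e + u) 0 k = h + u 0 k by rewrite mxE [X in X + _]mxE ek mulr1.
  have -> : h *: e + u - (h + u 0 k) *: e = z.
    by rewrite scalerDl opprD addrACA subrr add0r.
  by rewrite [h *: (1 : R)]mulr1.
by rewrite /derive E; exact: D.
Qed.

Lemma derive_flow_box_tangent (u v : 'rV[R]_n) : u 0 k = 0 -> v 0 k = 0 -> 'D_v flow_box u = v.
Proof.
move=> uk vk; rewrite -[RHS](@derive_id _ _ u v).
have E : (fun h : R => h^-1 *: ((flow_box \o shift u) (h *: v) - flow_box u)) =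
    (fun h : R => h^-1 *: ((id \o shift u) (h *: v) - u)).
  apply/funext => h; rewrite /= !flow_box_id //.
  by rewrite mxE [X in X + _]mxE uk vk mulr0 addr0.
by rewrite /derive E.
Qed.

(** On the hyperplane the differential fixes tangent vectors and sends [e] to [V u], which is
    transverse to the hyperplane. *)
Lemma flow_box_inj (u v : 'rV[R]_n) : u 0 k = 0 -> V u 0 k != 0 -> 'd flow_box u v = 0 -> v = 0.
Proof.
move=> uk Vk.
have df := smooth_at_differentiable (smooth_flow_box u).
have ek : e 0 k = 1 by rewrite mxE !eqxx.
pose w := v - v 0 k *: e.
have wk : w 0 k = 0 by rewrite mxE [X in _ + X]mxE [X in - X]mxE ek mulr1 subrr.
have vE : v = w + v 0 k *: e by rewrite /w subrK.
have De := derive_flow_box u; have Dw := derive_flow_box_tangent uk wk.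
rewrite deriveE // in De; rewrite deriveE // in Dw.
rewrite {1}vE linearD linearZ /= De Dw flow_box_id // => h.
have : (w + v 0 k *: V u) 0 k = 0 by rewrite h mxE.
rewrite mxE wk add0r mxE => /eqP; rewrite mulf_eq0 (negbTE Vk) orbF => /eqP v0.
by move: h; rewrite v0 scale0r addr0 vE v0 scale0r addr0.
Qed.

End flow_box.

(** * Calculus of the Poisson bracket and Hamiltonian flow boxes *)

Section bracket.
Context {R : realType} {n : nat} {M : smoothManifoldType R n} (pi : poisson_structure M).
Implicit Types (c d : chart R n M) (p q : M) (f g h : M -> R).

Notation brk := (bracket (pi_mx pi)).

Lemma bracket_antisym f g p : brk f g p = - brk g f p.
Proof.
have E : (dfun g p)^T *m pi_mx pi p *m dfun f p = - ((dfun f p)^T *m pi_mx pi p *m dfun g p)^T.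
  by rewrite !trmx_mul trmxK pi_antisym mulNmx mulmxN opprK mulmxA.
by rewrite /bracket /bivector E !mxE opprK.
Qed.

Lemma bracket_near_eqr f g h p : (\forall q \near p, g q = h q) -> brk f g p = brk f h p.
Proof. by move=> gh; rewrite /bracket (dfun_near_eq gh). Qed.

Lemma bracket_near_eq f f' g g' p : (\forall q \near p, f q = f' q) ->
  (\forall q \near p, g q = g' q) -> brk f g p = brk f' g' p.
Proof. by move=> ff gg; rewrite /bracket (dfun_near_eq ff) (dfun_near_eq gg). Qed.

Lemma bracket_cst f (a : R) p : brk f (fun=> a) p = 0.
Proof. by rewrite /bracket dfun_cst /bivector mulmx0 mxE. Qed.

Lemma bracket_comp m f (F : M -> 'rV[R]_m) (G : 'rV[R]_m -> R) p :
  smoothM F p -> smooth_at G (F p) ->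
  brk f (G \o F) p = \sum_j 'D_(delta_mx 0 j) G (F p) * brk f (fun x => F x 0 j) p.
Proof.
move=> sF sG; rewrite /bracket dfun_comp // /bivector mulmx_sumr summxE.
by apply: eq_bigr => j _; rewrite -scalemxAr mxE.
Qed.

Lemma bracket_chart f g c p : maximal_atlas c -> cdom c p -> smoothM g p ->
  brk f g p = \sum_j 'D_(delta_mx 0 j) (g \o cinv c) (cmap c p) * brk f (ccoord c j) p.
Proof.
move=> mc cp sg; rewrite (@bracket_near_eqr f g ((g \o cinv c) \o cmap c)).
  by apply: bracket_comp; [exact: smoothM_cmap|exact/smoothMP].
by apply: filterS (chart_nbhs cp) => q cq /=; rewrite cmapK_dom.
Qed.

Lemma smoothM_derive_chart g c p v : maximal_atlas c -> cdom c p -> smoothM g p ->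
  smoothM ('D_v (g \o cinv c) \o cmap c) p.
Proof.
move=> mc cp sg; apply: smoothM_comp; first exact: smoothM_cmap.
by apply: smooth_at_derive; exact/smoothMP.
Qed.

Lemma smoothM_bracket f g p : smoothM f p -> smoothM g p -> smoothM (brk f g) p.
Proof.
move=> sf sg; have cp := mem_chart_at p; have mc := chart_at_maximal p.
set c := chart_at p in cp mc.
apply: (@smoothM_near_eq _ _ _ R (fun q =>
   \sum_j ('D_(delta_mx 0 j) (g \o cinv c) \o cmap c) q *
     - (\sum_i ('D_(delta_mx 0 i) (f \o cinv c) \o cmap c) q * brk (ccoord c j) (ccoord c i) q))).
  apply: filterS3 (chart_nbhs cp) (smoothM_nbhs sf) (smoothM_nbhs sg) => q cq sfq sgq.
  rewrite (@bracket_chart f g c) //; apply: eq_bigr => j _; congr (_ * _).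
  by rewrite bracket_antisym (@bracket_chart (ccoord c j) f c).
apply: smooth_at_sum => j _; apply: smooth_atM; first exact: smoothM_derive_chart.
apply: smooth_atN; apply: smooth_at_sum => i _; apply: smooth_atM; first exact: smoothM_derive_chart.
exact: (smooth_on_at (@crng_open _ _ _ _) (pi_smooth pi p j i) (crng_cmap cp)).
Qed.

Lemma bracket_jacobi f g h p : smoothM f p -> smoothM g p -> smoothM h p ->
  brk f (brk g h) p + brk g (brk h f) p + brk h (brk f g) p = 0.
Proof.
move=> /smoothM_extend[f' [sf ff]] /smoothM_extend[g' [sg gg]] /smoothM_extend[h' [sh hh]].
have E a b a' b' : (\forall q \near p, a' q = a q) -> (\forall q \near p, b' q = b q) ->
    \forall q \near p, brk a' b' q = brk a b q.
  move=> /near_near aa /near_near bb; apply: filterS2 aa bb => q; exact: bracket_near_eq.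
have := pi_jacobi pi ((smooth_funP f').2 sf) ((smooth_funP g').2 sg) ((smooth_funP h').2 sh) p.
rewrite (bracket_near_eq ff (E _ _ _ _ gg hh)) (bracket_near_eq gg (E _ _ _ _ hh ff)).
by rewrite (bracket_near_eq hh (E _ _ _ _ ff gg)).
Qed.

(** The brackets of [f] with the coordinates are the components of its Hamiltonian field, and the
    new chart is the inverse of the flow box. The two charts agree on the hyperplane of the k-th
    coordinate, so that a slice inside it remains a slice. *)
Lemma straighten c p k f (N : set M) : maximal_atlas c -> cdom c p -> nbhs p N ->
  smoothM f p -> cmap c p 0 k = 0 -> brk f (ccoord c k) p != 0 ->
  exists c' (e : R), [/\ maximal_atlas c', cdom c' p, cdom c' `<=` cdom c `&` N &
    0 < e /\ crng c' = ball (cmap c' p) e] /\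
    [/\ forall q, cdom c' q -> cmap c q 0 k = 0 \/ cmap c' q 0 k = 0 -> cmap c' q = cmap c q,
        forall q, cdom c' q -> smoothM f q &
        forall q j, cdom c' q -> brk f (ccoord c' j) q = (j == k)%:R].
Proof.
move=> mc cp pN sf ck bk.
pose V0 u := \row_j brk f (ccoord c j) (cinv c u).
set a := cmap c p in ck.
have sV0 : smooth_at V0 a.
  apply: smooth_at_row => j.
  apply: ((smoothMP (brk f (ccoord c j)) mc cp).1); apply: smoothM_bracket => //.
  exact: smoothM_ccoord.
have [V [K [sV VK VV0]]] := cutoff sV0.
have Va : V a = V0 a := nbhs_singleton VV0.
have Vk : V a 0 k != 0 by rewrite Va mxE /a cmapK_dom.
pose T := flow_box V k.
have sT u : smooth_at T u := smooth_flow_box k sV VK u.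
have Ta : T a = a := flow_box_id sV VK ck.
have Tinj v : 'd T a v = 0 -> v = 0 := flow_box_inj sV VK ck Vk.
have [U [g [[oU Ua _] [oTU gK _ sg dinj]]]] :=
  inverse_function (sT a) Tinj (filterT : nbhs a setT).
have gT u : U u -> g (T u) = u by move=> Uu; apply: gK; rewrite inE.
have TUa : (T @` U) a by exists a.
have sga : smooth_at g a by apply: sg.
have gTnear u : U u -> \forall w \near u, g (T w) = w.
  move=> Uu; have : \forall w \near u, U w by exact: open_nbhs_nbhs.
  by apply: filterS => w; exact: gT.
have gainj v : 'd g a v = 0 -> v = 0.
  move=> gv.
  have ga : g a = a by rewrite -{1}Ta gT.
  have TgE : \forall w \near a, T (g w) = w.
    have : \forall w \near a, (T @` U) w by exact: open_nbhs_nbhs.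
    by apply: filterS => _ [u Uu <-]; rewrite gT.
  have dg := smooth_at_differentiable sga.
  have dT : differentiable T (g a) by exact: smooth_at_differentiable.
  have D := derive_comp v dg dT.
  have D1 : 'D_v (T \o g) a = v.
    by rewrite -[RHS](@derive_id _ _ a v); exact: (near_eq_derive v TgE).
  have D0 : 'D_v g a = 0 by rewrite deriveE.
  by rewrite -D1 D D0 derive0.
have N' : nbhs p (fun q => [/\ N q, smoothM f q, cdom c q & [/\ U (cmap c q),
    (T @` U) (cmap c q) & V (cmap c q) = V0 (cmap c q)]]).
  have h1 : \forall u \near a, U u by exact: open_nbhs_nbhs.
  have h2 : \forall u \near a, (T @` U) u by exact: open_nbhs_nbhs.
  have h3 : \forall u \near a, [/\ U u, (T @` U) u & V u = V0 u].
    by apply: filterS3 h1 h2 VV0 => u.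
  apply: filterS2 (filterI pN (smoothM_nbhs sf)) (filterI (chart_nbhs cp) (cmap_near cp h3)).
  by move=> q [Nq sq] [cq hq].
have [c' [e [mc' c'p c'N c'E [e0 rng]]]] := new_chart mc cp N' sga gainj.
have c'E' q : cdom c' q -> cmap c' q = g (cmap c q) by move=> cq; apply: c'E; rewrite inE.
exists c', e; split; first by split=> // q /c'N[cq []].
split.
- move=> q c'q; have [cq [_ _ _ [Uq [u Uu Tu] _]]] := c'N q c'q; rewrite c'E' //.
  have -> : g (cmap c q) = u by rewrite -Tu gT.
  case=> h; last by rewrite -Tu /T (flow_box_id sV VK).
  have TU : T (cmap c q) = cmap c q by exact: (flow_box_id sV VK h).
  by have e1 := gT _ Uq; rewrite TU -Tu gT // in e1; rewrite -Tu.
- by move=> q /c'N[_ []].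
move=> q j c'q; have [cq [_ _ _ [Uq [u Uu Tu] VVq]]] := c'N q c'q.
have sgq : smooth_at g (cmap c q) by apply: sg; exists u.
have sgj : smooth_at (fun w => g w 0 j) (cmap c q) by exact: smooth_at_coord.
rewrite (@bracket_near_eqr f _ ((fun w => g w 0 j) \o cmap c)); last first.
  by apply: filterS (chart_nbhs c'q) => z c'z; rewrite /ccoord c'E'.
rewrite bracket_comp //; last exact: smoothM_cmap.
have -> : \sum_i 'D_(delta_mx 0 i) (fun w => g w 0 j) (cmap c q) * brk f (fun x => cmap c x 0 i) q =
    'D_(V (cmap c q)) (fun w => g w 0 j) (cmap c q).
  rewrite [RHS]derive_rV; last exact: smooth_at_differentiable.
  apply: eq_bigr => i _; rewrite VVq mxE cmapK_dom // mulrC.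
  by [].
(* [V] is the k-th partial derivative of the flow box, so by the chain rule the derivative of [g]
   along [V] is the k-th derivative of [g] after [T], which is the identity. *)
rewrite -Tu -/T -[V (T u)](derive_flow_box k sV VK).
have dT : differentiable T u by exact: smooth_at_differentiable.
have dgj : differentiable (fun w => g w 0 j) (T u) by rewrite Tu; exact: smooth_at_differentiable.
rewrite -(derive_comp (delta_mx 0 k) dT dgj).
rewrite (near_eq_derive (g := rV_coord j)); last first.
  by apply: filterS (gTnear u Uu) => w /= ->.
rewrite deriveE; last by apply: linear_differentiable; exact: rV_coord_continuous.
rewrite diff_lin; last exact: rV_coord_continuous.
by rewrite -[LHS]/((delta_mx 0 k : 'rV[R]_n) 0 j) mxE eqxx.
Qed.

(* {f, .} is the k-th partial derivative in the chart, and by the Jacobi identity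
   it annihilates the coefficients of pi. *)
Lemma bracket_straight f c k p h : maximal_atlas c -> cdom c p ->
  (forall j, brk f (ccoord c j) p = (j == k)%:R) -> smoothM h p ->
  brk f h p = 'D_(delta_mx 0 k) (h \o cinv c) (cmap c p).
Proof.
move=> mc cp fj sh; rewrite (bracket_chart f mc cp sh) (bigD1 k) //= fj eqxx mulr1.
by rewrite big1 ?addr0 // => j jk; rewrite fj (negbTE jk) mulr0.
Qed.

Lemma bracket_straight_const f c k p a b : maximal_atlas c -> cdom c p ->
  (forall q, cdom c q -> smoothM f q) ->
  (forall q j, cdom c q -> brk f (ccoord c j) q = (j == k)%:R) ->
  'D_(delta_mx 0 k) (brk (ccoord c a) (ccoord c b) \o cinv c) (cmap c p) = 0.
Proof.
move=> mc cp sf fj.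
have sc j : smoothM (ccoord c j) p by exact: smoothM_ccoord.
rewrite -(@bracket_straight f) //; last 2 first.
- by move=> j; apply: fj.
- exact: smoothM_bracket.
have := bracket_jacobi (sf p cp) (sc a) (sc b).
have cst j (s : R) : \forall q \near p, s * brk f (ccoord c j) q = s * (j == k)%:R.
  by apply: filterS (chart_nbhs cp) => q cq; rewrite fj.
(* The other two Jacobi terms contain a bracket of [f] with a coordinate, which is locally
   constant. *)
rewrite (@bracket_near_eqr (ccoord c a) _ (fun=> -1 * (b == k)%:R)); last first.
  by apply: filterS (cst b (-1)) => q <-; rewrite bracket_antisym mulN1r.
rewrite [X in _ + X](@bracket_near_eqr (ccoord c b) _ (fun=> 1 * (a == k)%:R)); last first.
  by apply: filterS (cst a 1) => q <-; rewrite mul1r.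
by rewrite !bracket_cst !addr0.
Qed.

End bracket.

Section prelim.
Context {R : realType}.

Lemma left_inverse_diff_inj (V W : normedModType R) (f : V -> W) (g : W -> V) a v :
  differentiable f a -> differentiable g (f a) -> (\forall x \near a, g (f x) = x) ->
  'd f a v = 0 -> v = 0.
Proof.
move=> df dg gf dv.
have D1 : 'D_v (g \o f) a = v.
  by rewrite -[RHS](@derive_id _ _ a v); exact: (near_eq_derive v gf).
have D0 : 'D_v f a = 0 by rewrite deriveE.
by rewrite -D1 (derive_comp v df dg) D0 derive0.
Qed.

Lemma rV_norm_coord_le n (a b : 'rV[R]_n) : (forall j, `|a 0 j| <= `|b 0 j|) -> `|a| <= `|b|.
Proof. by move=> h; apply: rV_norm_le => // j; apply: le_trans (h j) (rV_coord_le _ _). Qed.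

Lemma derive_scale_dir (V W : normedModType R) (f : V -> W) a (s : R) v :
  differentiable f a -> 'D_(s *: v) f a = s *: 'D_v f a.
Proof. by move=> df; rewrite !deriveE // linearZ. Qed.

Lemma le0_geometric (x B : R) : (forall m : nat, x <= B / 2 ^+ m) -> x <= 0.
Proof.
move=> h; rewrite leNgt; apply/negP => x0.
set m := (Num.truncn (B / x)).+1.
have := h m; rewrite ler_pdivlMr ?exprn_gt0 //; apply/negP; rewrite -ltNge.
have : B / x < m%:R by exact: truncnS_gt.
rewrite ltr_pdivrMr // => h1; apply: lt_le_trans h1 _; rewrite mulrC.
by apply: ler_wpM2l; [exact: ltW|rewrite -natrX ler_nat ltnW // ltn_expl].
Qed.

(** Both sides equal the rank of [B] minus the dimension of the part of its row space in the common
    kernel. An explicit [K] can thus replace the cokernel of the unspecified [A] of [coregular]. *)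
Lemma rank_cokermx n m (B : 'M[R]_(m, n)) (A K : 'M[R]_n) :
  (forall v : 'rV[R]_n, (v <= A)%MS <-> v *m K = 0) ->
  \rank (B *m cokermx A) = \rank (B *m K).
Proof.
move=> h; have := mxrank_mul_ker B (cokermx A); have := mxrank_mul_ker B K.
have -> : \rank (B :&: kermx K)%MS = \rank (B :&: kermx (cokermx A))%MS.
  have e : (kermx K == kermx (cokermx A))%MS.
    apply/andP; split; apply/rV_subP => v.
      by move=> /sub_kermxP/h; rewrite submxE => /eqP vA; apply/sub_kermxP.
    by move=> /sub_kermxP vA; apply/sub_kermxP/h; rewrite submxE vA.
  by apply/eqmx_rank/eqmxP/cap_eqmx => //; apply/eqmxP.
by move=> <- /eqP; rewrite eqn_add2r => /eqP.
Qed.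

End prelim.

(** * The Poisson submanifold saturating a coregular one *)

Section saturate.
Context {R : realType} {n : nat} {M : smoothManifoldType R n} (pi : poisson_structure M).
Implicit Types (c d : chart R n M) (p q : M) (f g h : M -> R) (X : set M).

Notation brk := (bracket (pi_mx pi)).

Definition is_slice c k X := forall q, cdom c q ->
  (X q <-> forall i : 'I_n, (k <= i)%N -> cmap c q 0 i = 0).

(** The differentials of the normal coordinates are Casimir covectors along the slice; by
    antisymmetry of pi this says that the image of pi^sharp is tangent to it. *)
Definition poisson_slice c k := forall q, cdom c q ->
  (forall i : 'I_n, (k <= i)%N -> cmap c q 0 i = 0) ->
  forall i : 'I_n, (k <= i)%N -> pi_mx pi q *m dfun (ccoord c i) q = 0.

(** Padded with zero columns to a size independent of [k]; its left kernel is the tangent space of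
    the slice. *)
Definition conormal c k q : 'M[R]_n :=
  \matrix_(a, i) if (k <= i)%N then dfun (ccoord c i) q a 0 else 0.

Definition normal_rank X q r := exists2 A : 'M[R]_n,
  (forall v, (v <= A)%MS <-> tangent_space X q v) &
  \rank (pi_mx pi q *m cokermx A) = r.

Lemma mul_conormal m (B : 'M[R]_(m, n)) c k q a i :
  (B *m conormal c k q) a i = if (k <= i)%N then (B *m dfun (ccoord c i) q) a 0 else 0.
Proof.
rewrite !mxE; case: ifP => ki; first by apply: eq_bigr => b _; rewrite !mxE ki.
by rewrite big1 // => b _; rewrite !mxE ki mulr0.
Qed.

Lemma tangent_conormal c p X k v : maximal_atlas c -> cdom c p -> is_slice c k X -> X p ->
  tangent_space X p v <-> v *m conormal c k p = 0.
Proof.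
move=> mc cp sX Xp; have T := tangent_slice v mc cp Xp sX; split.
  move=> /T h; apply/rowP => i; rewrite mul_conormal [RHS]mxE; case: ifP => // ki; exact: h.
by move=> h; apply/T => i ki; have /rowP/(_ i) := h; rewrite mul_conormal ki [RHS]mxE.
Qed.

Lemma normal_rankP c p X k r : maximal_atlas c -> cdom c p -> is_slice c k X -> X p ->
  normal_rank X p r <-> \rank (pi_mx pi p *m conormal c k p) = r.
Proof.
move=> mc cp sX Xp; have T v := tangent_conormal v mc cp sX Xp; split.
  move=> [A AT <-]; apply/esym/rank_cokermx => v.
  by split=> [/AT/T|/T/AT].
move=> <-; exists (kermx (conormal c k p)) => [v|].
  by split=> [/sub_kermxP/T|/T/sub_kermxP].
by apply: rank_cokermx => v; split=> /sub_kermxP.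
Qed.

Lemma dfun_chart_at p l : dfun (ccoord (chart_at p) l) p = delta_mx l 0.
Proof.
apply/colP => i; rewrite mxE.
rewrite (near_eq_derive (g := rV_coord l)); last first.
  by apply: filterS (crng_nbhs (mem_chart_at p)) => u ru; rewrite /= /ccoord cinvK_rng.
rewrite deriveE; last by apply: linear_differentiable; exact: rV_coord_continuous.
rewrite diff_lin; last exact: rV_coord_continuous.
by rewrite -[LHS]/((delta_mx 0 i : 'rV[R]_n) 0 l) !mxE !eqxx andbT eq_sym.
Qed.

Lemma poisson_slice_bracket c k f q (i : 'I_n) : poisson_slice c k -> cdom c q ->
  (forall i : 'I_n, (k <= i)%N -> cmap c q 0 i = 0) -> (k <= i)%N ->
  brk f (ccoord c i) q = 0.
Proof.
by move=> pc cq cz ki; rewrite /bracket /bivector -mulmxA (pc q cq cz i ki) mulmx0 mxE.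
Qed.

(** Brings a chosen normal coordinate to the first normal position, so that the flow-out along it is
    again given by the vanishing of the last coordinates. *)
Lemma swap_chart c p (i k : 'I_n) : maximal_atlas c -> cdom c p ->
  exists c', [/\ maximal_atlas c', cdom c' p, cdom c' `<=` cdom c &
    forall q j, cdom c' q -> cmap c' q 0 j = cmap c q 0 (tperm i k j)].
Proof.
move=> mc cp; pose H (u : 'rV[R]_n) : 'rV[R]_n := \row_j u 0 (tperm i k j).
have sH u : smooth_at H u.
  by apply: smooth_at_row => j; apply: smooth_at_coord; exact: smooth_at_id.
have HK u : H (H u) = u by apply/rowP => j; rewrite !mxE tpermK.
have iH v : 'd H (cmap c p) v = 0 -> v = 0.
  apply: left_inverse_diff_inj; [exact: smooth_at_differentiable| |exact: nbhsW HK].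
  exact: smooth_at_differentiable.
have [c' [e [mc' c'p c's c'E _]]] := new_chart mc cp (filterT : nbhs p setT) (sH _) iH.
exists c'; split=> // [q /c's[]//|q j c'q].
by rewrite c'E ?inE // mxE.
Qed.

(* On a line in the direction k the normal coordinates g of d satisfy |g'| <= L |g|
   and vanish at one point; over a short time |g| <= B implies |g| <= B / 2. *)
Lemma flow_out_sub c (k : 'I_n) f X d m x1 : maximal_atlas c -> maximal_atlas d ->
  is_slice c k X -> (forall q, cdom c q -> smoothM f q) ->
  (forall q j, cdom c q -> brk f (ccoord c j) q = (j == k)%:R) ->
  cdom c x1 -> cdom d x1 -> X x1 -> poisson_slice d m ->
  (\forall y \near x1, X y -> forall i : 'I_n, (m <= i)%N -> cmap d y 0 i = 0) ->
  \forall y \near x1, (forall i : 'I_n, (k < i)%N -> cmap c y 0 i = 0) ->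
    forall i : 'I_n, (m <= i)%N -> cmap d y 0 i = 0.
Proof.
move=> mc md sX sf fj cx dx Xx pd XQ.
set u1 := cmap c x1; set z1 := cmap d x1.
have z1i (i : 'I_n) : (m <= i)%N -> z1 0 i = 0 by exact: (nbhs_singleton XQ Xx).
have u1k : u1 0 k = 0 by exact: ((sX x1 cx).1 Xx).
pose F z := \row_i brk f (ccoord d i) (cinv d z).
have sF : smooth_at F z1.
  apply: smooth_at_row => i.
  apply: ((smoothMP (brk f (ccoord d i)) md dx).1); apply: smoothM_bracket; first exact: sf.
  exact: smoothM_ccoord.
have [L [r0 [L0 r00 FL]]] := smooth_lipschitz_at sF.
have /nbhs_ballP[r1 /= r10 r1P] := crng_nbhs dx.
pose r := Num.min r0 r1; have rp : 0 < r by rewrite lt_min r00.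
(* The projection to the Poisson slice, on which the normal components of [F] vanish; the Lipschitz
   bound then controls them by the normal coordinates of [z]. *)
pose tz (z : 'rV[R]_n) : 'rV[R]_n := \row_i if (m <= i)%N then 0 else z 0 i.
have tzb z : ball z1 r z -> ball z1 r (tz z).
  rewrite -!ball_normE /=; apply: le_lt_trans; apply: rV_norm_coord_le => j.
  by rewrite !mxE; case: ifP => // mj; rewrite z1i // subr0 normr0.
have br0 z : ball z1 r z -> ball z1 r0 z by apply: le_ball; rewrite ge_min lexx.
have br1 z : ball z1 r z -> crng d z by move=> bz; apply: r1P; apply: le_ball bz; rewrite ge_min lexx orbT.
have Fb z B (i : 'I_n) : 0 <= B -> ball z1 r z -> (m <= i)%N ->
    (forall j : 'I_n, (m <= j)%N -> `|z 0 j| <= B) -> `|F z 0 i| <= L * B.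
  move=> B0 bz mi zB.
  have Ft : F (tz z) 0 i = 0.
    rewrite mxE; have rt := br1 _ (tzb _ bz); apply: (@poisson_slice_bracket d m) => //.
      exact: cdom_cinv.
    by move=> j mj; rewrite cinvK_rng // mxE mj.
  have -> : F z 0 i = (F z - F (tz z)) 0 i by rewrite [RHS]mxE [X in _ + X]mxE Ft subr0.
  apply: le_trans (rV_coord_le _ _) _; apply: le_trans (FL _ _ (br0 _ bz) (br0 _ (tzb _ bz))) _.
  apply: ler_wpM2l; first exact: ltW.
  apply: rV_norm_le => // j; rewrite !mxE; case: ifP => [mj|]; last by rewrite subrr normr0.
  by rewrite subr0; exact: zB.
pose phi := cmap d \o cinv c.
have phi1 : phi u1 = z1 by rewrite /phi /= cmapK_dom.
have sphi1 : smooth_at phi u1 by exact: chart_transition.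
have : \forall u \near u1, [/\ crng c u, cdom d (cinv c u), ball z1 r (phi u) &
   (X (cinv c u) -> forall i : 'I_n, (m <= i)%N -> phi u 0 i = 0)].
  have h3 : \forall u \near u1, ball z1 r (phi u).
    apply: (smooth_at_continuous sphi1); rewrite phi1; exact: nbhsx_ballx.
  apply: filterS2 (filterI (crng_nbhs cx) (cinv_near cx (chart_nbhs dx))) (filterI h3 (cinv_near cx XQ)).
  by move=> u [ru du] [bu Xu].
move=> /nbhs_ballP[e0 /= e00 eP].
(* The flow time is at most 1/(2L), so that integrating a derivative bounded by L B gives at most
   B/2. *)
pose e := Num.min e0 (2 * L)^-1.
have ep : 0 < e by rewrite lt_min e00 invr_gt0 mulr_gt0.
have eb u : ball u1 e u -> ball u1 e0 u by apply: le_ball; rewrite ge_min lexx.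
have : \forall y \near x1, ball u1 e (cmap c y) by apply: cmap_near => //; exact: nbhsx_ballx.
apply: filterS2 (chart_nbhs cx) => y cy by1 yk i mi.
set u := cmap c y in by1; set s := u 0 k.
pose ek : 'rV[R]_n := delta_mx 0 k.
(* The coordinate segment from a point of X at time 0 to the given point [u] at time 1. *)
pose ut (t : R) := u - s *: ek + t *: (s *: ek).
have utj t j : ut t 0 j = if j == k then t * s else u 0 j.
  have -> : ut t 0 j = u 0 j - s * ek 0 j + t * (s * ek 0 j) by rewrite /ut !mxE.
  rewrite mxE eqxx /=; case: eqP => [->|_]; last by rewrite !mulr0 subr0 addr0.
  by rewrite !mulr1 subrr add0r.
have utb t : 0 <= t <= 1 -> ball u1 e (ut t).
  move=> /andP[t0 t1]; move: by1; rewrite -!ball_normE /=; apply: le_lt_trans.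
  apply: rV_norm_coord_le => j; rewrite mxE [X in _ + X]mxE utj.
  rewrite [X in _ <= `|X|]mxE [X in _ <= `|_ + X|]mxE.
  case: eqP => [->|//]; rewrite u1k !sub0r !normrN normrM ger0_norm //.
  by rewrite ler_piMl.
have sb : `|s| <= (2 * L)^-1.
  have h1 : `|s| <= `|u1 - u|.
    by have := rV_coord_le (u1 - u) k; rewrite mxE [X in _ + X]mxE u1k sub0r normrN.
  apply: le_trans h1 _; move: by1; rewrite -ball_normE /= => /ltW h2.
  by apply: le_trans h2 _; rewrite ge_min lexx orbT.
have X0 : X (cinv c (ut 0)).
  have [r_ _ _ _] := eP _ (eb _ (utb 0 ltac:(by rewrite lexx ler01))).
  apply/sX; first exact: cdom_cinv.
  move=> j kj; rewrite cinvK_rng // utj; case: eqP => [_|/eqP jk]; first by rewrite mul0r.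
  by apply: yk; rewrite ltn_neqAle kj andbT eq_sym.
have phi0 (j : 'I_n) : (m <= j)%N -> phi (ut 0) 0 j = 0.
  have [_ _ _ h] := eP _ (eb _ (utb 0 ltac:(by rewrite lexx ler01))).
  exact: h.
have main l : forall t (j : 'I_n), 0 <= t <= 1 -> (m <= j)%N -> `|phi (ut t) 0 j| <= r / 2 ^+ l.
  elim: l => [|l IH] t j tI mj.
    have [_ _ b _] := eP _ (eb _ (utb t tI)).
    move: b; rewrite -ball_normE /= => /ltW b; rewrite expr0 divr1; apply: le_trans b.
    have := rV_coord_le (z1 - phi (ut t)) j; rewrite mxE [X in _ + X]mxE z1i // sub0r.
    by rewrite normrN.
  have B0 : 0 <= r / 2 ^+ l by rewrite divr_ge0 ?exprn_ge0 // ltW.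
  have tt t' : 0 <= t' <= 1 -> 0 <= t' * t <= 1.
    move: tI => /andP[t0 t1] /andP[t'0 t'1]; rewrite mulr_ge0 //=.
    by rewrite -[leRHS]mulr1; apply: ler_pM.
  have utE t' : ut 0 + t' *: (t *: (s *: ek)) = ut (t' * t).
    by rewrite /ut scale0r addr0 !scalerA.
  have := @mean_value_le _ _ (fun w => phi w 0 j) (ut 0) (t *: (s *: ek)) (r / 2 ^+ l.+1).
  have -> : ut 0 + t *: (s *: ek) = ut t by rewrite /ut scale0r addr0.
  rewrite phi0 // subr0; apply=> t' t'I; rewrite utE.
    have [ru du _ _] := eP _ (eb _ (utb _ (tt _ t'I))).
    have : smoothM (ccoord d j) (cinv c (ut (t' * t))) by exact: smoothM_ccoord.
    move=> /(smoothMP _ mc (cdom_cinv ru)); rewrite cinvK_rng //.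
    exact: smooth_at_differentiable.
  have [ru du bu _] := eP _ (eb _ (utb _ (tt _ t'I))).
  have sd : smoothM (ccoord d j) (cinv c (ut (t' * t))) by exact: smoothM_ccoord.
  have dd : differentiable (fun w => phi w 0 j) (ut (t' * t)).
    move: (sd) => /(smoothMP _ mc (cdom_cinv ru)); rewrite cinvK_rng //.
    exact: smooth_at_differentiable.
  (* In the direction k the coordinates of [d] solve the autonomous equation with right-hand side
     [F]. *)
  have bs := bracket_straight mc (cdom_cinv ru) (fun j => fj _ j (cdom_cinv ru)) sd.
  rewrite cinvK_rng // in bs.
  rewrite !derive_scale_dir // /GRing.scale /= -[X in _ * (_ * X)]bs.
  have -> : brk f (ccoord d j) (cinv c (ut (t' * t))) = F (phi (ut (t' * t))) 0 j.
    by rewrite mxE /phi /= cmapK_dom.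
  rewrite !normrM; move: tI => /andP[t0 t1].
  have h1 : `|t| * (`|s| * `|F (phi (ut (t' * t))) 0 j|) <= 1 * ((2 * L)^-1 * (L * (r / 2 ^+ l))).
    apply: ler_pM => //; rewrite ?mulr_ge0 //; first by rewrite ger0_norm.
    apply: ler_pM => //; apply: Fb => // j' mj'; apply: IH => //; exact: tt.
  apply: le_trans h1 _; rewrite le_eqVlt; apply/orP; left; apply/eqP.
  have L00 : L != 0 by rewrite lt0r_neq0.
  have e2 : 2 ^+ l != 0 :> R by rewrite expf_neq0.
  by rewrite exprS; field; rewrite ?L00 ?e2.
have u1E : ut 1 = u by rewrite /ut scale1r subrK.
apply/eqP; rewrite -normr_le0; apply: (@le0_geometric _ _ r) => l.
have := main l 1 i ltac:(by rewrite ler01 lexx) mi.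
by rewrite u1E /phi /= cmapK_dom.
Qed.

(** The last clause is minimality. It is stated at all points of X in the domain and for slices of
    any dimension [l], so that it can be composed with one more flow-out and later used in both
    directions between two charts. *)
Definition saturated c k c' m X := [/\ is_slice c' k X,
  (forall q, cdom c' q -> X q -> cmap c' q = cmap c q), poisson_slice c' m &
  forall x1 d l, cdom c' x1 -> X x1 -> maximal_atlas d -> cdom d x1 ->
    poisson_slice d l ->
    (\forall y \near x1, X y -> forall i : 'I_n, (l <= i)%N -> cmap d y 0 i = 0) ->
    \forall y \near x1, (forall i : 'I_n, (m <= i)%N -> cmap c' y 0 i = 0) ->
      forall i : 'I_n, (l <= i)%N -> cmap d y 0 i = 0].

(** One flow-out: positive normal rank yields a function whose Hamiltonian field moves a normal
    coordinate; that coordinate is swapped to place k and the field straightened. *)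
Lemma saturate_step c p (k : nat) X r : maximal_atlas c -> cdom c p -> is_slice c k X -> X p ->
  (forall q, cdom c q -> X q -> normal_rank X q r.+1) ->
  exists c1 (f : M -> R) (k1 : 'I_n), [/\ maximal_atlas c1, cdom c1 p, cdom c1 `<=` cdom c,
    k = k1 & is_slice c1 k X] /\
  [/\ forall q, cdom c1 q -> X q -> cmap c1 q = cmap c q,
     forall q, cdom c1 q -> smoothM f q,
     forall q j, cdom c1 q -> brk f (ccoord c1 j) q = (j == k1)%:R &
     forall q, cdom c1 q -> (forall i : 'I_n, (k < i)%N -> cmap c1 q 0 i = 0) ->
       \rank (pi_mx pi q *m conormal c1 k.+1 q) = r].
Proof.
move=> mc cp sX Xp rX.
have rp := (normal_rankP _ mc cp sX Xp).1 (rX p cp Xp).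
(* A non-zero entry of the normal part of pi: row [l] names the coordinate of [chart_at p] taken as
   Hamiltonian, column [i] the normal coordinate it moves. *)
have [i [l [ki nz]]] : exists (i : 'I_n) (l : 'I_n), (k <= i)%N /\
    (pi_mx pi p *m dfun (ccoord c i) p) l 0 != 0.
  apply: contrapT => h; have : pi_mx pi p *m conormal c k p = 0.
    apply/matrixP => a b; rewrite mul_conormal [RHS]mxE; case: ifP => // kb.
    by apply/eqP/negPn/negP => ne; apply: h; exists b, a.
  by move=> z; move: rp; rewrite z mxrank0.
have kn : (k < n)%N by exact: leq_ltn_trans ki (ltn_ord i).
pose k1 := Ordinal kn; pose f := ccoord (chart_at p) l.
have [cs [mcs csp csc csE]] := swap_chart i k1 mc cp.
have tpk (j : 'I_n) : (k <= j)%N -> (k <= tperm i k1 j)%N by move=> kj; case: tpermP.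
have tpl (j : 'I_n) : (j < k)%N -> tperm i k1 j = j.
  move=> jk; rewrite tpermD //; apply/eqP => e; rewrite -e /= in jk.
    by rewrite ltnNge ki in jk.
  by rewrite ltnn in jk.
have csX q : cdom cs q -> X q -> cmap cs q = cmap c q.
  move=> cq Xq; have z := (sX q (csc _ cq)).1 Xq; apply/rowP => j; rewrite csE //.
  have [jk|kj] := ltnP j k; first by rewrite tpl.
  by rewrite !z // tpk.
have csX' q : cdom cs q -> (forall j : 'I_n, (k <= j)%N -> cmap cs q 0 j = 0) -> X q.
  move=> cq z; apply/(sX q (csc _ cq)) => j kj.
  by rewrite -[j](tpermK i k1) -csE // z // tpk.
have csk : cmap cs p 0 k1 = 0 by rewrite csX //; exact: ((sX p cp).1 Xp).
have bk : brk f (ccoord cs k1) p != 0.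
  rewrite (@bracket_near_eqr _ _ _ _ _ _ (ccoord c i)); last first.
    by apply: filterS (chart_nbhs csp) => q cq; rewrite /ccoord csE // tpermR.
  rewrite /bracket /f dfun_chart_at /bivector -mulmxA trmx_delta -rowE mxE.
  exact: nz.
have sf : smoothM f p by apply: smoothM_ccoord; [exact: chart_at_maximal|exact: mem_chart_at].
have [c1 [e [[mc1 c1p c1cs [e0 rng]] [c1E sf1 fj]]]] :=
  straighten mcs csp (filterT : nbhs p setT) sf csk bk.
have c1s q : cdom c1 q -> cdom cs q by move=> /c1cs[].
have s1X : is_slice c1 k X.
  move=> q cq; split=> [Xq j kj|z].
    have z := (sX q (csc _ (c1s _ cq))).1 Xq; have cE := csX q (c1s _ cq) Xq.
    by rewrite c1E //; [rewrite cE; exact: z|left; rewrite cE; exact: (z k1 (leqnn _))].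
  apply: csX' (c1s _ cq) _ => j kj.
  by rewrite -c1E //; [exact: z|right; exact: (z k1)].
exists c1, f, k1; split; first by split=> // q /c1s/csc.
split=> // [q cq Xq|q cq qz].
  rewrite c1E //; first by apply: csX => //; exact: c1s.
  have z := (sX q (csc _ (c1s _ cq))).1 Xq; have cE := csX q (c1s _ cq) Xq.
  by left; rewrite cE; exact: (z k1 (leqnn _)).
pose ek : 'rV[R]_n := delta_mx 0 k1.
(* [u0] is the foot on X of the flow line through [q]. *)
set u := cmap c1 q; pose s := u 0 k1; pose u0 := u - s *: ek.
have pk : cmap c1 p 0 k1 = 0 by exact: ((s1X p c1p).1 Xp).
have utj t j : (u0 + t *: (s *: ek)) 0 j = if j == k1 then t * s else u 0 j.
  have -> : (u0 + t *: (s *: ek)) 0 j = u 0 j - s * ek 0 j + t * (s * ek 0 j) by rewrite /u0 !mxE.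
  rewrite mxE eqxx /=; case: eqP => [->|_]; last by rewrite !mulr0 subr0 addr0.
  by rewrite !mulr1 subrr add0r.
(* The range of the chart is a ball centred at a point with vanishing k-th coordinate; shrinking
   this coordinate does not increase the supremum distance. *)
have utb t : 0 <= t <= 1 -> crng c1 (u0 + t *: (s *: ek)).
  move=> /andP[t0 t1]; rewrite rng; have := crng_cmap cq; rewrite rng -!ball_normE /=.
  apply: le_lt_trans; apply: rV_norm_coord_le => j; rewrite mxE [X in _ + X]mxE utj.
  rewrite [X in _ <= `|X|]mxE [X in _ <= `|_ + X|]mxE -/u.
  case: eqP => [->|//]; rewrite pk !sub0r !normrN normrM ger0_norm //.
  by rewrite ler_piMl.
have r0 : crng c1 u0 by have := utb 0; rewrite scale0r addr0; apply; rewrite lexx ler01.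
set q0 := cinv c1 u0; have cq0 : cdom c1 q0 by exact: cdom_cinv.
have Xq0 : X q0.
  apply/s1X => // j kj; rewrite cinvK_rng //; have := utj 0 j; rewrite scale0r addr0 => ->.
  case: eqP => [_|/eqP jk]; first by rewrite mul0r.
  by apply: qz; rewrite ltn_neqAle kj andbT eq_sym.
have const a b : brk (ccoord c1 a) (ccoord c1 b) q = brk (ccoord c1 a) (ccoord c1 b) q0.
  pose phi := brk (ccoord c1 a) (ccoord c1 b) \o cinv c1.
  have dphi t : 0 <= t <= 1 -> differentiable phi (u0 + t *: (s *: ek)).
    move=> /utb rt; have ct := cdom_cinv rt.
    have : smoothM (brk (ccoord c1 a) (ccoord c1 b)) (cinv c1 (u0 + t *: (s *: ek))).
      by apply: smoothM_bracket; exact: smoothM_ccoord.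
    move=> /(smoothMP _ mc1 ct); rewrite cinvK_rng //; exact: smooth_at_differentiable.
  have := @mean_value_le _ _ phi u0 (s *: ek) 0 dphi.
  have -> : u0 + s *: ek = u by rewrite /u0 subrK.
  rewrite /phi /= cmapK_dom // normr_le0 subr_eq0 => h; apply/eqP/h => t tI.
  rewrite derive_scale_dir; last exact: dphi.
  have rt := utb t tI; have ct := cdom_cinv rt.
  have := bracket_straight_const (pi := pi) a b mc1 ct sf1 fj.
  by rewrite cinvK_rng // => ->; rewrite scaler0 normr0.
have full z : cdom c1 z -> (jac c1 z)^T \in unitmx by move=> cz; rewrite unitmx_tr; exact: jac_unit.
pose Pk z : 'M[R]_n := (jac c1 z)^T *m (pi_mx pi z *m conormal c1 k z).
have PkE z a b : Pk z a b = if (k <= b)%N then brk (ccoord c1 a) (ccoord c1 b) z else 0.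
  rewrite /Pk mulmxA mul_conormal; case: ifP => // kb.
  rewrite /bracket /bivector !mxE; apply: eq_bigr => x _; congr (_ * _).
  by rewrite !mxE; apply: eq_bigr => y _; congr (_ * _); rewrite !mxE.
have rankPk z : cdom c1 z -> \rank (Pk z) = \rank (pi_mx pi z *m conormal c1 k z).
  move=> cz; apply/eqmx_rank/eqmxP; apply: eqmxMfull.
  by rewrite row_full_unit; exact: full.
have rk : \rank (pi_mx pi q *m conormal c1 k q) = r.+1.
  rewrite -rankPk // (_ : Pk q = Pk q0); last first.
    by apply/matrixP => a b; rewrite !PkE const.
  rewrite rankPk //; apply: (normal_rankP _ mc1 cq0 s1X Xq0).1.
  by apply: rX => //; exact/csc/c1s.
set Q := pi_mx pi q *m conormal c1 k q in rk.
(* [D] erases column [k1], and its kernel is the line of [ek]. This line lies in the row space of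
   [Q], being the row of brackets of [f], so the rank drops by exactly one. *)
pose D : 'M[R]_n := 1%:M - delta_mx k1 k1.
have QD : pi_mx pi q *m conormal c1 k.+1 q = Q *m D.
  rewrite -mulmxA; congr (_ *m _); rewrite mulmxBr mulmx1; apply/matrixP => a b.
  rewrite !mxE (bigD1 k1) //= big1 ?addr0; last first.
    by move=> j jk; rewrite !mxE (negbTE jk) mulr0.
  rewrite !mxE eqxx /= leqnn; case: (ltngtP k b) => [kb|bk'|kb].
  - have -> : (b == k1) = false by apply/eqP => e'; rewrite e' ltnn in kb.
    by rewrite mulr0 subr0.
  - have -> : (b == k1) = false by apply/eqP => e'; rewrite e' ltnn in bk'.
    by rewrite mulr0 subr0.
  - have -> : b = k1 by apply/val_inj.
    by rewrite eqxx mulr1 subrr.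
have ekQ : (ek <= Q)%MS.
  apply/submxP; exists (dfun f q)^T; apply/rowP => j; rewrite mulmxA mul_conormal.
  rewrite [LHS]mxE eqxx /=; have := fj q j cq; rewrite /bracket /bivector => ->.
  case: ifP => // kj; case: eqP => // e'; by rewrite e' leqnn in kj.
have kerD : (kermx D <= ek)%MS.
  apply/rV_subP => v /sub_kermxP; rewrite mulmxBr mulmx1 => /eqP; rewrite subr_eq0 => /eqP vE.
  apply/submxP; exists (v 0 k1)%:M; apply/rowP => j; rewrite {1}vE mul_scalar_mx !mxE.
  rewrite (bigD1 k1) //= big1 ?addr0; last first.
    by move=> j' jk; rewrite !mxE (negbTE jk) mulr0.
  by rewrite !mxE !eqxx.
have ekD : (ek <= kermx D)%MS.
  apply/sub_kermxP; rewrite mulmxBr mulmx1; apply/eqP; rewrite subr_eq0; apply/eqP.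
  by rewrite /ek mul_delta_mx.
have := mxrank_mul_ker Q D; rewrite -QD rk.
have -> : \rank (Q :&: kermx D)%MS = 1%N.
  have e' : (Q :&: kermx D == ek)%MS.
    apply/andP; split; first exact: submx_trans (capmxSr _ _) kerD.
    by rewrite sub_capmx ekQ ekD.
  by rewrite (eqmx_rank e') mxrank_delta.
by rewrite addn1 => -[].
Qed.

Lemma saturate r c p k X : maximal_atlas c -> cdom c p -> is_slice c k X -> X p ->
  (k <= n)%N -> (forall q, cdom c q -> X q -> normal_rank X q r) ->
  exists c', [/\ maximal_atlas c', cdom c' p, cdom c' `<=` cdom c, (k + r <= n)%N &
    saturated c k c' (k + r) X].
Proof.
elim: r c k X => [|r IH] c k X mc cp sX Xp kn rX.
  (* With normal rank 0 the conormal covectors along X are killed by pi: X itself is the Poisson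
     slice, and minimality is immediate. *)
  exists c; rewrite addn0; split=> //; split=> // [q cq qz i ki|x1 d l cx Xx md dx pd XQ]; last first.
    by apply: filterS2 (chart_nbhs cx) XQ => y cy h z; apply: h; exact/(sX y cy).
  have Xq : X q by apply/sX.
  have := (normal_rankP _ mc cq sX Xq).1 (rX q cq Xq) => /eqP.
  rewrite mxrank_eq0 => /eqP z; apply/colP => a.
  by have := mul_conormal (pi_mx pi q) c k q a i; rewrite ki z => <-; rewrite !mxE.
have [c1 [f [k1 [[mc1 c1p c1c kk1 s1X] [c1E sf fj rk]]]]] := saturate_step mc cp sX Xp rX.
pose X1 := [set q | cdom c1 q /\ forall i : 'I_n, (k < i)%N -> cmap c1 q 0 i = 0].
have s1X1 : is_slice c1 k.+1 X1 by move=> q cq; split=> [[]|].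
have XX1 q : cdom c1 q -> X q -> X1 q.
  by move=> cq Xq; split=> // i ki; apply: ((s1X q cq).1 Xq); exact: ltnW.
have rX1 q : cdom c1 q -> X1 q -> normal_rank X1 q r.
  by move=> cq Xq; apply/(normal_rankP _ mc1 cq s1X1 Xq); apply: rk => //; case: Xq.
have k1n : (k.+1 <= n)%N by rewrite kk1.
have [c' [mc' c'p c'c1 krn [s' c'E pc' minc']]] := IH c1 k.+1 X1 mc1 c1p s1X1 (XX1 p c1p Xp) k1n rX1.
exists c'; rewrite addnS -addSn; split=> //; first by move=> q /c'c1/c1c.
have c'X q : cdom c' q -> X q -> cmap c' q = cmap c1 q.
  by move=> cq Xq; apply: c'E => //; apply: XX1 => //; exact: c'c1.
split=> //.
- move=> q cq; split=> [Xq i ki|z].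
    by rewrite c'X //; apply: ((s1X q (c'c1 _ cq)).1 Xq).
  have X1q : X1 q by apply/s' => // i ki; apply: z; exact: ltnW.
  by apply/(s1X q (c'c1 _ cq)) => i ki; rewrite -c'E //; exact: z.
- by move=> q cq Xq; rewrite c'X // c1E //; exact: c'c1.
(* A Poisson slice containing X near [x1] contains the flow-out [X1] by [flow_out_sub], hence the
   saturation of [X1] by induction. *)
move=> x1 d l c'x Xx md dx pd XQ.
apply: minc' => //; first by apply: XX1 => //; exact: c'c1.
have := @flow_out_sub c1 k1 f X d l x1 mc1 md.
rewrite -kk1 => /(_ s1X sf fj (c'c1 _ c'x) dx Xx pd XQ).
by apply: filterS => y h [_]; exact: h.
Qed.

End saturate.

Lemma deriveM_vanish (R : realType) (V : normedModType R) (f g : V -> R) x v :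
  differentiable f x -> differentiable g x -> g x = 0 ->
  'D_v (fun y => f y * g y) x = f x * 'D_v g x.
Proof.
move=> df dg g0; rewrite [LHS](@deriveM _ _ f g); try exact: diff_derivable.
by rewrite g0 scale0r addr0.
Qed.

Lemma derive_bigsum (R : realType) (V W : normedModType R) (J : Type) (r : seq J)
    (f : J -> V -> W) x v : (forall j, differentiable (f j) x) ->
  'D_v (fun y => \sum_(j <- r) f j y) x = \sum_(j <- r) 'D_v (f j) x.
Proof.
move=> df; suff [] : differentiable (fun y => \sum_(j <- r) f j y) x /\
  'D_v (fun y => \sum_(j <- r) f j y) x = \sum_(j <- r) 'D_v (f j) x by [].
elim: r => [|j r [IH1 IH2]].
  under eq_fun do rewrite big_nil; rewrite big_nil.
  by split; [exact: differentiable_cst|exact: derive_cst].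
under eq_fun do rewrite big_cons; rewrite big_cons; split; first exact: differentiableD.
by rewrite [LHS]deriveD ?IH2 //; exact: diff_derivable.
Qed.

(** * Complements of X in P *)

Section normal_spray.
Context {R : realType} {n : nat} (I : finType) (al ph : I -> 'rV[R]_n -> R) (u0 : 'rV[R]_n).
Context (k d : nat) (kd : (k <= d)%N).

(** The projection to the slice that represents X in the chart. *)
Definition trunc (u : 'rV[R]_n) : 'rV[R]_n := \row_j if (j < k)%N then u 0 j else 0.

(** The covector at [x] that measures the displacement to [w]; [w] is normal to P at [x] when its
    components below [d] vanish. *)
Definition spray (x w : 'rV[R]_n) : 'rV[R]_n :=
  \row_a \sum_s al s x * 'D_(delta_mx 0 a) (ph s) x * (ph s w - ph s x).

Hypothesis sal : forall s, smooth_at (al s) u0.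
Hypothesis sph : forall s, smooth_at (ph s) u0.
Hypothesis al0 : forall s, 0 <= al s u0.
Hypothesis nondeg : forall v, (forall s, al s u0 != 0 -> 'D_v (ph s) u0 = 0) -> v = 0.
Hypothesis tr0 : trunc u0 = u0.

Let l (z : 'rV[R]_(n + n)) : 'rV[R]_n := lsubmx z.
Let r (z : 'rV[R]_(n + n)) : 'rV[R]_n := rsubmx z.
Let z0 : 'rV[R]_(n + n) := row_mx u0 u0.
Let lz0 : l z0 = u0. Proof. exact: row_mxKl. Qed.
Let rz0 : r z0 = u0. Proof. exact: row_mxKr. Qed.
Let sl z : smooth_at l z. Proof. exact: smooth_at_lsubmx. Qed.
Let sr z : smooth_at r z. Proof. exact: smooth_at_rsubmx. Qed.
Let E (z : 'rV[R]_(n + n)) := spray (l z) (r z).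

(** The derivative of [spray] in its second argument on the diagonal, i.e. the metric pulled back by
    the weighted map with components [ph]. *)
Definition gram : 'M[R]_n :=
  \matrix_(b, a) \sum_s al s u0 * 'D_(delta_mx 0 a) (ph s) u0 * 'D_(delta_mx 0 b) (ph s) u0.

Let dph s : differentiable (ph s) u0. Proof. exact: smooth_at_differentiable. Qed.

Let sfl (f : 'rV[R]_n -> R) : smooth_at f u0 -> smooth_at (fun z => f (l z)) z0.
Proof. by move=> sf; apply: (@smooth_at_compR _ _ _ l f); rewrite ?lz0. Qed.

Let sfr (f : 'rV[R]_n -> R) : smooth_at f u0 -> smooth_at (fun z => f (r z)) z0.
Proof. by move=> sf; apply: (@smooth_at_compR _ _ _ r f); rewrite ?rz0. Qed.

Let sE : smooth_at E z0.
Proof.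
apply: smooth_at_row => a; apply: smooth_at_sum => s _.
apply: smooth_atM; first apply: smooth_atM.
- exact: sfl.
- by apply: (sfl (f := 'D_(delta_mx 0 a) (ph s))); exact: smooth_at_derive.
- by apply: smooth_atB; [exact: sfr|exact: sfl].
Qed.

(** The difference [ph s w - ph s x] vanishes on the diagonal, so only this factor contributes to
    the derivative. *)
Let dE h : 'd E z0 h = (r h - l h) *m gram.
Proof.
have dEz : differentiable E z0 by exact: smooth_at_differentiable.
rewrite -deriveE //; apply/rowP => a.
rewrite -[LHS]/(rV_coord a _) -(derive_lin_comp (L := rV_coord a)) //; last exact: rV_coord_continuous.
pose T s (z : 'rV[R]_(n + n)) := al s (l z) * 'D_(delta_mx 0 a) (ph s) (l z) * (ph s (r z) - ph s (l z)).
have sf s : smooth_at (fun z => al s (l z) * 'D_(delta_mx 0 a) (ph s) (l z)) z0.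
  by apply: smooth_atM; [exact: sfl|apply: (sfl (f := 'D_(delta_mx 0 a) (ph s))); exact: smooth_at_derive].
have sg s : smooth_at (fun z => ph s (r z) - ph s (l z)) z0.
  by apply: smooth_atB; [exact: sfr|exact: sfl].
have sT s : smooth_at (T s) z0 by exact: smooth_atM.
have -> : (fun z => rV_coord a (E z)) = (fun z => \sum_s T s z).
  by apply/funext => z; rewrite -[LHS]/(E z 0 a) mxE.
rewrite derive_bigsum; last by move=> s; exact: smooth_at_differentiable.
have dT s : 'D_h (T s) z0 = al s u0 * 'D_(delta_mx 0 a) (ph s) u0 * 'D_(r h - l h) (ph s) u0.
  rewrite [LHS]deriveM_vanish; try exact: smooth_at_differentiable; last by rewrite lz0 rz0 subrr.
  rewrite lz0; congr (_ * _).
  have dl : 'D_h l z0 = l h.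
    by rewrite [LHS](derive_lin_comp (L := @lsubmx _ 1 n n)) ?derive_id //; first by move=> u; exact: smooth_at_continuous.
  have dr : 'D_h r z0 = r h.
    by rewrite [LHS](derive_lin_comp (L := @rsubmx _ 1 n n)) ?derive_id //; first by move=> u; exact: smooth_at_continuous.
  have dL : 'D_h (fun z => ph s (l z)) z0 = 'D_(l h) (ph s) u0.
    by rewrite [LHS](@derive_comp _ _ _ _ l) ?lz0 ?dl //; exact: smooth_at_differentiable.
  have dR : 'D_h (fun z => ph s (r z)) z0 = 'D_(r h) (ph s) u0.
    by rewrite [LHS](@derive_comp _ _ _ _ r) ?rz0 ?dr //; exact: smooth_at_differentiable.
  rewrite [LHS]deriveB; try by apply: diff_derivable; apply: smooth_at_differentiable; first [exact: sfr|exact: sfl].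
  by rewrite dL dR !deriveE // linearB.
under eq_bigr => s _ do rewrite dT.
rewrite mxE; under [RHS]eq_bigr => b _ do rewrite [X in _ * X]mxE mulr_sumr.
rewrite exchange_big /=; apply: eq_bigr => s _.
rewrite (derive_rV (r h - l h) (dph s)) mulr_sumr; apply: eq_bigr => b _.
by rewrite /GRing.scale /= mulrCA.
Qed.

(** The form is a sum of squares with non-negative weights: every term vanishes, and [nondeg]
    concludes. *)
Let gram_pos (v : 'rV[R]_n) : (v *m gram *m v^T) 0 0 = 0 -> v = 0.
Proof.
have -> : (v *m gram *m v^T) 0 0 = \sum_s al s u0 * 'D_v (ph s) u0 ^+ 2.
  rewrite mxE; under eq_bigr => a _ do rewrite mxE mulr_suml.
  rewrite exchange_big /=.
  under eq_bigr => b _. 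
    under eq_bigr => a _ do rewrite !mxE mulr_sumr mulr_suml.
    rewrite exchange_big /=; over.
  rewrite exchange_big /=; apply: eq_bigr => s _.
  rewrite derive_rV // expr2 big_distrlr /= mulr_sumr; apply: eq_bigr => b _.
  rewrite mulr_sumr; apply: eq_bigr => a _; rewrite /GRing.scale /=.
  by ring.
move=> h; apply: nondeg => s as0.
have : al s u0 * 'D_v (ph s) u0 ^+ 2 = 0.
  have ge s' : true -> 0 <= al s' u0 * 'D_v (ph s') u0 ^+ 2 by rewrite mulr_ge0 // sqr_ge0.
  by move/eqP: h; rewrite psumr_eq0 // => /allP/(_ s); rewrite mem_index_enum => /(_ isT)/eqP.
by move/eqP; rewrite mulf_eq0 (negbTE as0) /= sqrf_eq0 => /eqP.
Qed.

Let strunc u : smooth_at trunc u.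
Proof.
apply: (@smooth_at_row _ _ n (fun j (u : 'rV[R]_n) => if (j < k)%N then u 0 j else 0)) => j.
case: (j < k)%N; last exact: (@smooth_at_cst R 'rV[R]_n R 0 u).
by apply: smooth_at_coord; exact: smooth_at_id.
Qed.

Lemma truncK u : trunc (trunc u) = trunc u.
Proof. by apply/rowP => j; rewrite !mxE; case: (j < k)%N. Qed.

Let dtrunc u h : 'd trunc u h = trunc h.
Proof.
have dt : differentiable trunc u by exact: smooth_at_differentiable.
rewrite -deriveE //; apply/rowP => j.
rewrite -[LHS]/(rV_coord j _) -(derive_lin_comp (L := rV_coord j)) //; last exact: rV_coord_continuous.
rewrite mxE; case: ifP => jk.
  have -> : (fun z => rV_coord j (trunc z)) = rV_coord j.
    by apply/funext => z; rewrite -[LHS]/(trunc z 0 j) mxE jk.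
  rewrite deriveE; last by apply: linear_differentiable; exact: rV_coord_continuous.
  by rewrite diff_lin //; exact: rV_coord_continuous.
have -> : (fun z => rV_coord j (trunc z)) = fun=> 0; last exact: derive_cst.
by apply/funext => z; rewrite -[LHS]/(trunc z 0 j) mxE jk.
Qed.

(* With E(x, w) = spray x w, the map (x, w) |-> (x, E(x, w)) is invertible near the
   diagonal.  Let Xi u be the w with E(trunc u, w) = u - trunc u: then H is the
   inverse t of Xi in the directions a, k <= a < d, and rho = trunc o t. *)
Lemma normal_spray_chart : exists H rho : 'rV[R]_n -> 'rV[R]_n,
  [/\ smooth_at H u0, forall v, 'd H u0 v = 0 -> v = 0 &
    forall w (a : 'I_n), (a < k)%N || (d <= a)%N -> H w 0 a = w 0 a] /\
  [/\ \forall w \near u0, {for w, continuous rho},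
    forall w, trunc (rho w) = rho w,
    \forall w \near u0, trunc w = w -> rho w = w /\ forall a : 'I_n, (k <= a)%N -> H w 0 a = 0,
    \forall w \near u0, (forall a : 'I_n, (k <= a < d)%N -> H w 0 a = 0) ->
       forall a : 'I_n, (a < d)%N -> spray (rho w) w 0 a = 0 &
    exists2 e, 0 < e & forall x w : 'rV[R]_n, ball u0 e x -> ball u0 e w -> trunc x = x ->
      (forall a : 'I_n, (a < d)%N -> spray x w 0 a = 0) ->
      forall a : 'I_n, (k <= a < d)%N -> H w 0 a = 0].
Proof.
pose G z : 'rV[R]_(n + n) := row_mx (l z) (E z).
have sG : smooth_at G z0 by apply: smooth_at_row_mx.
have Ed w : spray w w = 0.
  by apply/rowP => a; rewrite !mxE big1 // => s _; rewrite subrr mulr0.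
have E0 : E z0 = 0 by rewrite /E lz0 rz0.
have iG v : 'd G z0 v = 0 -> v = 0.
  have dG := smooth_at_differentiable sG.
  rewrite -deriveE // => dv.
  have h1 : l v = 0.
    have := derive_lin_comp (L := @lsubmx _ 1 n n) v (fun u => smooth_at_continuous (smooth_at_lsubmx u)) dG.
    rewrite dv linear0 => <-.
    have -> : (fun z => lsubmx (G z)) = l by apply/funext => z; exact: row_mxKl.
    rewrite deriveE; last exact: smooth_at_differentiable.
    by rewrite diff_lin // => u; exact: smooth_at_continuous (smooth_at_lsubmx u).
  have h2 : 'd E z0 v = 0.
    have := derive_lin_comp (L := @rsubmx _ 1 n n) v (fun u => smooth_at_continuous (smooth_at_rsubmx u)) dG.
    rewrite dv linear0 => <-; rewrite -deriveE; last exact: smooth_at_differentiable.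
    by have -> : (fun z => rsubmx (G z)) = E by apply/funext => z; exact: row_mxKr.
  rewrite -[v]hsubmxK -/(l v) -/(r v) h1.
  rewrite (_ : r v = 0) ?row_mx0 //; apply: gram_pos.
  by move: h2; rewrite dE h1 subr0 => ->; rewrite mul0mx mxE.
have [U [Gi [[oU Uz0 _] [oGU GK sGU sGi _]]]] := inverse_function sG iG filterT.
pose y0 : 'rV[R]_(n + n) := row_mx u0 0.
have Gz0 : G z0 = y0 by rewrite /G lz0 E0.
have GUy0 : (G @` U) y0 by exists z0.
have Giy0 : Gi y0 = z0 by rewrite -Gz0 GK ?inE.
have sGi0 : smooth_at Gi y0 by exact: sGi.
pose iota u : 'rV[R]_(n + n) := row_mx (trunc u) (u - trunc u).
have siota u : smooth_at iota u.
  by apply: smooth_at_row_mx => //; apply: smooth_atB => //; exact: smooth_at_id.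
have iota0 : iota u0 = y0 by rewrite /iota tr0 subrr.
pose Xi u := r (Gi (iota u)).
have sXi : smooth_at Xi u0.
  apply: (@smooth_at_comp _ _ _ _ (Gi \o iota) r) => //.
  by apply: smooth_at_comp => //; rewrite iota0.
have Xi0 : Xi u0 = u0 by rewrite /Xi iota0 Giy0.
have nGU : \forall u \near u0, (G @` U) (iota u).
  apply: (smooth_at_continuous (siota u0)); rewrite iota0.
  exact: open_nbhs_nbhs.
have lGi y : (G @` U) y -> l (Gi y) = l y.
  by move=> [z Uz <-]; rewrite GK ?inE // /G /l row_mxKl.
have EGi y : (G @` U) y -> E (Gi y) = r y.
  by move=> [z Uz <-]; rewrite GK ?inE // /G /r row_mxKr.
have GiE y : (G @` U) y -> Gi y = row_mx (l y) (r (Gi y)).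
  by move=> gy; rewrite -[LHS]hsubmxK -/(l _) lGi.
have sprayXi : \forall u \near u0, spray (trunc u) (Xi u) = u - trunc u.
  apply: filterS nGU => u gu; have := EGi _ gu.
  by rewrite {1}GiE // /E /l /r !row_mxKl !row_mxKr.
(* The defining equation of [Xi] differentiated at the diagonal point; both injectivity arguments
   below rest on it. *)
have dXi h : h - trunc h = ('d Xi u0 h - trunc h) *m gram.
  pose K u := row_mx (trunc u) (Xi u) : 'rV[R]_(n + n).
  have sK : smooth_at K u0 by exact: smooth_at_row_mx.
  have dK := smooth_at_differentiable sK.
  have K0 : K u0 = z0 by rewrite /K Xi0 tr0.
  have dEz : differentiable E (K u0) by rewrite K0; exact: smooth_at_differentiable.
  have : 'D_h (E \o K) u0 = 'D_h (fun u => u - trunc u) u0.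
    apply: near_eq_derive; apply: filterS sprayXi => u <-.
    by rewrite /= /E /K /l /r row_mxKl row_mxKr.
  rewrite derive_comp // K0 deriveE; last exact: smooth_at_differentiable.
  have dtr : differentiable trunc u0 by exact: smooth_at_differentiable.
  have eqr : r ('D_h K u0) = 'd Xi u0 h.
    rewrite -deriveE; last exact: smooth_at_differentiable.
    rewrite -[LHS](derive_lin_comp (L := @rsubmx _ 1 n n) h (fun u => smooth_at_continuous (smooth_at_rsubmx u)) dK).
    by have -> : (fun u => rsubmx (K u)) = Xi by apply/funext => u; exact: row_mxKr.
  have eqt : 'D_h trunc u0 = trunc h by rewrite deriveE // dtrunc.
  have eql : l ('D_h K u0) = trunc h.
    rewrite -eqt.
    rewrite -[LHS](derive_lin_comp (L := @lsubmx _ 1 n n) h (fun u => smooth_at_continuous (smooth_at_lsubmx u)) dK).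
    by have -> : (fun u => lsubmx (K u)) = trunc by apply/funext => u; exact: row_mxKl.
  rewrite dE eqr eql => ->.
  rewrite deriveB; [|exact: derivable_id|exact: diff_derivable].
  by rewrite eqt; congr (_ - _); exact/esym/derive_id.
have orth (a b : 'rV[R]_n) : (forall j, a 0 j = 0 \/ b 0 j = 0) -> (a *m b^T) 0 0 = 0.
  move=> ab; rewrite mxE big1 // => j _; rewrite [X in _ * X]mxE.
  by case: (ab j) => ->; rewrite ?mul0r ?mulr0.
(* [dXi] reads: v - trunc v is minus the image of trunc v under [gram]. The two have disjoint
   supports, so pairing with trunc v and positivity give trunc v = 0. *)
have iXi v : 'd Xi u0 v = 0 -> v = 0.
  move=> dv; have := dXi v; rewrite dv sub0r mulNmx => e.
  have t0 : trunc v = 0.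
    apply: gram_pos; rewrite -[trunc v *m gram]opprK -e mulNmx mxE orth ?oppr0 // => j.
    by rewrite [(v - trunc v) 0 j]mxE [X in _ + X]mxE !mxE; case: ifP => _; [left; rewrite subrr|right].
  by apply/rowP => j; have /rowP/(_ j) := e; rewrite t0 mul0mx !mxE oppr0 addr0.
have [U2 [t [[oU2 U2u0 _] [oV tK sXi2 st _]]]] := inverse_function sXi iXi filterT.
set V := Xi @` U2 in oV st.
have Vu0 : V u0 by exists u0.
have tu0 : t u0 = u0 by rewrite -{1}Xi0 tK ?inE.
have stw w : V w -> smooth_at t w by exact: st.
have XiK w : V w -> Xi (t w) = w by move=> [u Uu <-]; rewrite tK ?inE.
have nV : \forall w \near u0, V w by exact: open_nbhs_nbhs.
have dt := smooth_at_differentiable (stw u0 Vu0).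
(* Only the coordinates normal to X inside P are replaced; keeping those from [d] on leaves P a
   slice. *)
pose H w : 'rV[R]_n := \row_a if (k <= a)%N && (a < d)%N then t w 0 a else w 0 a.
have sH : smooth_at H u0.
  by apply: smooth_at_row => a; case: (_ && _); apply: smooth_at_coord; [exact: stw|exact: smooth_at_id].
exists H, (fun w => trunc (t w)); split; split.
- exact: sH.
- move=> v; have dH := smooth_at_differentiable sH; rewrite -deriveE // => dv.
  pose h := 'D_v t u0.
  have Ha (a : 'I_n) : (if (k <= a)%N && (a < d)%N then h 0 a else v 0 a) = 0.
    have := derive_lin_comp (L := rV_coord a) v (@rV_coord_continuous _ _ _) dH.
    rewrite dv linear0; case: ifP => ka.
      have -> : (fun y => rV_coord a (H y)) = (fun y => rV_coord a (t y)).
        by apply/funext => w; rewrite -[LHS]/(H w 0 a) mxE ka.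
      by rewrite derive_lin_comp //; exact: rV_coord_continuous.
    have -> : (fun y => rV_coord a (H y)) = rV_coord a.
      by apply/funext => w; rewrite -[LHS]/(H w 0 a) mxE ka.
    rewrite deriveE; last by apply: linear_differentiable; exact: rV_coord_continuous.
    by rewrite diff_lin //; exact: rV_coord_continuous.
  have dXih : 'd Xi u0 h = v.
    have dXt : differentiable Xi (t u0) by rewrite tu0; exact: smooth_at_differentiable.
    have : 'D_v (Xi \o t) u0 = 'D_v id u0 by apply: near_eq_derive; exact: filterS XiK nV.
    rewrite derive_comp // tu0 deriveE; last exact: smooth_at_differentiable.
    by move=> ->; exact: derive_id.
  (* Again disjoint supports: h - trunc h vanishes below [k] and, by [Ha], on [k, d), while v -
     trunc h vanishes from [d] on. *)
  have := dXi h; rewrite dXih => e.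
  have vh : v - trunc h = 0.
    apply: gram_pos; rewrite -e; apply: orth => j.
    have := Ha j; rewrite !mxE; case: (ltnP j k) => jk /=.
      by rewrite subrr; left.
    by case: (ltnP j d) => jd -> ; [left|right]; rewrite subr0.
  have vE : v = trunc h by apply/eqP; rewrite -subr_eq0; apply/eqP.
  apply/rowP => j; rewrite [RHS]mxE; have := Ha j; case: (ltnP j k) => jk //= _.
  by rewrite vE mxE ltnNge jk.
- move=> w a h; rewrite mxE; case: ifP => // /andP[ka ad].
  by move: h; rewrite ltnNge ka leqNgt ad.
- apply: filterS nV => w Vw; apply: (@continuous_comp _ _ _ t trunc).
    exact: smooth_at_continuous (stw w Vw).
  exact: smooth_at_continuous.
- by move=> w; exact: truncK.
- have nU : \forall w \near u0, U (row_mx w w).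
    have sd : smooth_at (fun w : 'rV[R]_n => row_mx w w) u0.
      by apply: smooth_at_row_mx; exact: smooth_at_id.
    by apply: (smooth_at_continuous sd); exact: open_nbhs_nbhs.
  apply: filterS2 nU (open_nbhs_nbhs (conj oU2 U2u0)) => w Uw U2w trw.
  have Xiw : Xi w = w.
    rewrite /Xi (_ : iota w = G (row_mx w w)) ?GK ?inE //; first exact: row_mxKr.
    by rewrite /iota trw subrr /G /E /l /r row_mxKl row_mxKr Ed.
  have tw : t w = w by rewrite -{1}Xiw tK ?inE.
  rewrite tw trw; split=> // a ka; rewrite mxE tw if_same -trw mxE.
  by rewrite ltnNge ka.
- have n1 : \forall w \near u0, spray (trunc (t w)) (Xi (t w)) = t w - trunc (t w).
    have : nbhs (t u0) [set u | spray (trunc u) (Xi u) = u - trunc u] by rewrite tu0.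
    by move=> /(smooth_at_continuous (stw u0 Vu0)).
  apply: filterS2 nV n1 => w Vw; rewrite XiK // => -> Hw a ad.
  rewrite mxE [X in _ + X]mxE [X in _ - X]mxE; case: (ltnP a k) => ak; first by rewrite subrr.
  by have := Hw a; rewrite ak ad mxE ak ad subr0; exact.
(* If [w] is normal at [x], then u = x + spray x w truncates to [x], because k <= d, and solves Xi u
   = w; hence t w = u, which vanishes on [k, d). *)
have : \forall z \near z0, U z /\ U2 (l z + E z).
  apply: filterI; first exact: open_nbhs_nbhs.
  have sz : smooth_at (fun z => l z + E z) z0 by exact: smooth_atD.
  apply: (smooth_at_continuous sz); rewrite lz0 E0 addr0; exact: open_nbhs_nbhs.
move=> /nbhs_ballP[e /= e0 eP]; exists e => // x w bx bw trx spr a /andP[ka ad].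
have [Uz U2z] : U (row_mx x w) /\ U2 (x + spray x w).
  have := eP (row_mx x w); rewrite /E /l /r row_mxKl row_mxKr; apply.
  move: bx bw; rewrite -!ball_normE /= => bx bw.
  rewrite /z0 opp_row_mx add_row_mx.
  apply: le_lt_trans (_ : _ <= Num.max `|u0 - x| `|u0 - w|) _; last by rewrite gt_max bx bw.
  by apply: row_mx_norm; rewrite le_max ?normr_ge0 ?lexx ?orbT.
have trz : trunc (x + spray x w) = x.
  have xj j : x 0 j = if (j < k)%N then x 0 j else 0 by rewrite -{1}trx mxE.
  apply/rowP => j; rewrite [LHS]mxE [RHS]xj; case: ifP => // jk.
  by rewrite mxE spr ?addr0 //; apply: leq_trans kd.
have Xiz : Xi (x + spray x w) = w.
  rewrite /Xi (_ : iota _ = G (row_mx x w)) ?GK ?inE //; first exact: row_mxKr.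
  by rewrite /iota trz addrAC subrr add0r /G /E /l /r row_mxKl row_mxKr.
rewrite mxE ka ad /= -Xiz tK ?inE // mxE spr // addr0 -trx mxE.
by rewrite ltnNge ka.
Qed.

End normal_spray.

Section complement.
Context {R : realType} {n : nat} {M : smoothManifoldType R n}.
Implicit Types (c : chart R n M) (p q x y : M) (X P : set M).

Lemma mulmx_dfun f c p v : maximal_atlas c -> cdom c p -> smoothM f p ->
  (v *m dfun f p) 0 0 = 'D_(v *m jac c p) (f \o cinv c) (cmap c p).
Proof.
move=> mc cp sf; rewrite (@dfun_near_eq _ _ _ _ ((f \o cinv c) \o cmap c)); last first.
  by apply: filterS (chart_nbhs cp) => q cq /=; rewrite cmapK_dom.
have sfc : smooth_at (f \o cinv c) (cmap c p) by exact/smoothMP.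
rewrite dfun_comp //; last exact: smoothM_cmap.
rewrite derive_rV; last exact: smooth_at_differentiable.
rewrite mulmx_sumr summxE; apply: eq_bigr => j _.
by rewrite -scalemxAr mxE mulmx_jac_coord mulrC.
Qed.

Lemma restrict_chart c p (N : set M) : maximal_atlas c -> cdom c p -> nbhs p N ->
  exists c', [/\ maximal_atlas c', cdom c' p, cdom c' `<=` cdom c `&` N &
    forall q, cdom c' q -> cmap c' q = cmap c q].
Proof.
move=> mc cp pN.
have [v|c' [e [mc' c'p c'c c'E _]]] := new_chart mc cp pN (smooth_at_id (cmap c p)).
  by rewrite -deriveE ?derive_id //; exact: smooth_at_differentiable (smooth_at_id _).
by exists c'; split=> // q cq; rewrite c'E ?inE.
Qed.

Lemma is_slice_restrict c c' k X : is_slice c k X -> cdom c' `<=` cdom c ->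
  (forall q, cdom c' q -> cmap c' q = cmap c q) -> is_slice c' k X.
Proof. by move=> sX c'c c'E q cq; rewrite c'E //; exact: sX (c'c _ cq). Qed.

(** A substitute for an embedding in Euclidean space: countably many maps with locally finite
    weights, one of positive weight being an immersion at each point. [N x] bounds the indices whose
    weight does not vanish near [x]. *)
Lemma embedding_family : exists (al : nat -> M -> R) (g : nat -> M -> 'rV[R]_n) (N : M -> nat),
  [/\ forall i q, smoothM (al i) q, forall i q, smoothM (g i) q, forall i q, 0 <= al i q,
    forall x, \forall y \near x, forall i, (N x <= i)%N -> al i y = 0 &
    forall x, exists i, [/\ (i < N x)%N, al i x != 0 &
      forall v : 'rV[R]_n, (forall j, (v *m dfun (fun q => g i q 0 j) x) 0 0 = 0) -> v = 0]].
Proof.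
have [[x0 _]|M0] := pselect (exists x : M, True); last first.
  exists (fun _ _ => 0), (fun _ _ => 0), (fun=> 0%N); split=> // [i q|i q|x|x].
  - exact: smoothM_cst.
  - exact: smoothM_cst.
  - by case: M0; exists x.
  - by case: M0; exists x.
have /choice[G GP] : forall p, exists g : M -> 'rV[R]_n, (forall q, smoothM g q) /\
    \forall q \near p, g q = cmap (chart_at p) q.
  move=> p; have cp := mem_chart_at p; have mc := chart_at_maximal p.
  have /choice[g gP] := fun j => smoothM_extend (smoothM_ccoord j mc cp).
  exists (fun q => \row_j g j q); split=> [q|].
    apply: smoothM_rV => j; rewrite (_ : (fun _ => _) = g j); first exact: (gP j).1.
    by apply/funext => z; rewrite mxE.
  have : \forall q \near p, forall j, g j q = ccoord (chart_at p) j q.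
    by apply: near_forall => j; exact: (gP j).2.
  by apply: filterS => q h; apply/rowP => j; rewrite mxE h.
pose U p := [set q | cdom (chart_at p) q /\ \forall z \near q, G p z = cmap (chart_at p) z].
have pU p : setT p -> nbhs p (U p).
  by move=> _; apply: filterI; [exact: chart_nbhs (mem_chart_at p)|exact: near_near (GP p).2].
have [s [b [_ sb b01 bU b1]]] := @bump_cover _ _ _ setT x0 U I pU.
have /choice[N NP] := fun x => b1 x I.
(* The product vanishes past any index with [b j q = 1], which gives local finiteness; at the first
   such index the weight is non-zero. *)
pose al i q := b i q * \prod_(j < i) (1 - b j q).
have al0 i j q : b j q = 1 -> (j < i)%N -> al i q = 0.
  by move=> bj ji; rewrite /al (bigD1 (Ordinal ji)) //= bj subrr mul0r mulr0.
exists al, (fun i => G (s i)), (fun x => (N x).+1); split.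
- move=> i q; apply: smooth_atM; first exact: sb.
  apply: smooth_at_prod => j _; apply: smooth_atB; first exact: smooth_at_cst.
  exact: sb.
- by move=> i q; exact: (GP (s i)).1.
- move=> i q; rewrite mulr_ge0 //; first by have /andP[] := b01 i q.
  by apply: prodr_ge0 => j _; rewrite subr_ge0; have /andP[] := b01 j q.
- by move=> x; apply: filterS (NP x) => y bN i; exact: al0.
move=> x; have ex : exists i, b i x == 1 by exists (N x); apply/eqP; exact: nbhs_singleton (NP x).
have [i /eqP bi min] := ex_minnP ex.
have nz : al i x != 0.
  rewrite /al bi mul1r; apply/prodf_neq0 => j _; rewrite subr_eq0 eq_sym.
  apply/negP => /min; apply/negP; rewrite -ltnNge; exact: ltn_ord.
exists i; split=> [|//|v h].
  by rewrite ltnS; apply: min; apply/eqP; exact: nbhs_singleton (NP x).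
have [cx gE] : U (s i) x by apply: bU; rewrite bi oner_neq0.
have mc := chart_at_maximal (s i).
have : v *m jac (chart_at (s i)) x = 0.
  apply/rowP => j; rewrite mulmx_jac_coord [RHS]mxE -[RHS](h j); congr ((_ *m _) _ _).
  by apply: dfun_near_eq; apply: filterS gE => z gz; rewrite /ccoord gz.
by move/(congr1 (mulmx^~ (invmx (jac (chart_at (s i)) x)))); rewrite mul0mx mulmxK ?jac_unit.
Qed.

Lemma complement_germs X P k d : (k <= d)%N -> (d <= n)%N ->
  (forall x, X x -> exists c, [/\ maximal_atlas c, cdom c x, is_slice c k X & is_slice c d P]) ->
  exists tau O : set M, [/\ open O, X `<=` O & forall y, O y -> exists h,
    [/\ maximal_atlas h, cdom h y, is_slice h k X, is_slice h d P &
      forall z, cdom h z -> tau z <-> forall a : 'I_n, (k <= a < d)%N -> cmap h z 0 a = 0]].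
Proof.
move=> kd dn XP; have [al [g [N [sal sg al0 alN nd]]]] := embedding_family.
pose e x y (v : 'rV[R]_n) := \sum_(i < N x) \sum_j
  al i x * (v *m dfun (fun q => g i q 0 j) x) 0 0 * (g i y 0 j - g i x 0 j).
pose perp x y := forall v, tangent_space P x v -> e x y v = 0.
have sgj i j q : smoothM (fun q => g i q 0 j) q by exact: smoothM_coord.
pose phi c (s : nat * 'I_n) u := g s.1 (cinv c u) 0 s.2.
(* In a slice chart of P the tangent vectors are those supported on the first [d] coordinates, so
   [perp] becomes the vanishing of the first [d] components of [spray]. *)
have spray_perp c x0 : maximal_atlas c -> cdom c x0 -> is_slice c d P ->
    \forall x \near x0, forall y, cdom c y -> P x ->
    perp x y <-> forall a : 'I_n, (a < d)%N ->
      spray (fun s : 'I_(N x0) * 'I_n => al s.1 \o cinv c)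
            (fun s => phi c (val s.1, s.2)) (cmap c x) (cmap c y) 0 a = 0.
  move=> mc c0 sP; apply: filterS2 (chart_nbhs c0) (alN x0) => x cx ax y cy Px.
  have eE v : e x y v = \sum_a (v *m jac c x) 0 a *
      spray (fun s : 'I_(N x0) * 'I_n => al s.1 \o cinv c)
            (fun s => phi c (val s.1, s.2)) (cmap c x) (cmap c y) 0 a.
    (* The intrinsic sum stops at [N x], the one in the chart at [N x0]; the weights at [x] vanish
       beyond either bound. *)
    have -> : e x y v = \sum_(i < N x0) \sum_j
       al i x * (v *m dfun (fun q => g i q 0 j) x) 0 0 * (g i y 0 j - g i x 0 j).
      pose F i := \sum_j al i x * (v *m dfun (fun q => g i q 0 j) x) 0 0 * (g i y 0 j - g i x 0 j).
      have F0 i : al i x = 0 -> F i = 0 by move=> z; apply: big1 => j _; rewrite z !mul0r.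
      have ext m m' : (m <= m')%N -> (forall i, (m <= i)%N -> F i = 0) ->
          \sum_(i < m) F i = \sum_(i < m') F i.
        move=> mm' h; rewrite -!(big_mkord xpredT F) (big_cat_nat _ mm') //=.
        by rewrite [X in _ + X]big1_seq ?addr0 // => i /andP[_]; rewrite mem_index_iota => /andP[/h].
      have F1 i : (N x <= i)%N -> F i = 0.
        by move=> h; apply: F0; exact: nbhs_singleton (alN x) i h.
      have F2 i : (N x0 <= i)%N -> F i = 0 by move=> h; apply: F0; exact: ax.
      rewrite -[LHS]/(\sum_(i < N x) F i) -[RHS]/(\sum_(i < N x0) F i).
      by rewrite (ext _ _ (leq_maxl (N x) (N x0)) F1) (ext _ _ (leq_maxr (N x) (N x0)) F2).
    rewrite pair_bigA /=; under [RHS]eq_bigr => a _ do rewrite [X in _ * X]mxE mulr_sumr.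
    rewrite [RHS]exchange_big /=; apply: eq_bigr => -[i j] _ /=.
    rewrite /phi /= !cmapK_dom // (mulmx_dfun _ mc cx (sgj i j x)).
    rewrite derive_rV; last by apply: smooth_at_differentiable; exact/smoothMP.
    rewrite mulr_sumr mulr_suml; apply: eq_bigr => a _.
    by rewrite /GRing.scale /=; ring.
  have T v := tangent_slice v mc cx Px sP; split=> [xy a ad|h v /T Tv].
    have ju := jac_unit mc cx; pose va := (delta_mx 0 a : 'rV[R]_n) *m invmx (jac c x).
    have vaE : va *m jac c x = delta_mx 0 a by rewrite mulmxKV.
    have : e x y va = 0.
      apply: xy; apply/T => b db; rewrite -mulmx_jac_coord vaE mxE eqxx /=.
      by case: eqP => // ba; rewrite ba leqNgt ad in db.
    rewrite eE vaE (bigD1 a) //= big1 ?addr0; last first.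
      by move=> b ba; rewrite mxE eqxx /= (negbTE ba) mul0r.
    by rewrite mxE !eqxx mul1r.
  rewrite eE big1 // => a _; have [ad|da] := ltnP a d; first by rewrite h ?mulr0.
  by rewrite mulmx_jac_coord Tv ?mul0r.
(* The piece of tau is characterized by [perp] from both sides at each point of X in the chart. The
   neighbourhood [O] is arbitrary in one half and provided by the other, so that the halves for two
   charts compose in [SS]. *)
have local x0 : exists h, X x0 -> [/\ maximal_atlas h, cdom h x0, is_slice h k X & is_slice h d P] /\
    forall x1, X x1 -> cdom h x1 ->
    (forall O, nbhs x1 O -> \forall y \near x1,
       (forall a : 'I_n, (k <= a < d)%N -> cmap h y 0 a = 0) -> exists x, [/\ X x, O x & perp x y]) /\
    (exists2 O, nbhs x1 O & \forall y \near x1, forall x, X x -> O x -> perp x y ->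
       forall a : 'I_n, (k <= a < d)%N -> cmap h y 0 a = 0).
  have [Xx0|nX] := pselect (X x0); last by exists (chart_at x0) => /nX.
  have [c [mc c0 sX sP]] := XP x0 Xx0.
  set u0 := cmap c x0.
  have XQ x : cdom c x -> X x -> P x.
    by move=> cx /(sX _ cx) z; apply/(sP _ cx) => i di; apply: z; exact: leq_trans di.
  have trX x : cdom c x -> X x <-> trunc k (cmap c x) = cmap c x.
    move=> cx; split=> [/(sX _ cx) z|z].
      by apply/rowP => j; rewrite mxE; case: ltnP => // kj; rewrite z.
    by apply/(sX _ cx) => i ki; rewrite -z mxE ltnNge ki.
  pose al' (s : 'I_(N x0) * 'I_n) := al s.1 \o cinv c.
  pose ph' (s : 'I_(N x0) * 'I_n) := phi c (val s.1, s.2).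
  have sal' s : smooth_at (al' s) u0 by apply/smoothMP.
  have sph' s : smooth_at (ph' s) u0 by apply/(smoothMP (fun q => g s.1 q 0 s.2)).
  have al'0 s : 0 <= al' s u0 by exact: al0.
  have nd' v : (forall s, al' s u0 != 0 -> 'D_v (ph' s) u0 = 0) -> v = 0.
    move=> h; have [i [iN ai iv]] := nd x0.
    have ju := jac_unit mc c0.
    have : v *m invmx (jac c x0) = 0.
      apply: iv => j; rewrite (mulmx_dfun _ mc c0 (sgj i j x0)) mulmxKV //.
      by apply: (h (Ordinal iN, j)); rewrite /al' /= cmapK_dom.
    by move/(congr1 (mulmx^~ (jac c x0))); rewrite mul0mx mulmxKV.
  have tr0 : trunc k u0 = u0 by exact/trX.
  have [H [rho [[sH iH Heq] [crho trho XH iii [e0 e00 iv]]]]] :=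
    normal_spray_chart kd sal' sph' al'0 nd' tr0.
  have [h0 [_ [mh0 h0x h0c h0E _]]] := new_chart mc c0 filterT sH iH.
  have h0cc q : cdom h0 q -> cdom c q by move=> /h0c[].
  pose Q u := [/\ {for u, continuous rho},
    trunc k u = u -> rho u = u /\ forall a : 'I_n, (k <= a)%N -> H u 0 a = 0,
    (forall a : 'I_n, (k <= a < d)%N -> H u 0 a = 0) ->
       forall a : 'I_n, (a < d)%N -> spray al' ph' (rho u) u 0 a = 0 &
    ball u0 e0 u].
  have nQ : \forall u \near u0, Q u.
    apply: filterS2 (filterI crho XH) (filterI iii (nbhsx_ballx _ _ e00)).
    by move=> u [? ?] [? ?]; split.
  have sp := spray_perp c x0 mc c0 sP.
  pose W x := [/\ Q (cmap c x), crng c (trunc k (cmap c x)), Q (trunc k (cmap c x)),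
     cdom h0 (cinv c (trunc k (cmap c x))) & \forall z \near x, forall y, cdom c y -> P z ->
     perp z y <-> forall a : 'I_n, (a < d)%N -> spray al' ph' (cmap c z) (cmap c y) 0 a = 0].
  have nW : \forall x \near x0, W x.
    have ct : {for u0, continuous (trunc k)}.
      apply: smooth_at_continuous.
      apply: (@smooth_at_row _ _ n (fun j (u : 'rV[R]_n) => if (j < k)%N then u 0 j else 0)) => j.
      case: (j < k)%N; last exact: (@smooth_at_cst R 'rV[R]_n R 0 u0).
      by apply: smooth_at_coord; exact: smooth_at_id.
    have nt (B : set 'rV[R]_n) : nbhs u0 B -> \forall x \near x0, B (trunc k (cmap c x)).
      move=> nB; apply: (cmap_near c0 (Q := fun u => B (trunc k u))).
      by apply: ct; rewrite tr0.
    have h1 : \forall x \near x0, Q (cmap c x) /\ Q (trunc k (cmap c x)).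
      exact: filterI (cmap_near c0 nQ) (nt _ nQ).
    have h2 : \forall x \near x0, crng c (trunc k (cmap c x)) /\ cdom h0 (cinv c (trunc k (cmap c x))).
      exact: filterI (nt _ (crng_nbhs c0)) (nt _ (cinv_near c0 (chart_nbhs h0x))).
    by apply: filterS3 h1 h2 (near_near sp) => x [? ?] [? ?] ?; split.
  have [h [mh hx hh0 hE0]] := restrict_chart mh0 h0x nW.
  have hW q : cdom h q -> W q by move=> /hh0[].
  have hc q : cdom h q -> cdom c q by move=> /hh0[/h0cc].
  have hE q : cdom h q -> cmap h q = H (cmap c q).
    by move=> hq; rewrite hE0 // h0E ?inE //; case: (hh0 _ hq).
  have hX : is_slice h k X.
    move=> q hq; have cq := hc _ hq; have [Qu ru Qt ht _] := hW q hq; rewrite hE //; split.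
      by move=> /(trX _ cq); case: Qu => _ h1 _ _ /h1[].
    move=> z; apply/(trX _ cq).
    (* The point and its truncation have the same image in the chart: coordinates below [k] are
       untouched, the others vanish for both. Injectivity of the chart then puts the point on X. *)
    have eH : H (trunc k (cmap c q)) = H (cmap c q).
      apply/rowP => j; have [jk|kj] := ltnP j k; last first.
        by rewrite z //; case: Qt => _ h1 _ _; apply: (h1 (truncK _ _)).2.
      by rewrite !Heq ?jk // mxE jk.
    have hq0 : cdom h0 q by case: (hh0 _ hq).
    have : cmap h0 (cinv c (trunc k (cmap c q))) = cmap h0 q.
      by rewrite !h0E ?inE //= cinvK_rng.
    move/(congr1 (cinv h0)); rewrite !cmapK_dom // => <-.
    by rewrite cinvK_rng // truncK.
  have hsP : is_slice h d P.
    move=> q hq; have cq := hc _ hq; rewrite hE //; split=> [/(sP _ cq) z i di|z].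
      by rewrite Heq ?di ?orbT // z.
    by apply/(sP _ cq) => i di; rewrite -Heq ?di ?orbT // z.
  exists h => _; split=> // x1 Xx1 hx1.
  have c1 := hc _ hx1; have [[cr1 tr1 _ _] _ _ _ sp1] := hW x1 hx1.
  have [rho1 _] := tr1 ((trX _ c1).1 Xx1).
  split.
    move=> O O1.
    have : nbhs (rho (cmap c x1)) [set u | [/\ crng c u, O (cinv c u) & forall y, cdom c y -> P (cinv c u) ->
       perp (cinv c u) y <-> forall a : 'I_n, (a < d)%N -> spray al' ph' (cmap c (cinv c u)) (cmap c y) 0 a = 0]].
      rewrite rho1; apply: filterS3 (crng_nbhs c1) (cinv_near c1 O1) (cinv_near c1 sp1).
      by move=> u; split.
    move=> /cr1/(cmap_near c1); apply: filterS2 (chart_nbhs hx1) => y hy [ru Ou pu] Hy.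
    have Xr : X (cinv c (rho (cmap c y))).
      by apply/trX; [exact: cdom_cinv|rewrite cinvK_rng].
    exists (cinv c (rho (cmap c y))); split=> //.
    apply/pu; [exact: hc|by apply: XQ => //; exact: cdom_cinv|].
    rewrite cinvK_rng //; have [[_ _ h3 _] _ _ _ _] := hW y hy.
    by apply: h3 => a; rewrite -hE //; exact: Hy.
  exists [set x | [/\ cdom c x, ball u0 e0 (cmap c x) & forall y, cdom c y -> P x ->
     perp x y <-> forall a : 'I_n, (a < d)%N -> spray al' ph' (cmap c x) (cmap c y) 0 a = 0]].
    have bq : \forall x \near x1, cdom h x by exact: chart_nbhs.
    by apply: filterS2 bq sp1 => x hx' spx; split=> //; [exact: hc|case: (hW _ hx') => -[]].
  apply: filterS (chart_nbhs hx1) => y hy x Xx [cx bx spx] pxy a ka.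
  have cy := hc _ hy; rewrite hE //.
  apply: (iv (cmap c x) (cmap c y)) => //; first by case: (hW _ hy) => -[].
    exact/(trX _ cx).
  exact: (spx y cy (XQ x cx Xx)).1 pxy.
have /choice[h hP] := local.
pose S x := [set y | forall a : 'I_n, (k <= a < d)%N -> cmap (h x) y 0 a = 0].
have XN x : X x -> nbhs x (cdom (h x)).
  by move=> /hP[[_ hx _ _] _]; exact: chart_nbhs.
have SS x x' x1 : X x -> X x' -> X x1 -> cdom (h x) x1 -> cdom (h x') x1 ->
    \forall y \near x1, S x y -> S x' y.
  move=> Xx Xx' Xx1 h1 h1'.
  have [hi _] := (hP x Xx).2 x1 Xx1 h1; have [_ [B B1 hB]] := (hP x' Xx').2 x1 Xx1 h1'.
  by apply: filterS2 (hi B B1) hB => y hy hy' /hy[z [Xz Oz pz]]; exact: hy' pz.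
have co x x1 : X x -> X x1 -> cdom (h x) x1 -> \forall y \near x1, S x y <-> S x1 y.
  move=> Xx Xx1 hx1; have [[_ h11 _ _] _] := hP x1 Xx1.
  by apply: filterS2 (SS x x1 x1 Xx Xx1 Xx1 hx1 h11) (SS x1 x x1 Xx1 Xx Xx1 h11 hx1).
have [tau [B [oB XB _ BP]]] := glue_germs XN co.
exists tau, B; split=> // y /BP[x [Xx hy tS]].
have [[mh _ sX sP] _] := hP x Xx.
have [h' [mh' h'y h'h h'E]] := restrict_chart mh hy tS.
have h'd : cdom h' `<=` cdom (h x) by move=> q /h'h[].
exists h'; split=> //; [exact: is_slice_restrict sX _ _|exact: is_slice_restrict sP _ _|].
by move=> z hz; rewrite h'E //; have [_] := h'h z hz.
Qed.

End complement.

(** * Level sets *)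

Section mask.
Context {F : fieldType}.

Definition mask n (A : pred 'I_n) : 'M[F]_n := diag_mx (\row_i (A i)%:R).

Lemma mul_mask m n (B : 'M[F]_(m, n)) (A : pred 'I_n) i j :
  (B *m mask A) i j = if A j then B i j else 0.
Proof. by rewrite mul_mx_diag !mxE; case: (A j); rewrite ?mulr1 ?mulr0. Qed.

Lemma mul_mask_eq0 n (v : 'rV[F]_n) (A : pred 'I_n) :
  v *m mask A = 0 <-> forall a, A a -> v 0 a = 0.
Proof.
split=> [/rowP z a Aa|z]; first by have := z a; rewrite mul_mask Aa [RHS]mxE.
by apply/rowP => a; rewrite mul_mask [RHS]mxE; case: ifP => // /z.
Qed.

Lemma mask_addC n (A : pred 'I_n) : mask A + mask (predC A) = 1%:M.
Proof.
apply/matrixP => i j; rewrite mxE -[mask A]mul1mx -[mask (predC A)]mul1mx !mul_mask /=.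
by case: (A j); rewrite ?addr0 ?add0r.
Qed.

(** Only the upper bound is computed; for [A] and its complement the masks add up to the identity,
    which forces equality. *)
Lemma rank_mask n (A : pred 'I_n) : \rank (mask A) = #|A|.
Proof.
have ub (B : pred 'I_n) : (\rank (mask B) <= #|B|)%N.
  have -> : mask B = \sum_(i | B i) delta_mx i i.
    apply/matrixP => i j; rewrite -[mask B]mul1mx mul_mask summxE mxE.
    case: ifP => Bj; last first.
      rewrite big1 // => l Bl; rewrite mxE; case: (j =P l) => [jl|_]; last by rewrite andbF.
      by rewrite jl Bl in Bj.
    rewrite (bigD1 j) //= mxE eqxx andbT big1 ?addr0 // => l /andP[_ lj].
    by rewrite mxE [j == l]eq_sym (negbTE lj) andbF.
  rewrite -sum1_card; elim/big_ind2 : _ => [|a x b y xa yb|i _].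
  - by rewrite mxrank0.
  - by apply: leq_trans (mxrank_add _ _) _; exact: leq_add.
  - by rewrite mxrank_delta.
apply/eqP; rewrite eqn_leq ub /= -(leq_add2r #|predC A|) cardC card_ord.
rewrite -{1}(mxrank1 F n) -(mask_addC A); apply: leq_trans (mxrank_add _ _) _.
by rewrite leq_add2l ub.
Qed.

Lemma card_ord_range n k d : (d <= n)%N -> #|[pred a : 'I_n | (k <= a < d)%N]| = (d - k)%N.
Proof.
move=> dn; rewrite -sum1_card (eq_bigl (fun a : 'I_n => (k <= a < d)%N)) //.
have [kd|dk] := leqP k d; last first.
  rewrite big1 => [|a /andP[ka ad]]; first by apply/esym/eqP; rewrite subn_eq0 ltnW.
  by have := leq_ltn_trans ka ad; rewrite ltnNge ltnW.
rewrite -(big_mkord (fun a => (k <= a < d)%N) (fun=> 1%N)).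
under eq_bigl => a do rewrite andbC.
rewrite -(@big_nat_widenl _ _ _ k 0 n (fun a => (a < d)%N)) //.
by rewrite -(@big_nat_widen _ _ _ k d n xpredT) // sum_nat_const_nat muln1.
Qed.

Lemma mul_pid_eq0 n N m (v : 'rV[F]_n) : (m <= N)%N ->
  v *m (pid_mx m : 'M[F]_(n, N)) = 0 <-> forall j : 'I_n, (j < m)%N -> v 0 j = 0.
Proof.
move=> mN; split=> [/rowP h j jm|h].
  have := h (Ordinal (leq_trans jm mN)); rewrite [RHS]mxE mxE (bigD1 j) //= big1 => [|i ij].
    by rewrite mxE eqxx jm mulr1 addr0.
  by rewrite mxE /= (_ : (i == j :> nat) = false) ?mulr0 //; apply/negbTE.
apply/rowP => j; rewrite [RHS]mxE mxE big1 // => i _; rewrite [X in _ * X]mxE.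
by case: (ltnP i m) => im; [rewrite h ?mul0r|rewrite andbF mulr0].
Qed.

End mask.

Section slice.
Context {R : realType} {n : nat} {M : smoothManifoldType R n}.
Implicit Types (c : chart R n M) (p q : M).

Definition jacobian N (F : M -> 'rV[R]_N) p : 'M[R]_(n, N) :=
  \matrix_(i, j) dfun (fun q => F q 0 j) p i 0.

Lemma mulmx_jacobian N (F : M -> 'rV[R]_N) p v : smoothM F p ->
  v *m jacobian F p = 'D_v (F \o cinv (chart_at p)) (cmap (chart_at p) p).
Proof.
move=> sF; have dF := smooth_at_differentiable sF; apply/rowP => j.
rewrite -[RHS]/(rV_coord j _) -(derive_lin_comp (L := rV_coord j)) //; last exact: rV_coord_continuous.
rewrite -[RHS](@dfunE _ _ _ (fun q => F q 0 j)); last exact: smoothM_coord.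
by rewrite !mxE; apply: eq_bigr => i _; rewrite mxE.
Qed.

Lemma jacobian_mask c p (A : pred 'I_n) :
  jacobian (fun q => cmap c q *m mask A) p = jac c p *m mask A.
Proof.
apply/matrixP => i j; rewrite mul_mask mxE.
have -> : (fun q => (cmap c q *m mask A) 0 j) = if A j then ccoord c j else fun=> 0.
  by apply/funext => q; rewrite mul_mask; case: (A j).
by case: (A j); [rewrite [RHS]mxE|rewrite dfun_cst mxE].
Qed.

Lemma jacobian_row_mx N N' (F : M -> 'rV[R]_N) (G : M -> 'rV[R]_N') p :
  jacobian (fun q => row_mx (F q) (G q)) p = row_mx (jacobian F p) (jacobian G p).
Proof.
apply/matrixP => i j; rewrite mxE; case: (split_ordP j) => l ->.
  have -> : (fun q => row_mx (F q) (G q) 0 (lshift N' l)) = (fun q => F q 0 l).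
    by apply/funext => q; rewrite row_mxEl.
  by rewrite [RHS]row_mxEl [RHS]mxE.
have -> : (fun q => row_mx (F q) (G q) 0 (rshift N l)) = (fun q => G q 0 l).
  by apply/funext => q; rewrite row_mxEr.
by rewrite [RHS]row_mxEr [RHS]mxE.
Qed.

(* The components of F with index outside A are redundant; they allow F to be
   built by masking the coordinates of a chart. *)
Lemma slice_chart N (F : M -> 'rV[R]_N) (A : pred 'I_N) p (U : set M) :
  nbhs p U -> smoothM F p -> F p = 0 ->
  (\forall q \near p, F q *m mask A = F q) -> \rank (jacobian F p) = #|A| ->
  exists c, [/\ maximal_atlas c, cdom c p, cdom c `<=` U,
    forall q, cdom c q ->
      F q = 0 <-> forall i : 'I_n, (n - #|A| <= i)%N -> cmap c q 0 i = 0 &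
    forall v : 'rV[R]_n, (forall i : 'I_n, (n - #|A| <= i)%N -> (v *m dfun (ccoord c i) p) 0 0 = 0) <->
      v *m jacobian F p = 0].
Proof.
move=> pU sF F0 FA; set J := jacobian F p; set m := #|A| => rJ.
pose L := col_ebase J; pose Q := row_ebase J.
have JE : J = L *m pid_mx m *m Q by rewrite /L /Q -rJ mulmx_ebase.
have uL : L \in unitmx by exact: col_ebase_unit.
have uQ : Q \in unitmx by exact: row_ebase_unit.
have mn : (m <= n)%N by rewrite -rJ rank_leq_row.
have mN : (m <= N)%N by rewrite -rJ rank_leq_col.
set c0 := chart_at p; set u0 := cmap c0 p.
have cp : cdom c0 p := mem_chart_at p; have mc : maximal_atlas c0 := chart_at_maximal p.
have sF0 : smooth_at (F \o cinv c0) u0 by exact: sF.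
(* From the factorization of [J] by [L] and [Q], the second term has derivative L pid; the linear
   term adds L copid, so the total is the invertible [L]. The first [m] coordinates depend on [F]
   alone. *)
pose K (u : 'rV[R]_n) : 'rV[R]_n := (u - u0) *m (L *m copid_mx m)
   + (F \o cinv c0) u *m (invmx Q *m (pid_mx m : 'M[R]_(N, n))).
have sK : smooth_at K u0.
  by apply: smooth_atD; apply: smooth_at_mulmx => //; apply: smooth_atB;
    [exact: smooth_at_id|exact: smooth_at_cst].
have dK v : 'D_v K u0 = v *m L.
  have sl : smooth_at (fun u : 'rV[R]_n => u - u0) u0.
    by apply: smooth_atB; [exact: smooth_at_id|exact: smooth_at_cst].
  have dl := smooth_at_differentiable sl; have dF := smooth_at_differentiable sF0.
  rewrite [LHS]deriveD; try by apply: diff_derivable; apply: smooth_at_differentiable; exact: smooth_at_mulmx.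
  have -> : 'D_v (fun u => (u - u0) *m (L *m copid_mx m)) u0 = v *m (L *m copid_mx m).
    rewrite [LHS](derive_lin_comp (L := mulmxr (L *m copid_mx m)) v _ dl); last exact: linear_rV_continuous.
    congr (_ *m _); rewrite [LHS]deriveB ?derive_cst ?subr0; [exact: derive_id|exact: derivable_id|exact: derivable_cst].
  rewrite [X in _ + X](derive_lin_comp (L := mulmxr (invmx Q *m (pid_mx m : 'M[R]_(N, n)))) v _ dF); last exact: linear_rV_continuous.
  rewrite /= -mulmx_jacobian // -/J JE !mulmxA mulmxK // -!mulmxA pid_mx_id // -!mulmxDr.
  by rewrite /copid_mx subrK mulmx1.
(* Slices are given by the last coordinates, so the order is reversed. *)
pose H u : 'rV[R]_n := \row_i K u 0 (rev_ord i).
have sH : smooth_at H u0 by apply: smooth_at_row => i; exact: smooth_at_coord.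
have dH v (i : 'I_n) : ('D_v H u0) 0 i = (v *m L) 0 (rev_ord i).
  have dHd := smooth_at_differentiable sH; have dKd := smooth_at_differentiable sK.
  rewrite -dK -[LHS]/(rV_coord i _) -(derive_lin_comp (L := rV_coord i)) //; last exact: rV_coord_continuous.
  rewrite -[RHS]/(rV_coord (rev_ord i) _) -(derive_lin_comp (L := rV_coord (rev_ord i))) //; last exact: rV_coord_continuous.
  have -> : (fun u => rV_coord i (H u)) = (fun u => rV_coord (rev_ord i) (K u)).
    by apply/funext => u; rewrite -[LHS]/(H u 0 i) mxE.
  by [].
have iH v : 'd H u0 v = 0 -> v = 0.
  rewrite -deriveE; last exact: smooth_at_differentiable.
  move=> h; have vL : v *m L = 0.
    by apply/rowP => j; rewrite -[j]rev_ordK -dH h [LHS]mxE [RHS]mxE.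
  by rewrite -[v](mulmxK uL) vL mul0mx.
have JA : J *m mask A = J.
  apply/matrixP => i j; rewrite mul_mask; case: ifPn => // nA; rewrite mxE.
  rewrite (@dfun_near_eq _ _ _ _ (fun=> 0)) ?dfun_cst ?mxE //.
  by apply: filterS FA => q <-; rewrite mul_mask (negbTE nA).
(* Equal ranks make the row space of [J] that of the mask; the values of [F] near [p] thus lie in
   it, and their first [m] coordinates in [K] determine them. *)
have AJ : (mask A <= J)%MS.
  have JleA : (J <= mask A)%MS by rewrite -JA submxMl.
  by have [_] := mxrank_leqif_sup JleA; rewrite rJ rank_mask eqxx => <-.
have [c [e [mc' c'p c'U c'E _]]] := new_chart mc cp (filterI pU FA) sH iH.
have revm (i : 'I_n) : (n - m <= i)%N = (rev_ord i < m)%N.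
  by rewrite /= subnSK // !leq_subLR addnC.
exists c; split=> // [q /c'U[_ []]//|q cq|v].
  have [cq0 [_ FAq]] := c'U q cq.
  have -> : (forall i : 'I_n, (n - m <= i)%N -> cmap c q 0 i = 0) <->
      K (cmap c0 q) *m (pid_mx m : 'M[R]_(n, N)) = 0.
    rewrite mul_pid_eq0 //; split=> h i im.
      by have := h (rev_ord i); rewrite revm rev_ordK c'E ?inE // mxE rev_ordK; apply.
    by rewrite c'E ?inE // mxE; apply: h; rewrite -revm.
  rewrite mulmxDl -!mulmxA mul_copid_mx_pid // !mulmx0 add0r pid_mx_id // /= cmapK_dom //.
  split=> [->|h]; first by rewrite mul0mx.
  have /submxP[la FE] : (F q <= J)%MS by rewrite -FAq; exact: submx_trans (submxMl _ _) AJ.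
  move: h; rewrite FE JE !mulmxA mulmxK // -!mulmxA pid_mx_id // => h.
  by rewrite !mulmxA in h *; rewrite h mul0mx.
have E1 i : (v *m dfun (ccoord c i) p) 0 0 = (v *m L) 0 (rev_ord i).
  rewrite -mulmx_jac_coord mulmx_jac // -dH; congr ((_ : 'rV_n) _ _).
  apply: near_eq_derive; apply: filterS2 (crng_nbhs cp) (cinv_near cp (chart_nbhs c'p)) => u ru cu.
  by rewrite /= c'E ?inE //= cinvK_rng.
have -> : v *m J = 0 <-> v *m L *m (pid_mx m : 'M[R]_(n, N)) = 0.
  rewrite JE !mulmxA; split=> [h|->]; last by rewrite mul0mx.
  by rewrite -[LHS](mulmxK uQ) h mul0mx.
rewrite mul_pid_eq0 //; split=> h i im.
  by have := h (rev_ord i); rewrite revm rev_ordK E1 rev_ordK; apply.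
by rewrite E1; apply: h; rewrite -revm.
Qed.

End slice.

(** * Coregularity and transversals *)

Section main.
Context {R : realType} {n : nat} {M : smoothManifoldType R n} (pi : poisson_structure M).
Implicit Types (c h : chart R n M) (p q x y : M) (X P : set M).

Notation brk := (bracket (pi_mx pi)).

Definition bracket_mx c q : 'M[R]_n := \matrix_(a, b) brk (ccoord c a) (ccoord c b) q.

Lemma bracket_mxE c q : bracket_mx c q = (jac c q)^T *m pi_mx pi q *m jac c q.
Proof.
apply/matrixP => a b; rewrite mxE /bracket /bivector.
rewrite mxE [RHS]mxE; apply: eq_bigr => i _; rewrite [X in _ = _ * X]mxE; congr (_ * _).
by rewrite !mxE; apply: eq_bigr => j _; rewrite !mxE.
Qed.

Lemma conormalE c k q : conormal c k q = jac c q *m mask [pred i : 'I_n | (k <= i)%N].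
Proof. by apply/matrixP => a i; rewrite mul_mask !mxE /=; case: ifP => // _; rewrite mxE. Qed.

Lemma rank_conormal c k q : maximal_atlas c -> cdom c q -> \rank (conormal c k q) = (n - k)%N.
Proof.
move=> mc cq; rewrite conormalE (eqmxMfull _ _) ?row_full_unit ?jac_unit // rank_mask -(@card_ord_range n k n) //.
by apply: eq_card => i; rewrite !inE ltn_ord andbT.
Qed.

Lemma smoothM_mulmx_mask c p (A : pred 'I_n) : maximal_atlas c -> cdom c p ->
  smoothM (fun q => cmap c q *m mask A) p.
Proof. by move=> mc cp; apply: smooth_at_mulmx; exact: smoothM_cmap. Qed.

(** A left inverse [L] at [x] gives determinant 1 there, and the determinant stays non-zero
    nearby. *)
Lemma bracket_mx_full_near h x m (D : 'M[R]_(m, n)) : maximal_atlas h -> cdom h x ->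
  row_full (col_mx D (bracket_mx h x)) ->
  \forall y \near x, row_full (col_mx D (bracket_mx h y)).
Proof.
move=> mh hx /row_fullP[L LE].
pose f y := \det (L *m col_mx D (bracket_mx h y)).
have sC j b : smoothM (fun y => col_mx D (bracket_mx h y) j b) x.
  case: (split_ordP j) => l ->.
    apply: (@smoothM_near_eq _ _ _ R (fun=> D l b)); last exact: smoothM_cst.
    by apply: nbhsW => y; rewrite col_mxEu.
  apply: (@smoothM_near_eq _ _ _ R (brk (ccoord h l) (ccoord h b))).
    by apply: nbhsW => y; rewrite col_mxEd mxE.
  by apply: smoothM_bracket; exact: smoothM_ccoord.
have sE a b : smoothM (fun y => (L *m col_mx D (bracket_mx h y)) a b) x.
  apply: (@smoothM_near_eq _ _ _ R (fun y => \sum_j L a j * col_mx D (bracket_mx h y) j b)).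
    by apply: nbhsW => y; rewrite mxE.
  apply: smooth_at_sum => j _; apply: smooth_atM; first exact: smooth_at_cst.
  exact: sC.
have sf : smoothM f x.
  apply: smooth_at_sum => s _; apply: smooth_atM; first exact: smooth_at_cst.
  by apply: smooth_at_prod => i _; exact: sE.
have fx : nbhs (f x) [set z | z != 0].
  apply: open_nbhs_nbhs; split; first exact: open_neq.
  by rewrite /f LE det1 /= oner_neq0.
have : \forall y \near x, f y != 0 by exact: (smoothM_continuous sf fx).
apply: filterS => y fy.
rewrite -sub1mx; apply: submx_trans (submxMl L _).
by rewrite sub1mx row_full_unit unitmxE unitfE.
Qed.

(** Transversality at points of X: bracket columns from [d] on vanish since P is Poisson, so the
    normal rank [r] is carried by the d - k = r middle columns, which therefore have full rank. *)
Lemma poisson_bracket_mx_full h x k d r X P : (k + r = d)%N -> (d <= n)%N ->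
  maximal_atlas h -> cdom h x -> is_slice h k X -> is_slice h d P -> X x -> P x ->
  (forall alpha, tangent_space P x (sharp pi x alpha)) -> normal_rank pi X x r ->
  row_full (col_mx (mask [pred a : 'I_n | ~~ (k <= a < d)%N]) (bracket_mx h x)).
Proof.
move=> krd dn mh hx sX sP Xx Px PT /(normal_rankP pi _ mh hx sX Xx) rk.
set A := [pred a : 'I_n | ~~ (k <= a < d)%N]; set S := col_mx _ _.
pose B := bracket_mx h x; pose C := [pred a : 'I_n | (k <= a < d)%N].
have Bd (a b : 'I_n) : (d <= b)%N -> B a b = 0.
  move=> db; have := (tangent_slice _ mh hx Px sP).1 (PT (dfun (ccoord h a) x)) b db.
  by move=> h0; rewrite -[RHS]h0 [LHS]mxE.
pose K := B *m mask C.
have KE : K = B *m mask [pred a : 'I_n | (k <= a)%N].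
  apply/matrixP => a b; rewrite !mul_mask /=; case: (ltnP b d) => bd; rewrite ?andbT ?andbF //.
  by rewrite Bd //; case: ifP.
have rK : \rank K = r.
  rewrite KE /B bracket_mxE -!mulmxA (eqmxMfull _ _) ?row_full_unit ?unitmx_tr ?jac_unit //.
  by rewrite -conormalE.
have /submxP[Z ZE] : (mask C <= K)%MS.
  have KC : (K <= mask C)%MS by exact: submxMl.
  have [_] := mxrank_leqif_sup KC; rewrite rK rank_mask (card_ord_range k dn) -krd addKn eqxx.
  by move=> <-.
(* The components of the bracket rows outside the middle columns are removed with the rows of the
   mask. *)
have KS : (K <= S)%MS.
  apply/submxP; exists (row_mx (- (B *m mask (predC C))) 1%:M).
  rewrite mul_row_col mul1mx mulNmx -mulmxA (_ : mask (predC C) *m mask A = mask (predC C)); last first.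
    apply/matrixP => a b; rewrite mul_mask; case: ifP => // nA.
    by rewrite -[mask (predC C)]mul1mx mul_mask (_ : predC C b = A b) // nA.
  by rewrite /K -[X in _ = _ + X]mulmx1 -(mask_addC C) mulmxDr addrCA addNr addr0.
rewrite -sub1mx -(mask_addC C); apply: addmx_sub.
  by rewrite ZE; exact: submx_trans (submxMl _ _) KS.
by apply/submxP; exists (row_mx 1%:M 0); rewrite mul_row_col mul1mx mul0mx addr0.
Qed.

Lemma level_tangent N (F : M -> 'rV[R]_N) (A : pred 'I_N) S p (U : set M) :
  nbhs p U -> (forall q, U q -> S q <-> F q = 0) -> S p -> smoothM F p ->
  (forall q, F q *m mask A = F q) -> \rank (jacobian F p) = #|A| ->
  (exists c, [/\ maximal_atlas c, cdom c p & is_slice c (n - #|A|) S]) /\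
  forall v, tangent_space S p v <-> v *m jacobian F p = 0.
Proof.
move=> pU SF Sp sF FA rJ; have Fp : F p = 0 by apply/SF => //; exact: nbhs_singleton.
have [c [mc cp cU cF cT]] := slice_chart pU sF Fp (nbhsW _ FA) rJ.
have sS : is_slice c (n - #|A|) S.
  by move=> q cq; split=> [/(SF _ (cU _ cq))/(cF _ cq)|/(cF _ cq)/(SF _ (cU _ cq))].
split; first by exists c.
by move=> v; rewrite -cT; exact: tangent_slice sS.
Qed.

(** Rows of the mask are directions tangent to [T], bracket rows are Hamiltonian fields; full rank
    is transversality. [T] is cut out by middle coordinates, so [level_tangent] supplies the slice
    charts. *)
Lemma leaf_transversal_of_charts (T : set M) k d :
  (forall y, T y -> exists h, [/\ maximal_atlas h, cdom h y,
    forall z, cdom h z -> T z <-> forall a : 'I_n, (k <= a < d)%N -> cmap h z 0 a = 0 &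
    row_full (col_mx (mask [pred a : 'I_n | ~~ (k <= a < d)%N]) (bracket_mx h y))]) ->
  leaf_transversal pi T.
Proof.
move=> TP; pose A := [pred a : 'I_n | (k <= a < d)%N].
have key y : T y -> exists h, [/\ maximal_atlas h, cdom h y,
    row_full (col_mx (mask (predC A)) (bracket_mx h y)),
    exists c, [/\ maximal_atlas c, cdom c y & is_slice c (n - #|A|) T] &
    forall v, tangent_space T y v <-> v *m (jac h y *m mask A) = 0].
  move=> Ty; have [h [mh hy hT full]] := TP y Ty; exists h.
  have [||q||e1 e2] := @level_tangent n (fun q => cmap h q *m mask A) A T y (cdom h) (chart_nbhs hy) _ Ty.
  - by move=> q hq; rewrite hT // mul_mask_eq0.
  - exact: smoothM_mulmx_mask.
  - by apply/matrixP => i j; rewrite !mul_mask; case: (A j).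
  - by rewrite jacobian_mask (eqmxMfull _ _) ?row_full_unit ?jac_unit // rank_mask.
  by split=> // v; rewrite -jacobian_mask.
split.
  by exists (n - #|A|)%N; [exact: leq_subr|move=> y /key[h [_ _ _ [c ?] _]]; exists c].
move=> y /key[h [mh hy full _ hT]] v; have uJ := jac_unit mh hy.
have /submxP[l lE] : (v *m jac h y <= col_mx (mask (predC A)) (bracket_mx h y))%MS by exact: submx_full.
exists (lsubmx l *m mask (predC A) *m invmx (jac h y)), ((rsubmx l *m (jac h y)^T)^T); split.
  apply/hT; rewrite mulmxA mulmxKV //; apply/matrixP => i j; rewrite !mul_mask [RHS]mxE /=.
  by case: (k <= j < d)%N.
rewrite /sharp trmxK -[v](mulmxK uJ) lE -[l]hsubmxK mul_row_col row_mxKl row_mxKr mulmxDl.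
by rewrite bracket_mxE !mulmxA mulmxK.
Qed.

Lemma coregular_intersection X : embedded_submanifold X -> coregular pi X ->
  exists P tau : set M,
    [/\ poisson_submanifold pi P, leaf_transversal pi tau & X = P `&` tau].
Proof.
move=> [k kn kX] [r rX].
(* The bound k + r <= n comes from a point of X; for empty X, empty sets serve as P and tau. *)
have [[x0 Xx0]|X0] := pselect (exists x, X x); last first.
  have E : embedded_submanifold (set0 : set M) by exists 0%N.
  exists set0, set0; split=> //; rewrite setI0; apply/seteqP; split=> x // Xx.
  by case: X0; exists x.
have /choice[c cP] : forall x, exists c, X x -> [/\ maximal_atlas c, cdom c x, (k + r <= n)%N,
    is_slice c k X & poisson_slice pi c (k + r)] /\
    forall x1 d l, cdom c x1 -> X x1 -> maximal_atlas d -> cdom d x1 -> poisson_slice pi d l ->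
    (\forall y \near x1, X y -> forall i : 'I_n, (l <= i)%N -> cmap d y 0 i = 0) ->
    \forall y \near x1, (forall i : 'I_n, (k + r <= i)%N -> cmap c y 0 i = 0) ->
      forall i : 'I_n, (l <= i)%N -> cmap d y 0 i = 0.
  move=> x; have [Xx|nX] := pselect (X x); last by exists (chart_at x) => /nX.
  have [c [mc cx sX]] := kX x Xx.
  have [c' [mc' c'x _ krn [s' _ p' m']]] := saturate mc cx sX Xx kn (fun q _ => rX q).
  by exists c'.
set d := (k + r)%N in cP.
have dn : (d <= n)%N by have [[]] := cP x0 Xx0.
pose S x := [set y | forall i : 'I_n, (d <= i)%N -> cmap (c x) y 0 i = 0].
have XN x : X x -> nbhs x (cdom (c x)) by move=> /cP[[_ cx _ _ _] _]; exact: chart_nbhs.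
(* Minimality of one saturation against the other; exchanging the two gives equality of germs in
   [co]. *)
have SS x x' x1 : X x -> X x' -> X x1 -> cdom (c x) x1 -> cdom (c x') x1 ->
    \forall y \near x1, S x y -> S x' y.
  move=> Xx Xx' Xx1 c1 c1'; have [_ min] := cP x Xx.
  have [[mc' _ _ s' p'] _] := cP x' Xx'; apply: min => //.
  apply: filterS (chart_nbhs c1') => y cy Xy i di.
  by apply: ((s' y cy).1 Xy); exact: leq_trans (leq_addr r k) di.
have co x x1 : X x -> X x1 -> cdom (c x) x1 -> \forall y \near x1, S x y <-> S x1 y.
  move=> Xx Xx1 cx1; have [[_ c11 _ _ _] _] := cP x1 Xx1.
  by apply: filterS2 (SS x x1 x1 Xx Xx1 Xx1 cx1 c11) (SS x1 x x1 Xx1 Xx Xx1 c11 cx1).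
have [P [B [oB XB PB BP]]] := glue_germs XN co.
have charts y : B y -> exists c', [/\ maximal_atlas c', cdom c' y, is_slice c' k X,
    is_slice c' d P & poisson_slice pi c' d].
  move=> /BP[x [Xx cy PS]]; have [[mc cx _ sX pc] _] := cP x Xx.
  have [c' [mc' c'y c'c c'E]] := restrict_chart mc cy PS.
  have c'd : cdom c' `<=` cdom (c x) by move=> q /c'c[].
  exists c'; split=> //; first exact: is_slice_restrict sX _ _.
    by move=> q cq; rewrite c'E //; have [_] := c'c q cq.
  move=> q cq z i di; rewrite (@dfun_near_eq _ _ _ _ (ccoord (c x) i)); last first.
    by apply: filterS (chart_nbhs cq) => q' cq'; rewrite /ccoord c'E.
  by apply: pc => //; [exact: c'd|move=> j dj; rewrite -c'E //; exact: z].
have PT y : P y -> forall alpha, tangent_space P y (sharp pi y alpha).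
  move=> Py alpha; have [c' [mc' c'y _ sP pc']] := charts y (PB y Py).
  apply/(tangent_slice _ mc' c'y Py sP) => i di.
  by rewrite /sharp -mulmxA pc' // ?mulmx0 ?mxE //; apply: (sP y c'y).1.
have pP : poisson_submanifold pi P.
  split=> //; exists d => // y /PB/charts[c' [mc' c'y _ sP _]].
  by exists c'.
have XP x : X x -> P x.
  move=> Xx; have [c' [mc' c'x sX sP _]] := charts x (XB x Xx).
  by apply/(sP x c'x) => i di; apply: ((sX x c'x).1 Xx); exact: leq_trans (leq_addr r k) di.
have [T [B' [oB' XB' TP]]] : exists tau O : set M, [/\ open O, X `<=` O & forall y, O y -> exists h,
    [/\ maximal_atlas h, cdom h y, is_slice h k X, is_slice h d P &
      forall z, cdom h z -> tau z <-> forall a : 'I_n, (k <= a < d)%N -> cmap h z 0 a = 0]].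
  apply: complement_germs (leq_addr r k) dn _ => x /XB/charts[c' [mc' c'x sX sP _]].
  by exists c'.
(* An open neighbourhood of X on which transversality persists and a chart adapted to X, P and T
   exists; in such a chart P and T meet exactly in X. *)
pose W := [set y | exists h,
    [/\ maximal_atlas h, cdom h y, is_slice h k X, is_slice h d P &
      forall z, cdom h z -> T z <-> forall a : 'I_n, (k <= a < d)%N -> cmap h z 0 a = 0] /\
    row_full (col_mx (mask [pred a : 'I_n | ~~ (k <= a < d)%N]) (bracket_mx h y))].
have oW y : W y -> nbhs y W.
  move=> [h [[mh hy sX sP sT] full]].
  by apply: filterS2 (chart_nbhs hy) (bracket_mx_full_near mh hy full) => z hz fz; exists h.
have XW x : X x -> W x.
  move=> Xx; have [h [mh hx sX sP sT]] := TP x (XB' x Xx); exists h; split=> //.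
  apply: (poisson_bracket_mx_full (erefl : k + r = d)%N dn mh hx sX sP Xx (XP x Xx)).
    exact: PT (XP x Xx).
  exact: rX.
exists P, (T `&` W); split=> //.
  apply: (@leaf_transversal_of_charts _ k d) => y [Ty Wy].
  have [h [[mh hy _ _ sT] full]] := Wy.
  have [h' [mh' h'y h'h h'E]] := restrict_chart mh hy (oW y Wy).
  exists h'; split; [exact: mh'|exact: h'y|move=> z hz|].
    have [hz' Wz] := h'h z hz; rewrite h'E //; split=> [[Tz _]|z0]; first exact: (sT z hz').1 Tz.
    by split=> //; apply/(sT z hz').
  rewrite (_ : bracket_mx h' y = bracket_mx h y) //; apply/matrixP => a b; rewrite !mxE.
  by apply: bracket_near_eq; apply: filterS (chart_nbhs h'y) => z hz; rewrite /ccoord h'E.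
apply/seteqP; split=> [x Xx|x [Px [Tx [h [[mh hx sX sP sT] _]]]]].
  split; first exact: XP.
  have Wx := XW x Xx; split=> //; have [h [[mh hx sX sP sT] _]] := Wx.
  by apply/(sT x hx) => a /andP[ka _]; exact: (sX x hx).1 Xx a ka.
apply/(sX x hx) => a ka; have [ad|da] := ltnP a d.
  by apply: (sT x hx).1 => //; rewrite ka.
exact: (sP x hx).1 Px a da.
Qed.

Lemma intersection_coregular X P T : poisson_submanifold pi P -> leaf_transversal pi T ->
  X = P `&` T -> coregular pi X.
Proof.
move=> [[dP dPn cP] PT] [[dT dTn cT] TT] XE; exists (n - dT)%N => p.
rewrite {1}XE => -[Pp Tp].
have [c [mc cp sP]] := cP p Pp; have [t [mt tp sT]] := cT p Tp.
pose AP := [pred i : 'I_n | (dP <= i)%N]; pose AT := [pred i : 'I_n | (dT <= i)%N].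
(* The defining functions of P and tau together; by transversality their differential has rank the
   sum of the codimensions, which yields the tangent space of X as an intersection. *)
pose F q : 'rV[R]_(n + n) := row_mx (cmap c q *m mask AP) (cmap t q *m mask AT).
pose A : pred 'I_(n + n) := fun i => match fintype.split i with inl j => (dP <= j)%N | inr j => (dT <= j)%N end.
have JE : jacobian F p = row_mx (conormal c dP p) (conormal t dT p).
  by rewrite jacobian_row_mx !jacobian_mask !conormalE.
pose KP := kermx (conormal c dP p); pose KT := kermx (conormal t dT p).
have KPE v : (v <= KP)%MS <-> tangent_space P p v.
  by rewrite (tangent_conormal v mc cp sP Pp); split=> /sub_kermxP.
have KTE v : (v <= KT)%MS <-> tangent_space T p v.
  by rewrite (tangent_conormal v mt tp sT Tp); split=> /sub_kermxP.
have piKP : (pi_mx pi p <= KP)%MS.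
  apply/row_subP => i; apply/KPE; have := PT p Pp (delta_mx i 0).
  by rewrite /sharp trmx_delta -rowE.
have sum1 : \rank (KP + KT)%MS = n.
  apply/eqP; rewrite -[_ == _]/(row_full _) -sub1mx; apply/row_subP => i.
  have [u [alpha [uT ->]]] := TT p Tp (row i 1%:M).
  rewrite addrC; apply: addmx_sub_adds; last exact/KTE.
  exact: submx_trans (submxMl _ _) piKP.
pose K := kermx (jacobian F p).
have KE v : (v <= K)%MS = (v <= KP)%MS && (v <= KT)%MS.
  apply/sub_kermxP/andP => [|[/sub_kermxP vP /sub_kermxP vT]]; rewrite JE mul_mx_row.
    by move/eqP; rewrite row_mx_eq0 => /andP[/eqP ? /eqP ?]; split; apply/sub_kermxP.
  by rewrite vP vT row_mx0.
have Kcap : \rank K = \rank (KP :&: KT)%MS.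
  apply: eqmx_rank; apply/andP; split; apply/rV_subP => v; rewrite sub_capmx KE //.
have rKP : \rank KP = dP by rewrite mxrank_ker rank_conormal // subKn.
have rKT : \rank KT = dT by rewrite mxrank_ker rank_conormal // subKn.
have rK : (n + \rank K = dP + dT)%N by rewrite Kcap -{1}sum1 mxrank_sum_cap rKP rKT.
have card k : #|[pred i : 'I_n | (k <= i)%N]| = (n - k)%N.
  by rewrite -(@card_ord_range n k n) //; apply: eq_card => i; rewrite !inE ltn_ord andbT.
have cA : #|A| = (n - dP + (n - dT))%N.
  rewrite -sum1_card big_mkcond big_split_ord /= -!card -!sum1_card.
  congr (_ + _)%N; rewrite [RHS]big_mkcond; apply: eq_bigr => i _; congr (if _ then _ else _).
    by rewrite unfold_in /A (unsplitK (inl i)).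
  by rewrite unfold_in /A (unsplitK (inr i)).
have rJ : \rank (jacobian F p) = #|A|.
  have := rK; rewrite mxrank_ker cA => e; have := rank_leq_row (jacobian F p); lia.
have XF q : (cdom c `&` cdom t) q -> X q <-> F q = 0.
  rewrite XE => -[cq tq]; split=> [[/(sP q cq) zP /(sT q tq) zT]|].
    have zP' : cmap c q *m mask AP = 0 by exact/mul_mask_eq0.
    have zT' : cmap t q *m mask AT = 0 by exact/mul_mask_eq0.
    by rewrite -[F q]/(row_mx _ _) zP' zT' row_mx0.
  move/eqP; rewrite row_mx_eq0 => /andP[/eqP/mul_mask_eq0 zP /eqP/mul_mask_eq0 zT].
  by split; [apply/(sP q cq)|apply/(sT q tq)].
have Xp : X p by rewrite XE.
have sF : smoothM F p by apply: smooth_at_row_mx; exact: smoothM_mulmx_mask.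
have FA q : F q *m mask A = F q.
  apply/rowP => j; rewrite mul_mask /A; case: (split_ordP j) => i ->.
    by rewrite -[F q]/(row_mx _ _) row_mxEl mul_mask /=; case: (dP <= i)%N.
  by rewrite -[F q]/(row_mx _ _) row_mxEr mul_mask /=; case: (dT <= i)%N.
have [_ XT] := level_tangent (filterI (chart_nbhs cp) (chart_nbhs tp)) XF Xp sF FA rJ.
have XT' v : (v <= K)%MS <-> tangent_space X p v by rewrite XT; split=> /sub_kermxP.
exists K => //.
(* The rank sought is dim(im pi^sharp + T_p X) - dim T_p X. *)
have e1 := mxrank_mul_ker (pi_mx pi p) (cokermx K).
have e2 : \rank (pi_mx pi p :&: kermx (cokermx K))%MS = \rank (pi_mx pi p :&: K)%MS.
  apply: eqmx_rank; apply/andP; split; apply: capmxS => //; apply/rV_subP => v.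
    by move=> /sub_kermxP vK; rewrite submxE vK.
  by rewrite submxE => /eqP vK; apply/sub_kermxP.
have e3 := mxrank_sum_cap (pi_mx pi p) K.
(* For v tangent to P write v = u + pi^sharp(alpha) with u tangent to tau; then u = v -
   pi^sharp(alpha) is tangent to P as well, hence to X. *)
have e4 : \rank (pi_mx pi p + K)%MS = dP.
  rewrite -rKP; apply: eqmx_rank; apply/andP; split.
    rewrite addsmx_sub piKP /=; apply/rV_subP => v; by rewrite KE => /andP[].
  apply/rV_subP => v vP; have [u [alpha [uT vE]]] := TT p Tp v.
  have sP' : (sharp pi p alpha <= pi_mx pi p)%MS by exact: submxMl.
  rewrite vE addrC; apply: addmx_sub_adds => //; rewrite KE; apply/andP; split; last exact/KTE.
  have -> : u = v - sharp pi p alpha by rewrite vE addrK.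
  by apply: addmx_sub => //; rewrite eqmx_opp; exact: submx_trans sP' piKP.
move: e1 e3 rK; rewrite e2 e4.
move: (\rank (pi_mx pi p)) (\rank (pi_mx pi p *m _)) (\rank (pi_mx pi p :&: K)%MS) (\rank K).
by move=> a b a' b'; lia.
Qed.

End main.

Theorem proposition1p10 (R : realType) (n : nat) (M : smoothManifoldType R n)
    (pi : poisson_structure M) (X : set M) (hX : embedded_submanifold X) :
  coregular pi X <->
  exists P tau : set M,
    [/\ poisson_submanifold pi P, leaf_transversal pi tau & X = P `&` tau].
Proof.
split; first exact: coregular_intersection.
by move=> [P [tau [pP ttau XE]]]; exact: intersection_coregular pP ttau XE.
Qed.
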